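(* Let $\rho:\overline I\to(0,1)$. Let $(E,H)$ be the exact solution (see context), let $\tilde E,\tilde E_t\in C^1_p(\overline I,H(\operatorname{curl},\Omega))$ be approximations of $E,\partial_tE$, and let $\tilde H,\tilde H_t$ be approximations of $H,\partial_tH$ with $\tilde H(t)\in H(\operatorname{curl},\Omega)$ and $\tilde H_t(t)\in L^2(\Omega,\mathbb R^3)$ for all $t\in\overline I$. Put $e:=E-\tilde E$, $e_t:=\partial_tE-\tilde E_t$, $h:=H-\tilde H$, $h_t:=\partial_tH-\tilde H_t$, and assume $e_t(t)\in H(\overset{\circ}{\operatorname{curl}},\Omega)$ for all $t\in I$. Define the residuals $$r:=F-\tilde E_t+\varepsilon^{-1}\operatorname{curl}\tilde H,\qquad q:=G-\tilde H_t-\mu^{-1}\operatorname{curl}\tilde E,$$ and $$n(t):=\|e_t(t)\|^2_{\varepsilon,\Omega}+\rho(t)\|\operatorname{curl}e(t)\|^2_{\mu^{-1},\Omega},\qquad \hat n(t):=\rho(t)\|h_t(t)\|^2_{\mu,\Omega}+\|\operatorname{curl}h(t)\|^2_{\varepsilon^{-1},\Omega}.$$ For $Y\in C^1_p(\overline I,H(\operatorname{curl},\Omega))$ and $\gamma:\overline I\to(0,\infty)$ let $\Gamma(t):=\int_0^t\gamma(s)\,ds$, $$\tilde K:=\mu^{-1}\operatorname{curl}\tilde E-Y,\qquad\check K:=\varepsilon\partial_t\tilde E_t+\operatorname{curl}Y-K,$$ $$\begin{aligned}g(t):={}&(1-\rho(t))^{-1}\|\tilde K(t)\|^2_{\mu,\Omega}+2\langle\tilde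 K,\operatorname{curl}(\tilde E_t-\partial_t\tilde E)\rangle_{\Omega_t}\\&+\int_0^t\gamma(s)^{-1}\|\check K(s)\|^2_{\varepsilon^{-1},\Omega}\,ds+\int_0^t(\gamma(s)\rho(s))^{-1}\|(\mu^{-1}\operatorname{curl}\tilde E_t-\partial_tY)(s)\|^2_{\mu,\Omega}\,ds,\end{aligned}$$ $$z:=\|e_t(0)\|^2_{\varepsilon,\Omega}+\|\operatorname{curl}e(0)\|^2_{\mu^{-1},\Omega}+2\langle\tilde K(0),\operatorname{curl}e(0)\rangle_\Omega,\qquad f(t):=g(t)+z,$$ $$b_{Y,\gamma}(t):=\exp(\Gamma(t))\int_0^t\exp(-\Gamma(s))\gamma(s)f(s)\,ds+f(t).$$ Then $e_t-\varepsilon^{-1}\operatorname{curl}h=r$ and $h_t+\mu^{-1}\operatorname{curl}e=q$, and for all $t\in\overline I$ $$\hat n(t)\le2n(t)+2\|r(t)\|^2_{\varepsilon,\Omega}+2\|q(t)\|^2_{\mu,\Omega}\le2\inf_{Y,\gamma}b_{Y,\gamma}(t)+2\|r(t)\|^2_{\varepsilon,\Omega}+2\|q(t)\|^2_{\mu,\Omega}$$ and $$n(t)+\hat n(t)\le3\inf_{Y,\gamma}b_{Y,\gamma}(t)+2\|r(t)\|^2_{\varepsilon,\Omega}+2\|q(t)\|^2_{\mu,\Omega},$$ where the infima are taken over $\gamma:\overline I\to(0,\infty)$ and $Y\in C^1_p(\overline I,H(\operatorname{curl},\Omega))$.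
   Context: Setting. $\Omega\subset\mathbb R^3$ is a domain (connected open set, bounded or unbounded) with Lipschitz boundary; $T>0$, $I:=(0,T)$, $\Omega_t:=(0,t)\times\Omega$. $\varepsilon,\mu$ are time-independent, real, symmetric, positive definite matrix-valued functions on $\Omega$ with measurable bounded coefficients, whose inverses have the same properties. All fields are real-valued. Norms: for $\Xi=\Omega$ or $\Xi=\Omega_t$, $\langle\cdot,\cdot\rangle_\Xi$ is the $L^2(\Xi,\mathbb R^3)$ scalar product, and for such a matrix $A$, $\|\Phi\|_{A,\Xi}:=\langle A\Phi,\Phi\rangle_\Xi^{1/2}$. Spaces: $H(\operatorname{curl},\Omega):=\{\Phi\in L^2(\Omega,\mathbb R^3):\operatorname{curl}\Phi\in L^2(\Omega,\mathbb R^3)\}$ with its natural norm; $H(\overset{\circ}{\operatorname{curl}},\Omega)$ is the closure in it of the smooth compactly supported vector fields on $\Omega$ (encoding zero tangential trace). $C^\ell_p$ denotes fields that are $C^{\ell-1}$ and piecewise $C^\ell$ in time. Exact solution. Let $D:=H(\overset{\circ}{\operatorname{curl}},\Omega)\times H(\operatorname{curl},\Omega)$, $\mathcal H:=L^2(\Omega,\mathbb R^3)\times L^2(\Omega,\mathbb R^3)$, and $D_2:=\{(\Phi,\Psi)\in D:(\varepsilon^{-1}\operatorname{curl}\Psi,\mu^{-1}\operatorname{curl}\Phi)\in D\}$ (with graph norm). The data satisfy $(F,G)\in L^1(I,D_2)\cap C^0(\overline I,D)\cap C^1(\overline I,\mathcal H)$, $(E_0,H_0)\in D_2$, and $(E,H)\in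 C^0(\overline I,D_2)\cap C^1(\overline I,D)\cap C^2(\overline I,\mathcal H)$ is the unique solution of $$\partial_tE-\varepsilon^{-1}\operatorname{curl}H=F,\quad \partial_tH+\mu^{-1}\operatorname{curl}E=G,\quad E(0)=E_0,\quad H(0)=H_0.$$ Consequently $E$ satisfies $\partial_t\varepsilon\partial_tE+\operatorname{curl}\mu^{-1}\operatorname{curl}E=K$ with $K:=\varepsilon\partial_tF+\operatorname{curl}G$, $E(t)\in H(\overset{\circ}{\operatorname{curl}},\Omega)$, $E(0)=E_0$, $\partial_tE(0)=E_0':=\varepsilon^{-1}\operatorname{curl}H_0+F(0)$. *)

(* Defs.v *)
From HB Require Import structures.
From mathcomp Require Import all_boot all_order all_algebra.
From mathcomp Require Import all_classical all_reals all_analysis.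

Set Implicit Arguments.
Unset Strict Implicit.
Unset Printing Implicit Defensive.
Import Order.TTheory GRing.Theory Num.Theory.
Import numFieldNormedType.Exports.

Local Open Scope classical_set_scope.
Local Open Scope ring_scope.

(* Points of R^3 are triples, so that the library's topology, derivatives and
   product measures apply.  Vector values are columns.  An element of
   L^2(Omega, R^3) is handled through a representative R^3 -> R^3 whose values
   outside Omega are irrelevant; equality is a.e. equality in Omega (aeq). *)
Definition field (R : realType) : lmodType R := R * R * R -> 'cV[R]_3.
Definition mxfield (R : realType) : Type := R * R * R -> 'M[R]_3.

Definition leb3 (R : realType) :=
  ((@lebesgue_measure R \x @lebesgue_measure R) \x @lebesgue_measure R)%E.

Definition colv (R : realType) (x : R * R * R) : 'cV[R]_3 :=
  \col_(i < 3) (if i == 0 then x.1.1 else if i == 1 then x.1.2 else x.2).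

(* Near every boundary point, in suitable Cartesian coordinates y = Q x, the
   domain is the strict epigraph of a Lipschitz function of (y_0, y_1). *)
Definition lipschitz_boundary (R : realType) (Om : set (R * R * R)) : Prop :=
  forall x0, (closure Om `\` interior Om) x0 ->
    exists (Q : 'M[R]_3) (a : R * R -> R) (k : R),
      [/\ Q *m Q^T = 1%:M, k.-lipschitz a &
        \forall x \near x0,
          Om x <-> a ((Q *m colv x) 0 0, (Q *m colv x) 1 0)
                   < (Q *m colv x) 2%:R 0].

Definition lipschitz_domain (R : realType) (Om : set (R * R * R)) : Prop :=
  [/\ open Om, connected Om & lipschitz_boundary Om].

(* Real symmetric positive definite matrix fields with measurable bounded
   entries, the inverse being of the same kind. *)
Definition spd_bounded (R : realType) (Om : set (R * R * R)) (A : mxfield R)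
    : Prop :=
  [/\ forall x, Om x -> (A x)^T = A x,
      forall x, Om x -> forall v : 'cV[R]_3, v != 0 ->
        0 < (v^T *m A x *m v) 0 0,
      forall i j, measurable_fun Om (fun x => A x i j) &
      exists C : R, forall x, Om x -> forall i j, `|A x i j| <= C].

Definition minv (R : realType) (A : mxfield R) : mxfield R :=
  fun x => invmx (A x).

Definition coefficient (R : realType) (Om : set (R * R * R)) (A : mxfield R)
    : Prop :=
  spd_bounded Om A /\ spd_bounded Om (minv A).

Definition mact (R : realType) (A : mxfield R) (u : field R) : field R :=
  fun x => A x *m u x.

Definition aeq (R : realType) (Om : set (R * R * R)) (u v : field R) : Prop :=
  {ae @leb3 R, forall x, Om x -> u x = v x}.

Definition L2 (R : realType) (Om : set (R * R * R)) : set (field R) :=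
  [set u : field R | forall i : 'I_3, measurable_fun Om (fun x => u x i 0) /\
     (@leb3 R).-integrable Om (fun x => ((u x i 0) ^+ 2)%:E)].

Definition ip (R : realType) (Om : set (R * R * R)) (u v : field R) : R :=
  \int[@leb3 R]_(x in Om) ((u x)^T *m v x) 0 0.

(* wsqn Om A u is the square of the A-weighted L^2 norm of u. *)
Definition wsqn (R : realType) (Om : set (R * R * R)) (A : mxfield R)
    (u : field R) : R :=
  ip Om (mact A u) u.

Definition unit3 (R : realType) (i : 'I_3) : R * R * R :=
  ((i == 0)%:R, (i == 1)%:R, (i == 2%:R)%:R).

Fixpoint Cn (R : realType) (n : nat) (f : R * R * R -> R) : Prop :=
  continuous f /\
  if n is n'.+1 then forall i : 'I_3,
    (forall x, derivable f x (unit3 R i)) /\ Cn n' (fun x => 'D_(unit3 R i) f x)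
  else True.

Definition test_field (R : realType) (Om : set (R * R * R)) : set (field R) :=
  [set phi : field R | (forall (n : nat) (i : 'I_3), Cn n (fun x => phi x i 0)) /\
     exists K : set (R * R * R),
       [/\ compact K, K `<=` Om & forall x, ~ K x -> phi x = 0]].

(* Classical curl; the indices i + 1, i + 2 are taken modulo 3. *)
Definition ccurl (R : realType) (phi : field R) : field R :=
  fun x => \col_(i < 3)
    ('D_(unit3 R (i + 1)) (fun y => phi y (i + 2%:R) 0) x -
     'D_(unit3 R (i + 2%:R)) (fun y => phi y (i + 1) 0) x).

Definition is_curl (R : realType) (Om : set (R * R * R)) (u w : field R)
    : Prop :=
  L2 Om w /\ forall phi, test_field Om phi -> ip Om u (ccurl phi) = ip Om w phi.

(* A representative of the weak curl, unique up to a.e. equality in Om. *)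
Definition curl (R : realType) (Om : set (R * R * R)) (u : field R) : field R :=
  xget 0 [set w : field R | is_curl Om u w].

(* A linear space of (pairs of) fields with its seminorm, which vanishes
   exactly on the a.e. zero elements. *)
Record fspace (R : realType) (V : lmodType R) :=
  FSpace { mem_fs : set V; nrm_fs : V -> R }.

Definition L2_space (R : realType) (Om : set (R * R * R)) : fspace (field R) :=
  FSpace (L2 Om) (fun u => Num.sqrt (ip Om u u)).

Definition Hcurl (R : realType) (Om : set (R * R * R)) : fspace (field R) :=
  FSpace [set u : field R | L2 Om u /\ exists w, is_curl Om u w]
         (fun u => Num.sqrt (ip Om u u + ip Om (curl Om u) (curl Om u))).

Definition Hcurl0 (R : realType) (Om : set (R * R * R)) : fspace (field R) :=
  FSpace [set u : field R | mem_fs (Hcurl Om) u /\ forall d : R, 0 < d ->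
            exists2 phi, test_field Om phi & nrm_fs (Hcurl Om) (u - phi) < d]
         (nrm_fs (Hcurl Om)).

Definition prod_space (R : realType) (V W : lmodType R)
    (X : fspace V) (Y : fspace W) : fspace (V * W)%type :=
  FSpace [set p | mem_fs X p.1 /\ mem_fs Y p.2]
         (fun p => Num.sqrt (nrm_fs X p.1 ^+ 2 + nrm_fs Y p.2 ^+ 2)).

Definition Hspace (R : realType) (Om : set (R * R * R)) :=
  prod_space (L2_space Om) (L2_space Om).

Definition Dspace (R : realType) (Om : set (R * R * R)) :=
  prod_space (Hcurl0 Om) (Hcurl Om).

Definition maxwell_op (R : realType) (Om : set (R * R * R)) (eps mu : mxfield R)
    (p : field R * field R) : field R * field R :=
  (mact (minv eps) (curl Om p.2), mact (minv mu) (curl Om p.1)).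

Definition D2space (R : realType) (Om : set (R * R * R)) (eps mu : mxfield R)
    : fspace (field R * field R)%type :=
  FSpace [set p | mem_fs (Dspace Om) p /\
                  mem_fs (Dspace Om) (maxwell_op Om eps mu p)]
         (fun p => Num.sqrt (nrm_fs (Dspace Om) p ^+ 2 +
                     nrm_fs (Dspace Om) (maxwell_op Om eps mu p) ^+ 2)).

(* w is the strong derivative at t, in the norm of X, of u : [a, b] -> X
   (one-sided at a and b). *)
Definition is_dt (R : realType) (V : lmodType R) (X : fspace V) (a b : R)
    (u : R -> V) (t : R) (w : V) : Prop :=
  mem_fs X w /\
  (fun s => nrm_fs X ((s - t)^-1 *: (u s - u t) - w))
    @ within `[a, b] t^' --> (0 : R).

Fixpoint Ck (R : realType) (V : lmodType R) (X : fspace V) (k : nat) (a b : R)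
    (u : R -> V) : Prop :=
  (forall t, t \in `[a, b] -> mem_fs X (u t) /\
     (fun s => nrm_fs X (u s - u t)) @ within `[a, b] (nbhs t) --> (0 : R)) /\
  if k is k'.+1 then exists w : R -> V,
    (forall t, t \in `[a, b] -> is_dt X a b u t (w t)) /\ Ck X k' a b w
  else True.

(* C^1_p([0, T], X): continuous, and C^1 up to the end points on each of
   finitely many consecutive closed subintervals. *)
Definition C1p (R : realType) (V : lmodType R) (X : fspace V) (T : R)
    (u : R -> V) : Prop :=
  Ck X 0 0 T u /\
  exists (m : nat) (tau : nat -> R),
    [/\ tau 0%N = 0, tau m = T &
        forall i, (i < m)%N ->
          tau i < tau i.+1 /\ Ck X 1 (tau i) (tau i.+1) u].

(* The time derivative, as an element of L^2(Omega, R^3); for a C^1_p function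
   it is meaningful except at finitely many times. *)
Definition dt (R : realType) (Om : set (R * R * R)) (T : R) (u : R -> field R)
    : R -> field R :=
  fun t => xget 0 [set w : field R | is_dt (L2_space Om) 0 T u t w].

Definition step_fun (R : realType) (V : lmodType R) (X : fspace V) (u : R -> V)
    : Prop :=
  exists (n : nat) (A : 'I_n -> set (measurableTypeR R)) (c : 'I_n -> V),
    (forall i, measurable (A i) /\ mem_fs X (c i)) /\
    forall t, u t = \sum_(i < n) (\1_(A i) t : R) *: c i.

(* Bochner space L^1((0, T), X). *)
Definition bochner1 (R : realType) (V : lmodType R) (X : fspace V) (T : R)
    (u : R -> V) : Prop :=
  (exists U : nat -> R -> V,
     (forall n, step_fun X (U n)) /\
     {ae @lebesgue_measure R, forall t, t \in `]0, T[ -> mem_fs X (u t) /\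
        (fun n => nrm_fs X (U n t - u t)) @ \oo --> (0 : R)}) /\
  (\int[@lebesgue_measure R]_(t in `]0%R, T[) (nrm_fs X (u t))%:E < +oo)%E.

Definition maxwell_data (R : realType) (Om : set (R * R * R))
    (eps mu : mxfield R) (T : R) (F G : R -> field R) (E0 H0 : field R)
    : Prop :=
  [/\ bochner1 (D2space Om eps mu) T (fun t => (F t, G t)),
      Ck (Dspace Om) 0 0 T (fun t => (F t, G t)),
      Ck (Hspace Om) 1 0 T (fun t => (F t, G t)) &
      mem_fs (D2space Om eps mu) (E0, H0)].

Definition maxwell_solution (R : realType) (Om : set (R * R * R))
    (eps mu : mxfield R) (T : R) (F G : R -> field R) (E0 H0 : field R)
    (E H : R -> field R) : Prop :=
  [/\ Ck (D2space Om eps mu) 0 0 T (fun t => (E t, H t)),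
      Ck (Dspace Om) 1 0 T (fun t => (E t, H t)),
      Ck (Hspace Om) 2 0 T (fun t => (E t, H t)),
      (forall t, t \in `]0, T[ ->
         aeq Om (dt Om T E t - mact (minv eps) (curl Om (H t))) (F t) /\
         aeq Om (dt Om T H t + mact (minv mu) (curl Om (E t))) (G t)) &
      aeq Om (E 0) E0 /\ aeq Om (H 0) H0].

(* Scalar product of L^2((0, t) x Omega, R^3), identified with
   L^2((0, t), L^2(Omega, R^3)). *)
Definition ip_time (R : realType) (Om : set (R * R * R)) (t : R)
    (u v : R -> field R) : R :=
  \int[@lebesgue_measure R]_(s in `[0, t]) ip Om (u s) (v s).

(* The weights rho, gamma must be measurable for the integrals in the bound to
   make sense; gamma is integrable so that Gam is finite. *)
Definition rho_weight (R : realType) (T : R) (rho : R -> R) : Prop :=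
  measurable_fun `[0, T] rho /\
  forall t, t \in `[0, T] -> 0 < rho t /\ rho t < 1.

Definition gamma_weight (R : realType) (T : R) (gamma : R -> R) : Prop :=
  (@lebesgue_measure R).-integrable `[0, T] (fun t => (gamma t)%:E) /\
  forall t, t \in `[0, T] -> 0 < gamma t.

Definition Kt (R : realType) (Om : set (R * R * R)) (mu : mxfield R)
    (tE Y : R -> field R) : R -> field R :=
  fun t => mact (minv mu) (curl Om (tE t)) - Y t.

Definition Kc (R : realType) (Om : set (R * R * R)) (eps : mxfield R) (T : R)
    (K tEt Y : R -> field R) : R -> field R :=
  fun t => mact eps (dt Om T tEt t) + curl Om (Y t) - K t.

(* The last two integrals may be +oo for some choices of gamma. *)
Definition gfun (R : realType) (Om : set (R * R * R)) (eps mu : mxfield R)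
    (T : R) (K tE tEt : R -> field R) (rho : R -> R)
    (Y : R -> field R) (gamma : R -> R) (t : R) : \bar R :=
  (((1 - rho t)^-1 * wsqn Om mu (Kt Om mu tE Y t) +
    2 * ip_time Om t (Kt Om mu tE Y)
          (fun s => curl Om (tEt s - dt Om T tE s)))%:E +
   \int[@lebesgue_measure R]_(s in `[0%R, t])
      ((gamma s)^-1 * wsqn Om (minv eps) (Kc Om eps T K tEt Y s))%:E +
   \int[@lebesgue_measure R]_(s in `[0%R, t])
      ((gamma s * rho s)^-1 *
       wsqn Om mu (mact (minv mu) (curl Om (tEt s)) - dt Om T Y s))%:E)%E.

Definition zconst (R : realType) (Om : set (R * R * R)) (eps mu : mxfield R)
    (tE Y : R -> field R) (e et : R -> field R) : R :=
  wsqn Om eps (et 0) + wsqn Om (minv mu) (curl Om (e 0)) +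
  2 * ip Om (Kt Om mu tE Y 0) (curl Om (e 0)).

Definition Gam (R : realType) (gamma : R -> R) (t : R) : R :=
  \int[@lebesgue_measure R]_(s in `[0, t]) gamma s.

Definition bound (R : realType) (gamma : R -> R) (f : R -> \bar R) (t : R)
    : \bar R :=
  ((expR (Gam gamma t))%:E *
   \int[@lebesgue_measure R]_(s in `[0%R, t])
      ((expR (- Gam gamma s) * gamma s)%:E * f s) + f t)%E.

(* Main.v *)
Require Import Defs.
From HB Require Import structures.
From mathcomp Require Import all_boot all_order all_algebra.
From mathcomp Require Import all_classical all_reals all_analysis.
From mathcomp Require Import measurable_realfun ring lra.
Import Order.TTheory GRing.Theory Num.Theory.
Import numFieldNormedType.Exports.
Local Open Scope classical_set_scope.
Local Open Scope ring_scope.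

Set Implicit Arguments.
Unset Strict Implicit.
Unset Printing Implicit Defensive.

(** The error [e] satisfies a second-order wave equation weakly, so that on each
    interval where the approximations are C^1 the time derivative of
    [|e_t|^2 + |curl e|^2 + 2 <Kt, curl e>] contains only the residuals paired
    with [e_t] and [curl e]: the last summand absorbs the term
    [<Kt, curl e_t>], on which there is no control.  Summing over the finitely
    many pieces and applying Young's inequality with the weights [gamma] and
    [gamma * rho] gives [n <= f + int gamma n], and Gronwall's inequality in
    integral form bounds [n] by [b].  Gronwall is proved for merely integrable
    [gamma], without absolute continuity: [exp (- Gamma) N] and its candidate
    primitive differ by a function whose increments are quadratic in those of a
    continuous monotone function, hence by a constant.  The dual quantities
    [h_t] and [curl h] are [q - mu^-1 curl e] and [eps (e_t - r)]. *)

(** * Square integrable fields and weighted scalar products *)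

(** [curl] and [dt] are choices of representatives, so identities between them hold almost
    everywhere and rest on uniqueness. For the curl this is the fundamental lemma on an arbitrary
    open set, which is why smooth bumps and Borel measurability in R^3 are developed. The time
    derivatives of the approximations are controlled only inside the pieces, hence the balances are
    stated in integrated form, which ignores break points. The wave equation is used only after
    testing with a field of zero tangential trace: [e_t] is such a field, while [e] need not be.

    The energy contains |curl e|^2 with weight one, but the indefinite summand 2 <Kt, curl e> costs
    the share 1 - rho of it. This is the origin of rho in n and of (1 - rho)^-1 in g; at time 0
    nothing is absorbed, so z keeps weight one. The constant 2 comes from |a + b|^2 <= 2 |a|^2 + 2
    |b|^2, and 3 is 1 + 2. The integrals in g may be infinite and rho is only measurable, so the
    final inequality lives in the extended reals and n is treated as merely bounded and
    measurable. *)

Definition sqint {d} {T : measurableType d} {R : realType}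
    (m : {measure set T -> \bar R}) (D : set T) (f : T -> R) : Prop :=
  measurable_fun D f /\ m.-integrable D (fun x => ((f x) ^+ 2)%:E).

Lemma sqintM {d} {T : measurableType d} {R : realType}
    (m : {measure set T -> \bar R}) (D : set T) (f g : T -> R) :
  measurable D -> sqint m D f -> sqint m D g ->
  m.-integrable D (fun x => (f x * g x)%:E).
Proof.
move=> mD [mf if2] [mg ig2].
apply: (le_integrable mD _ _ (integrableD mD if2 ig2)).
  by apply/measurable_EFinP; exact: measurable_funM.
move=> x Dx /=; rewrite lee_fin.
rewrite [leRHS]ger0_norm ?addr_ge0 ?sqr_ge0// ler_norml.
by apply/andP; split; nra.
Qed.

Lemma sqintD {d} {T : measurableType d} {R : realType}
    (m : {measure set T -> \bar R}) (D : set T) (f g : T -> R) :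
  measurable D -> sqint m D f -> sqint m D g ->
  sqint m D (fun x => f x + g x).
Proof.
move=> mD [mf if2] [mg ig2].
have mfg : measurable_fun D (fun x => f x + g x) by exact: measurable_funD.
split=> //.
have i2 := integrableD mD if2 ig2.
apply: (le_integrable mD _ _ (integrableD mD i2 i2)).
  by apply/measurable_EFinP; exact: measurable_funX.
move=> x Dx /=; rewrite lee_fin.
rewrite [leRHS]ger0_norm ?addr_ge0 ?sqr_ge0// ler_norml.
have := sqr_ge0 (f x - g x); have := sqr_ge0 (f x + g x).
by move=> *; apply/andP; split; nra.
Qed.

Lemma sqint_bounded_mul {d} {T : measurableType d} {R : realType}
    (m : {measure set T -> \bar R}) (D : set T) (a f : T -> R) (C : R) :
  measurable D -> measurable_fun D a -> (forall x, D x -> `|a x| <= C) ->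
  sqint m D f -> sqint m D (fun x => a x * f x).
Proof.
move=> mD ma aC [mf if2].
have maf : measurable_fun D (fun x => a x * f x) by exact: measurable_funM.
split=> //.
apply: (le_integrable mD _ _ (integrableZl mD (C ^+ 2) if2)).
  by apply/measurable_EFinP; exact: measurable_funX.
move=> x Dx /=; have C0 : 0 <= C by apply: le_trans (aC x Dx).
rewrite lee_fin [leLHS]ger0_norm ?sqr_ge0// [leRHS]ger0_norm; last first.
  by rewrite mulr_ge0 ?sqr_ge0.
rewrite exprMn; apply: ler_wpM2r; first exact: sqr_ge0.
by rewrite -[leLHS]real_normK ?num_real// lerXn2r ?nnegrE// aC.
Qed.

Lemma sqintZ {d} {T : measurableType d} {R : realType}
    (m : {measure set T -> \bar R}) (D : set T) (c : R) (f : T -> R) :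
  measurable D -> sqint m D f -> sqint m D (fun x => c * f x).
Proof.
move=> mD; apply: (@sqint_bounded_mul _ _ _ m D (cst c) f `|c|) => //.
Qed.

Lemma sqint0 {d} {T : measurableType d} {R : realType}
    (m : {measure set T -> \bar R}) (D : set T) :
  measurable D -> sqint m D (cst (0 : R)).
Proof.
move=> mD; split; first exact: measurable_cst.
apply: (eq_integrable mD _ _ _ (integrable0 m D)) => x _ /=.
by rewrite expr0n.
Qed.

(** * Measurability of open subsets of R^3 through countable bases *)

Definition countable_measurable_base {d} (T : measurableType d)
    (N : T -> set_system T) : Prop :=
  exists B : nat -> set T, (forall n, measurable (B n)) /\
    forall x U, N x U -> exists n, B n x /\ B n `<=` U.

Lemma countable_base_real (R : realType) :
  @countable_measurable_base _ (measurableTypeR R) (fun x : R => nbhs x).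
Proof.
pose B (p : rat * rat) : set R := `]ratr p.1, ratr p.2[%classic.
(* Numbers that encode no pair of rationals get [setT]: it is measurable, and the second condition
   only asks for one suitable index. *)
exists (fun n => odflt setT (omap B (unpickle n))); split.
  by move=> n; case: unpickle => [p|] /=; [exact: measurable_itv|exact: measurableT].
move=> x U /nbhs_ballP[r /= r0 rU].
have /rat_in_itvoo[p /[!in_itv]/= /andP[p1 p2]] : x - r < x by rewrite ltrBlDr ltrDl.
have /rat_in_itvoo[q /[!in_itv]/= /andP[q1 q2]] : x < x + r by rewrite ltrDl.
exists (pickle (p, q)); rewrite pickleK /B/=; split.
  by rewrite in_itv/= p2 q1.
move=> y /=; rewrite in_itv/= => /andP[py yq]; apply: rU.
by rewrite /ball/= ltr_norml; apply/andP; split; lra.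
Qed.

Lemma countable_base_prod {d1 d2} (T1 : measurableType d1)
    (T2 : measurableType d2) (N1 : T1 -> set_system T1)
    (N2 : T2 -> set_system T2) (N : T1 * T2 -> set_system (T1 * T2)) :
  (forall x U, N x U -> exists U1 U2, [/\ N1 x.1 U1, N2 x.2 U2 &
    U1 `*` U2 `<=` U]) ->
  countable_measurable_base N1 -> countable_measurable_base N2 ->
  countable_measurable_base N.
Proof.
move=> NE [B1 [mB1 B1N]] [B2 [mB2 B2N]].
pose B (p : nat * nat) := B1 p.1 `*` B2 p.2.
exists (fun n => odflt setT (omap B (unpickle n))); split.
  by move=> n; case: unpickle => [p|] /=; [exact: measurableX|exact: measurableT].
move=> [x y] U /NE[U1 [U2 [/= /B1N[i [ix iU]] /B2N[j [jy jU]] U12]]].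
exists (pickle (i, j)); rewrite pickleK /B/=; split=> //.
by move=> [a b] [/= ? ?]; apply: U12; split => /=; [exact: iU|exact: jU].
Qed.

(** An open set is the union of the countably many basic sets it contains. The neighbourhoods are a
    parameter [N], so the measurable structure and the topology may come from two presentations of
    the same points. *)
Lemma countable_base_open {d} (T : measurableType d) (N : T -> set_system T)
    (U : set T) :
  countable_measurable_base N -> (forall x, U x -> N x U) -> measurable U.
Proof.
move=> [B [mB BN]] oU.
have -> : U = \bigcup_(n in [set n | B n `<=` U]) B n.
  apply/seteqP; split => x.
    by move=> /[dup] Ux /oU /BN[n [nx nU]]; exists n.
  by move=> [n nU]; exact: nU.
by apply: bigcup_measurable => n _; exact: mB.
Qed.

(** Countable bases are stable under products, so the product sigma-algebra contains all open sets.
    This gives measurability of the domain and, below, of continuous functions. *)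
Lemma open_measurable_R3 (R : realType) (U : set (R * R * R)) :
  open U -> measurable U.
Proof.
move=> oU.
apply: (@countable_base_open _ (measurableTypeR R * measurableTypeR R * measurableTypeR R)%type
  (fun x : R * R * R => nbhs x)); last first.
  by move=> x Ux; exact: open_nbhs_nbhs.
have NE (S1 S2 : topologicalType) (x : S1 * S2) (V : set (S1 * S2)) :
  nbhs x V -> exists U1 U2, [/\ nbhs x.1 U1, nbhs x.2 U2 & U1 `*` U2 `<=` V].
  by move=> [[U1 U2] [/= h1 h2] h3]; exists U1, U2.
apply: (@countable_base_prod _ _ (measurableTypeR R * measurableTypeR R)%type
  (measurableTypeR R) (fun x : R * R => nbhs x) (fun x : R => nbhs x)).
- exact: NE.
- apply: (@countable_base_prod _ _ (measurableTypeR R)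
    (measurableTypeR R) (fun x : R => nbhs x) (fun x : R => nbhs x)).
  + exact: NE.
  + exact: countable_base_real.
  + exact: countable_base_real.
- exact: countable_base_real.
Qed.

Lemma continuous_measurable_R3 (R : realType) (D : set (R * R * R))
    (f : R * R * R -> R) :
  measurable D -> continuous f -> measurable_fun D f.
Proof.
move=> mD cf; apply: (measurability _ (RGenOpens.measurableE R)).
move=> _ [_ [a [b ->]] <-].
apply: measurableI => //; apply: open_measurable_R3.
by apply: open_comp => //; exact: interval_open.
Qed.

(** * Linear structure and scalar product of [L2] *)

HB.instance Definition _ (R : realType) := Measure.copy (@leb3 R)
  ((@lebesgue_measure R \x @lebesgue_measure R) \x @lebesgue_measure R)%E.

(** Lets the filter lemmas combine statements of the form [aeq]. *)
#[global] Instance leb3_ae_filter (R : realType) :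
  Filter (nbhs (almost_everywhere (@leb3 R))).
Proof.
exact: (@ae_filter_ringOfSetsType _ _ _
  ((@lebesgue_measure R \x @lebesgue_measure R) \x @lebesgue_measure R)%E).
Qed.

Lemma L2_sqint (R : realType) (Om : set (R * R * R)) (u : field R) :
  L2 Om u <-> forall i : 'I_3, sqint (@leb3 R) Om (fun x => u x i 0).
Proof. by split => h i; have [] := h i. Qed.

(** Only changes the presentation of the carrier, to the product of measurable types on which [leb3]
    is a measure. *)
Lemma measurable_leb3 (R : realType) (Om : set (R * R * R)) :
  measurable Om ->
  measurable (Om : set (measurableTypeR R * measurableTypeR R * measurableTypeR R)).
Proof. exact. Qed.

Lemma L2D (R : realType) (Om : set (R * R * R)) (u v : field R) :
  measurable Om -> L2 Om u -> L2 Om v -> L2 Om (u + v).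
Proof.
move=> /measurable_leb3 mO /L2_sqint u2 /L2_sqint v2; apply/L2_sqint => i.
rewrite [X in sqint _ _ X](_ : _ = (fun x => u x i 0 + v x i 0)).
  exact: sqintD.
by apply/funext => x; rewrite mxE.
Qed.

Lemma L2Z (R : realType) (Om : set (R * R * R)) (c : R) (u : field R) :
  measurable Om -> L2 Om u -> L2 Om (c *: u).
Proof.
move=> /measurable_leb3 mO /L2_sqint u2; apply/L2_sqint => i.
rewrite [X in sqint _ _ X](_ : _ = (fun x => c * u x i 0)).
  exact: sqintZ.
by apply/funext => x; rewrite mxE.
Qed.

Lemma L20 (R : realType) (Om : set (R * R * R)) :
  measurable Om -> L2 Om (0 : field R).
Proof.
move=> /measurable_leb3 mO; apply/L2_sqint => i.
rewrite [X in sqint _ _ X](_ : _ = cst 0); first exact: sqint0.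
by apply/funext => x; rewrite mxE.
Qed.

Lemma L2N (R : realType) (Om : set (R * R * R)) (u : field R) :
  measurable Om -> L2 Om u -> L2 Om (- u).
Proof. by move=> mO u2; rewrite -scaleN1r; exact: L2Z. Qed.

Lemma L2B (R : realType) (Om : set (R * R * R)) (u v : field R) :
  measurable Om -> L2 Om u -> L2 Om v -> L2 Om (u - v).
Proof. by move=> mO u2 v2; apply: L2D => //; exact: L2N. Qed.

Lemma dotE (R : realType) (a b : 'cV[R]_3) :
  (a^T *m b) 0 0 = \sum_(i < 3) a i 0 * b i 0.
Proof. by rewrite mxE; apply: eq_bigr => i _; rewrite mxE. Qed.

Lemma integrable_dot (R : realType) (Om : set (R * R * R)) (u v : field R) :
  measurable Om -> L2 Om u -> L2 Om v ->
  (@leb3 R).-integrable Om (fun x => (((u x)^T *m v x) 0 0)%:E).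
Proof.
move=> /measurable_leb3 mO /L2_sqint u2 /L2_sqint v2.
rewrite [X in _.-integrable _ X](_ : _ =
    (fun x => \sum_(i < 3) (u x i 0 * v x i 0)%:E)%E); last first.
  by apply/funext => x; rewrite dotE sumEFin.
by apply: integrable_sum => // i _; exact: sqintM.
Qed.

Lemma measurable_dot (R : realType) (Om : set (R * R * R)) (u v : field R) :
  measurable Om -> L2 Om u -> L2 Om v ->
  measurable_fun (Om : set (measurableTypeR R * measurableTypeR R * measurableTypeR R))
    (fun x => ((u x)^T *m v x) 0 0).
Proof.
move=> mO u2 v2; have := integrable_dot mO u2 v2.
by move=> /integrableP[/measurable_EFinP].
Qed.

Lemma ipC (R : realType) (Om : set (R * R * R)) (u v : field R) :
  ip Om u v = ip Om v u.
Proof.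
apply: eq_Rintegral => x _; rewrite !dotE.
by apply: eq_bigr => i _; rewrite mulrC.
Qed.

Lemma ipDl (R : realType) (Om : set (R * R * R)) (u v w : field R) :
  measurable Om -> L2 Om u -> L2 Om v -> L2 Om w ->
  ip Om (u + v) w = ip Om u w + ip Om v w.
Proof.
move=> mO u2 v2 w2; rewrite /ip -RintegralD//; last 2 first.
- exact: integrable_dot.
- exact: integrable_dot.
by apply: eq_Rintegral => x _; rewrite linearD/= mulmxDl mxE.
Qed.

Lemma ipZl (R : realType) (Om : set (R * R * R)) (c : R) (u w : field R) :
  measurable Om -> L2 Om u -> L2 Om w -> ip Om (c *: u) w = c * ip Om u w.
Proof.
move=> mO u2 w2; rewrite /ip -RintegralZl//; last exact: integrable_dot.
by apply: eq_Rintegral => x _; rewrite linearZ/= -scalemxAl mxE.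
Qed.

Lemma ipNl (R : realType) (Om : set (R * R * R)) (u w : field R) :
  measurable Om -> L2 Om u -> L2 Om w -> ip Om (- u) w = - ip Om u w.
Proof. by move=> mO u2 w2; rewrite -scaleN1r ipZl// mulN1r. Qed.

Lemma ipBl (R : realType) (Om : set (R * R * R)) (u v w : field R) :
  measurable Om -> L2 Om u -> L2 Om v -> L2 Om w ->
  ip Om (u - v) w = ip Om u w - ip Om v w.
Proof. by move=> mO u2 v2 w2; rewrite ipDl ?ipNl//; exact: L2N. Qed.

Lemma ipDr (R : realType) (Om : set (R * R * R)) (u v w : field R) :
  measurable Om -> L2 Om u -> L2 Om v -> L2 Om w ->
  ip Om w (u + v) = ip Om w u + ip Om w v.
Proof. by move=> mO u2 v2 w2; rewrite ipC ipDl// !(ipC _ w). Qed.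

Lemma ipZr (R : realType) (Om : set (R * R * R)) (c : R) (u w : field R) :
  measurable Om -> L2 Om u -> L2 Om w -> ip Om w (c *: u) = c * ip Om w u.
Proof. by move=> mO u2 w2; rewrite ipC ipZl// ipC. Qed.

Lemma ipBr (R : realType) (Om : set (R * R * R)) (u v w : field R) :
  measurable Om -> L2 Om u -> L2 Om v -> L2 Om w ->
  ip Om w (u - v) = ip Om w u - ip Om w v.
Proof. by move=> mO u2 v2 w2; rewrite ipC ipBl// !(ipC _ w). Qed.

Lemma ip_ge0 (R : realType) (Om : set (R * R * R)) (u : field R) :
  0 <= ip Om u u.
Proof.
apply: Rintegral_ge0 => x _; rewrite dotE; apply: sumr_ge0 => i _.
by rewrite -expr2 sqr_ge0.
Qed.

Lemma aeqxx (R : realType) (Om : set (R * R * R)) (u : field R) : aeq Om u u.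
Proof. exact: aeW. Qed.

Lemma aeq_sym (R : realType) (Om : set (R * R * R)) (u v : field R) :
  aeq Om u v -> aeq Om v u.
Proof. by apply: filterS => x h Ox; rewrite h. Qed.

Lemma aeq_trans (R : realType) (Om : set (R * R * R)) (v u w : field R) :
  aeq Om u v -> aeq Om v w -> aeq Om u w.
Proof. by apply: filterS2 => x h1 h2 Ox; rewrite h1// h2. Qed.

Lemma aeqD (R : realType) (Om : set (R * R * R)) (u u' v v' : field R) :
  aeq Om u u' -> aeq Om v v' -> aeq Om (u + v) (u' + v').
Proof. by apply: filterS2 => x h1 h2 Ox; rewrite !fctE h1// h2. Qed.

Lemma aeqB (R : realType) (Om : set (R * R * R)) (u u' v v' : field R) :
  aeq Om u u' -> aeq Om v v' -> aeq Om (u - v) (u' - v').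
Proof. by apply: filterS2 => x h1 h2 Ox; rewrite !fctE h1// h2. Qed.

Lemma aeqZ (R : realType) (Om : set (R * R * R)) (c : R) (u u' : field R) :
  aeq Om u u' -> aeq Om (c *: u) (c *: u').
Proof. by apply: filterS => x h1 Ox; rewrite !fctE h1. Qed.

Lemma aeq_mact (R : realType) (Om : set (R * R * R)) (A : mxfield R)
    (u u' : field R) :
  aeq Om u u' -> aeq Om (mact A u) (mact A u').
Proof. by apply: filterS => x h1 Ox; rewrite /mact h1. Qed.

Lemma aeq_subr0 (R : realType) (Om : set (R * R * R)) (u v : field R) :
  aeq Om (u - v) 0 <-> aeq Om u v.
Proof.
split; apply: filterS => x h Ox; last by rewrite !fctE h// subrr.
by apply/eqP; rewrite -subr_eq0; apply/eqP; exact: (h Ox).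
Qed.

Lemma ip_aeq (R : realType) (Om : set (R * R * R)) (u u' v v' : field R) :
  measurable Om -> L2 Om u -> L2 Om u' -> L2 Om v -> L2 Om v' ->
  aeq Om u u' -> aeq Om v v' -> ip Om u v = ip Om u' v'.
Proof.
move=> mO u2 u2' v2 v2' uu' vv'.
rewrite /ip /Rintegral; congr fine; apply: ae_eq_integral => //.
- by apply/measurable_EFinP; exact: measurable_dot.
- by apply/measurable_EFinP; exact: measurable_dot.
by move: vv' uu'; apply: filterS2 => x h1 h2 Ox /=; rewrite h1// h2.
Qed.

Lemma ip_eq0_aeq (R : realType) (Om : set (R * R * R)) (u : field R) :
  measurable Om -> L2 Om u -> ip Om u u = 0 -> aeq Om u 0.
Proof.
move=> mO u2; rewrite /ip /Rintegral => u0.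
have ui := integrable_dot mO u2 u2.
(* [ip] is the real part of an extended integral and would also vanish for an infinite one;
   integrability excludes that. *)
have u0' : (\int[@leb3 R]_(x in Om) (((u x)^T *m u x) 0 0)%:E = 0)%E.
  by rewrite -[LHS]fineK ?u0//; exact: integrable_fin_num.
have dot0 x : 0 <= ((u x)^T *m u x) 0 0.
  by rewrite dotE; apply: sumr_ge0 => i _; rewrite -expr2 sqr_ge0.
have : (\int[@leb3 R]_(x in Om) `|(((u x)^T *m u x) 0 0)%:E| = 0)%E.
  by rewrite -u0'; apply: eq_integral => x _; rewrite gee0_abs// lee_fin.
move/ae_eq_integral_abs => h.
have {}h := h mO (measurable_int _ ui).
apply: filterS h => x h Ox; apply/colP => i.
have /eqP := EFin_inj (h Ox); rewrite dotE psumr_eq0; last first.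
  by move=> j _; rewrite -expr2 sqr_ge0.
move/allP => /(_ i); rewrite mem_index_enum => /(_ isT) /=.
by rewrite mulf_eq0 orbb => /eqP ->; rewrite mxE.
Qed.

(** * Matrix weights, Cauchy-Schwarz and Young inequalities *)

Lemma measurable_mact (R : realType) (Om : set (R * R * R)) (A : mxfield R)
    (u : field R) :
  measurable Om -> spd_bounded Om A -> L2 Om u -> L2 Om (mact A u).
Proof.
move=> /measurable_leb3 mO [_ _ mA [C AC]] /L2_sqint u2; apply/L2_sqint => i.
have h (j : 'I_3) : sqint (@leb3 R) Om (fun x => A x i j * u x j 0).
  exact: (@sqint_bounded_mul _ _ _ (@lebesgue_measure R \x @lebesgue_measure R \x @lebesgue_measure R)%E Om
    (fun x => A x i j) (fun x => u x j 0) C mO (mA i j) (fun x Ox => AC x Ox i j) (u2 j)).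
rewrite [X in sqint _ _ X](_ : _ = (fun x =>
    A x i 0 * u x 0 0 + A x i 1 * u x 1 0 + A x i 2%:R * u x 2%:R 0)).
  by apply: sqintD => //; exact: sqintD.
apply/funext => x; rewrite mxE !big_ord_recr big_ord0/= add0r.
by congr (_ * _ + _ * _ + _ * _); congr (_ _ _); apply/val_inj.
Qed.

Lemma ip_mact (R : realType) (Om : set (R * R * R)) (A : mxfield R)
    (u v : field R) :
  spd_bounded Om A -> ip Om (mact A u) v = ip Om u (mact A v).
Proof.
move=> [As _ _ _]; apply: eq_Rintegral => x /set_mem Ox.
by rewrite /mact trmx_mul As// -mulmxA.
Qed.

Lemma wsqn_ge0 (R : realType) (Om : set (R * R * R)) (A : mxfield R)
    (u : field R) :
  spd_bounded Om A -> 0 <= wsqn Om A u.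
Proof.
move=> [As Ap _ _]; apply: Rintegral_ge0 => x Ox.
rewrite /mact trmx_mul As//.
have [->|/(Ap _ Ox)/ltW//] := eqVneq (u x) 0.
by rewrite mulmx0 mxE.
Qed.

(** A nonzero vector in the kernel would make the quadratic form vanish. *)
Lemma spd_unitmx (R : realType) (Om : set (R * R * R)) (A : mxfield R) x :
  spd_bounded Om A -> Om x -> A x \in unitmx.
Proof.
move=> [As Ap _ _] Ox; rewrite -row_free_unit -kermx_eq0.
apply/negPn/negP => /rowV0Pn[w /sub_kermxP wA w0].
have /(Ap _ Ox) : w^T != 0 by rewrite trmx_eq0.
by rewrite trmxK wA mul0mx mxE ltxx.
Qed.

Lemma mactVK (R : realType) (Om : set (R * R * R)) (A : mxfield R)
    (u : field R) :
  spd_bounded Om A -> aeq Om (mact A (mact (minv A) u)) u.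
Proof.
move=> hA; apply: aeW => x Ox; rewrite /mact /minv mulmxA mulmxV ?mul1mx//.
exact: spd_unitmx Ox.
Qed.

Lemma mactD (R : realType) (A : mxfield R) (u v : field R) :
  mact A (u + v) = mact A u + mact A v.
Proof. by apply/funext => x; rewrite /mact !fctE mulmxDr. Qed.

Lemma mactN (R : realType) (A : mxfield R) (u : field R) :
  mact A (- u) = - mact A u.
Proof. by apply/funext => x; rewrite /mact !fctE mulmxN. Qed.

Lemma mactB (R : realType) (A : mxfield R) (u v : field R) :
  mact A (u - v) = mact A u - mact A v.
Proof. by rewrite mactD mactN. Qed.

Lemma mactZ (R : realType) (A : mxfield R) (c : R) (u : field R) :
  mact A (c *: u) = c *: mact A u.
Proof. by apply/funext => x; rewrite /mact !fctE -scalemxAr. Qed.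

Lemma ip_linear_quadratic (R : realType) (Om : set (R * R * R)) (u v : field R) (t : R) :
  measurable Om -> L2 Om u -> L2 Om v ->
  ip Om (u + t *: v) (u + t *: v) =
    ip Om u u + 2 * t * ip Om u v + t ^+ 2 * ip Om v v.
Proof.
move=> mO u2 v2; have tv2 := L2Z t mO v2.
rewrite ipDl ?ipDr ?ipZl ?ipZr//; [|exact: L2D..].
rewrite (ipC _ v u); ring.
Qed.

Lemma ip_CS2 (R : realType) (Om : set (R * R * R)) (u v : field R) :
  measurable Om -> L2 Om u -> L2 Om v ->
  ip Om u v ^+ 2 <= ip Om u u * ip Om v v.
Proof.
move=> mO u2 v2.
have h t : 0 <= ip Om u u + 2 * t * ip Om u v + t ^+ 2 * ip Om v v.
  by rewrite -ip_linear_quadratic// ip_ge0.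
move: h (ip_ge0 Om v) (ip_ge0 Om u).
move: (ip Om u v) (ip Om v v) (ip Om u u) => b c a h c0 a0.
have [c1|] := ltrP 0 c.
  (* The minimiser of the quadratic polynomial in t. *)
  have := h (- b / c); rewrite -subr_ge0 => h1.
  have : 0 <= (a + 2 * (- b / c) * b + (- b / c) ^+ 2 * c) * c.
    by rewrite mulr_ge0// -subr_ge0.
  rewrite (_ : _ * c = a * c - b ^+ 2) ?subr_ge0//.
  by field; exact: lt0r_neq0.
move=> c1; have {c0 c1}c0 : c = 0 by apply/eqP; rewrite eq_le c1 c0.
(* With c = 0 the polynomial is affine in t; unless b = 0, the choice t = -(a + 1) / (2 b) gives it
   the value -1. *)
have := h (- (a + 1) / 2 * b); have := h (- (a + 1) / 2 / b).
rewrite c0 !mulr0 !addr0; have [->|b0] := eqVneq b 0; first by rewrite expr0n.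
rewrite (_ : a + _ = -1); last by field.
by rewrite lerNr oppr0 => /(lt_le_trans ltr01); rewrite ltxx.
Qed.

Lemma nrmL2E (R : realType) (Om : set (R * R * R)) (u : field R) :
  nrm_fs (L2_space Om) u = Num.sqrt (ip Om u u).
Proof. by []. Qed.

Lemma ip_CS (R : realType) (Om : set (R * R * R)) (u v : field R) :
  measurable Om -> L2 Om u -> L2 Om v ->
  `|ip Om u v| <= nrm_fs (L2_space Om) u * nrm_fs (L2_space Om) v.
Proof.
move=> mO u2 v2; rewrite !nrmL2E -sqrtrM ?ip_ge0// -sqrtr_sqr ler_wsqrtr//.
exact: ip_CS2.
Qed.

Lemma nrmL2_ge0 (R : realType) (Om : set (R * R * R)) (u : field R) :
  0 <= nrm_fs (L2_space Om) u.
Proof. exact: sqrtr_ge0. Qed.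

Lemma nrmL2_sqr (R : realType) (Om : set (R * R * R)) (u : field R) :
  nrm_fs (L2_space Om) u ^+ 2 = ip Om u u.
Proof. by rewrite sqr_sqrtr// ip_ge0. Qed.

Lemma nrmL2D (R : realType) (Om : set (R * R * R)) (u v : field R) :
  measurable Om -> L2 Om u -> L2 Om v ->
  nrm_fs (L2_space Om) (u + v) <=
    nrm_fs (L2_space Om) u + nrm_fs (L2_space Om) v.
Proof.
move=> mO u2 v2.
rewrite -[leRHS]ger0_norm ?addr_ge0 ?nrmL2_ge0// -sqrtr_sqr ler_wsqrtr//.
rewrite ipDl ?ipDr//; last exact: L2D.
rewrite sqrrD !nrmL2_sqr (ipC _ v u).
have := le_trans (ler_norm _) (ip_CS mO u2 v2).
by rewrite -mulr_natl; lra.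
Qed.

Lemma nrmL2Z (R : realType) (Om : set (R * R * R)) (c : R) (u : field R) :
  measurable Om -> L2 Om u ->
  nrm_fs (L2_space Om) (c *: u) = `|c| * nrm_fs (L2_space Om) u.
Proof.
move=> mO u2; rewrite !nrmL2E ipZl ?ipZr//; last exact: L2Z.
by rewrite mulrA -expr2 sqrtrM ?sqr_ge0// sqrtr_sqr.
Qed.

Lemma nrmL2N (R : realType) (Om : set (R * R * R)) (u : field R) :
  measurable Om -> L2 Om u ->
  nrm_fs (L2_space Om) (- u) = nrm_fs (L2_space Om) u.
Proof. by move=> mO u2; rewrite -scaleN1r nrmL2Z// normrN1 mul1r. Qed.

Lemma nrmL2_aeq (R : realType) (Om : set (R * R * R)) (u v : field R) :
  measurable Om -> L2 Om u -> L2 Om v -> aeq Om u v ->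
  nrm_fs (L2_space Om) u = nrm_fs (L2_space Om) v.
Proof. by move=> mO u2 v2 uv; rewrite !nrmL2E; congr Num.sqrt; exact: ip_aeq. Qed.

Lemma nrmL2_eq0 (R : realType) (Om : set (R * R * R)) (u : field R) :
  measurable Om -> L2 Om u -> nrm_fs (L2_space Om) u = 0 -> aeq Om u 0.
Proof.
move=> mO u2 u0; apply: ip_eq0_aeq => //; rewrite -nrmL2_sqr u0 expr0n//.
Qed.

Lemma wsqnD (R : realType) (Om : set (R * R * R)) (A : mxfield R)
    (u v : field R) :
  measurable Om -> spd_bounded Om A -> L2 Om u -> L2 Om v ->
  wsqn Om A (u + v) = wsqn Om A u + 2 * ip Om (mact A u) v + wsqn Om A v.
Proof.
move=> mO hA u2 v2; have Au := measurable_mact mO hA u2.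
have Av := measurable_mact mO hA v2.
rewrite /wsqn mactD ipDl ?ipDr//; last exact: L2D.
rewrite [X in _ + (X + _)]ip_mact// (ipC _ v); ring.
Qed.

Lemma wsqnZ (R : realType) (Om : set (R * R * R)) (A : mxfield R) (c : R)
    (u : field R) :
  measurable Om -> spd_bounded Om A -> L2 Om u ->
  wsqn Om A (c *: u) = c ^+ 2 * wsqn Om A u.
Proof.
move=> mO hA u2; have Au := measurable_mact mO hA u2.
rewrite /wsqn mactZ ipZl ?ipZr//; last exact: L2Z.
ring.
Qed.

Lemma wsqnN (R : realType) (Om : set (R * R * R)) (A : mxfield R)
    (u : field R) :
  measurable Om -> spd_bounded Om A -> L2 Om u -> wsqn Om A (- u) = wsqn Om A u.
Proof. by move=> mO hA u2; rewrite -scaleN1r wsqnZ// sqrrN expr1n mul1r. Qed.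

(** The right side exceeds the left by [wsqn Om A (u - v)], which is nonnegative. *)
Lemma wsqnD_le (R : realType) (Om : set (R * R * R)) (A : mxfield R)
    (u v : field R) :
  measurable Om -> spd_bounded Om A -> L2 Om u -> L2 Om v ->
  wsqn Om A (u + v) <= 2 * wsqn Om A u + 2 * wsqn Om A v.
Proof.
move=> mO hA u2 v2; have Au := measurable_mact mO hA u2.
have := wsqn_ge0 (u - v) hA; rewrite !wsqnD ?wsqnN//; last exact: L2N.
rewrite -[in ip Om (mact A u) (- v)]scaleN1r ipZr//; lra.
Qed.

Lemma wsqnB_le (R : realType) (Om : set (R * R * R)) (A : mxfield R)
    (u v : field R) :
  measurable Om -> spd_bounded Om A -> L2 Om u -> L2 Om v ->
  wsqn Om A (u - v) <= 2 * wsqn Om A u + 2 * wsqn Om A v.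
Proof.
move=> mO hA u2 v2; apply: (le_trans (wsqnD_le mO hA u2 (L2N mO v2))).
by rewrite wsqnN.
Qed.

Lemma wsqn_aeq (R : realType) (Om : set (R * R * R)) (A : mxfield R)
    (u v : field R) :
  measurable Om -> spd_bounded Om A -> L2 Om u -> L2 Om v -> aeq Om u v ->
  wsqn Om A u = wsqn Om A v.
Proof.
move=> mO hA u2 v2 uv; apply: ip_aeq => //; [exact: measurable_mact..|].
exact: aeq_mact.
Qed.

(** Converts the flux terms eps^-1 curl h and mu^-1 curl e of the first-order system into the
    weighted norms of the curls. *)
Lemma wsqn_mactV (R : realType) (Om : set (R * R * R)) (A : mxfield R)
    (u : field R) :
  measurable Om -> coefficient Om A -> L2 Om u ->
  wsqn Om A (mact (minv A) u) = wsqn Om (minv A) u.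
Proof.
move=> mO [hA hAi] u2; have Au := measurable_mact mO hAi u2.
rewrite /wsqn [RHS]ipC; apply: ip_aeq => //; [|exact: mactVK|exact: aeqxx].
exact: measurable_mact.
Qed.

(** Expand the nonnegative A-norm of c u - A^-1 v and divide by c. *)
Lemma ip_weighted_young (R : realType) (Om : set (R * R * R)) (A : mxfield R)
    (c : R) (u v : field R) :
  measurable Om -> coefficient Om A -> L2 Om u -> L2 Om v -> 0 < c ->
  2 * ip Om u v <= c * wsqn Om A u + c^-1 * wsqn Om (minv A) v.
Proof.
move=> mO hA u2 v2 c0; have [hA1 hA2] := hA.
have Au := measurable_mact mO hA1 u2; have Av := measurable_mact mO hA2 v2.
have := wsqn_ge0 (c *: u - mact (minv A) v) hA1.
rewrite wsqnD// ?wsqnN ?wsqnZ//; [|exact: L2Z|exact: L2N].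
rewrite wsqn_mactV// -[in ip _ _ _]scaleN1r mactZ ipZl ?ipZr//; last exact: L2Z.
rewrite ip_mact// (@ip_aeq _ _ u u _ v)//; [|exact: measurable_mact|exact: aeqxx|exact: mactVK].
move=> h; rewrite -(ler_pM2l c0).
rewrite [leRHS](_ : _ = c ^+ 2 * wsqn Om A u + wsqn Om (minv A) v).
  by lra.
by field; exact: lt0r_neq0.
Qed.

(** * Test fields and the fundamental lemma *)

(** The whole chain of derivatives is the witness, so the later inductions on the order can move
    along it explicitly. *)
Definition smooth1 (R : realType) (f : R -> R) : Prop :=
  exists F : nat -> R -> R, F 0%N = f /\
    forall n (x : R), is_derive x (1 : R) (F n) (F n.+1 x).

(* The derivatives of [exp (- 1 / x)] all have this form. *)
Definition flat_exp (R : realType) (p : {poly R}) (x : R) : R :=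
  if 0 < x then p.[x^-1] * expR (- x^-1) else 0.

(** With y = 1/x >= 1 and n = [size p], |p(y)| <= S y^n, while exp y >= y^(n+2) / (n+2)!. The two
    extra powers of y become x^2, which is what makes the function flat at 0. *)
Lemma flat_exp_bound (R : realType) (p : {poly R}) :
  exists C : R, forall x, x <= 1 -> `|flat_exp p x| <= C * x ^+ 2.
Proof.
pose n := size p; pose S := (\sum_(i < n) `|p`_i| : R).
have S0 : 0 <= S by apply: sumr_ge0.
exists (S * (n.+2)`!%:R) => x x1; rewrite /flat_exp.
case: ifPn => [x0|_]; last by rewrite normr0 mulr_ge0 ?sqr_ge0// mulr_ge0.
set y := x^-1; have y1 : 1 <= y by rewrite invf_ge1.
have y0 : 0 < y by rewrite invr_gt0.
have py : `|p.[y]| <= S * y ^+ n.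
  rewrite horner_coef (le_trans (ler_norm_sum _ _ _))// mulr_suml.
  apply: ler_sum => i _; rewrite normrM ler_wpM2l//.
  rewrite normrX ger0_norm ?(ltW y0)//.
  by apply: ler_weXn2l => //; exact/ltnW/ltn_ord.
have ey : y ^+ n.+2 <= (n.+2)`!%:R * expR y.
  rewrite mulrC -ler_pdivrMr ?ltr0n ?fact_gt0//.
  have := @expR_ge1Dxn R y n.+1 (ltW y0); apply: le_trans.
  by rewrite lerDr.
rewrite normrM [X in _ * X]ger0_norm ?expR_ge0// expRN.
rewrite ler_pdivrMr ?expR_gt0// (le_trans py)// -!mulrA ler_wpM2l//.
rewrite ![_ * (_ * _)]mulrA mulrAC.
have -> : y ^+ n = y ^+ n.+2 * x ^+ 2.
  rewrite -addn2 exprD -mulrA -exprMn mulVf ?expr1n ?mulr1//.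
  exact: lt0r_neq0.
rewrite [leRHS](_ : _ = (n.+2)`!%:R * expR y * x ^+ 2); last by ring.
by rewrite ler_wpM2r ?sqr_ge0.
Qed.

(** By the quadratic bound, the difference quotient at 0 is at most C |h|. *)
Lemma is_derive_flat_exp0 (R : realType) (p : {poly R}) :
  is_derive (0 : R) (1 : R) (flat_exp p) 0.
Proof.
have [C hC] := flat_exp_bound p.
suff h : (fun h : R => h^-1 *: (flat_exp p (h *: 1 + 0) - flat_exp p 0))
    @ 0^' --> (0 : R).
  apply: DeriveDef; first by apply/cvg_ex; exists 0.
  exact: cvg_lim h.
have f0 : flat_exp p 0 = 0 by rewrite /flat_exp ltxx.
apply/norm_cvg0P.
apply: (@squeeze_cvgr _ _ _ _ (fun=> 0) (fun h : R => C * `|h|)).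
- near=> h; rewrite normr_ge0/= f0 subr0 addr0 normrZ normfV.
  have h0 : h != 0 by near: h; exact: nbhs_dnbhs_neq.
  rewrite ler_pdivrMl ?normr_gt0// [h *: 1]mulr1.
  rewrite mulrCA -expr2 real_normK ?num_real//; apply: hC.
  near: h; apply: nbhs_dnbhs; exact: lt_le_nbhsl ltr01.
- exact: cvg_cst.
- rewrite -[X in _ --> X](mulr0 C) -[X in C * X](@normr0 _ R).
  apply: cvgM; first exact: cvg_cst.
  by apply: cvg_norm; apply: cvg_within_filter; exact: cvg_id.
Unshelve. all: by end_near. Qed.

(** For y = 1/x one has dy/dx = -y^2, so differentiating p(y) exp(-y) replaces p by X^2 (p - p'):
    the family is closed under derivation. *)
Lemma is_derive_flat_exp (R : realType) (p : {poly R}) (x : R) :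
  is_derive x (1 : R) (flat_exp p) (flat_exp ('X^2 * (p - p^`())) x).
Proof.
have [x0|x0|->] := ltgtP x 0.
- rewrite [X in is_derive _ _ _ X](_ : _ = 0); last first.
    by rewrite /flat_exp ltNge (ltW x0).
  apply: (@near_eq_is_derive _ _ _ (cst 0)).
  near=> y; rewrite /flat_exp ifF//; apply/negbTE; rewrite -leNgt.
  by near: y; exact: lt_le_nbhsl.
- rewrite {2}/flat_exp x0.
  apply: (@near_eq_is_derive _ _ _ (fun y : R => p.[y^-1] * expR (- y^-1) : R)).
    near=> y; rewrite /flat_exp ifT//.
    by near: y; exact: lt_nbhsr.
  have dV : is_derive x (1 : R) (fun y : R => y^-1) (- x ^- 2).
    have := @is_deriveV _ (fun y : R => y) x 1 1 (lt0r_neq0 x0) (is_derive_id _ _).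
    by rewrite /GRing.scale/= mulr1.
  have d1 : is_derive x (1 : R) (fun y : R => p.[y^-1]) (p^`().[x^-1] * - x ^- 2).
    exact: (@is_derive1_comp _ (horner p) (fun y : R => y^-1) x).
  have d2 : is_derive x (1 : R) (fun y : R => expR (- y^-1))
      (expR (- x^-1) * x ^- 2).
    have dN : is_derive x (1 : R) (fun y : R => - y^-1) (x ^- 2).
      by have := is_deriveN dV; rewrite opprK.
    exact: (@is_derive1_comp _ expR (fun y : R => - y^-1) x).
  have d3 : is_derive x (1 : R) (fun y : R => p.[y^-1] * expR (- y^-1) : R) _ :=
    is_deriveM d1 d2.
  apply: is_derive_eq.
  rewrite !hornerE /GRing.scale/= exprVn; ring.
- rewrite [X in is_derive _ _ _ X](_ : _ = 0); last by rewrite /flat_exp ltxx.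
  exact: is_derive_flat_exp0.
Unshelve. all: by end_near. Qed.

Lemma smooth1_flat_exp (R : realType) (p : {poly R}) : smooth1 (flat_exp p).
Proof.
exists (fun n => flat_exp (iter n (fun p => 'X^2 * (p - p^`())) p)).
by split=> // n x; exact: is_derive_flat_exp.
Qed.

Lemma smooth1_affine (R : realType) (f : R -> R) (c d : R) :
  smooth1 f -> smooth1 (fun x => f (c * x + d)).
Proof.
move=> [F [F0 dF]]; exists (fun n x => c ^+ n * F n (c * x + d)); split.
  by apply/funext => x; rewrite F0 expr0 mul1r.
move=> n x.
have da : is_derive x (1 : R) (fun x : R => c * x + d) c.
  have := is_deriveD (is_deriveZ c (is_derive_id x (1 : R))) (is_derive_cst d x (1 : R)).
  by rewrite /GRing.scale/= mulr1 addr0.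
have h := @is_derive1_comp _ (F n) (fun x : R => c * x + d) x _ _ (dF _ _) da.
have h2 : is_derive x (1 : R) (fun x => c ^+ n * F n (c * x + d))
    (c ^+ n *: (F n.+1 (c * x + d) * c)) := is_deriveZ (c ^+ n) h.
apply: is_derive_eq.
by rewrite /GRing.scale/= exprS; ring.
Qed.

Lemma CnS (R : realType) n (f : R * R * R -> R) : Cn n.+1 f -> Cn n f.
Proof.
elim: n f => [|n ih] f; first by move=> [cf _]; split.
by move=> [cf df]; split=> // i; have [d1 d2] := df i; split=> //; exact: ih.
Qed.

Lemma CnD (R : realType) n (f g : R * R * R -> R) :
  Cn n f -> Cn n g -> Cn n (fun x => f x + g x).
Proof.
elim: n f g => [|n ih] f g [cf df] [cg dg].
  by split=> // x; apply: continuousD; [exact: cf|exact: cg].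
split=> [x|i]; first by apply: continuousD; [exact: cf|exact: cg].
have [d1 d2] := df i; have [e1 e2] := dg i.
split=> [x|]; first exact: derivableD.
rewrite (_ : (fun x => _) = (fun x => 'D_(unit3 R i) f x + 'D_(unit3 R i) g x)).
  exact: ih.
by apply/funext => x; exact: deriveD.
Qed.

Lemma CnM (R : realType) n (f g : R * R * R -> R) :
  Cn n f -> Cn n g -> Cn n (fun x => f x * g x).
Proof.
elim: n f g => [|n ih] f g.
  by move=> [cf df] [cg dg]; split=> // x; apply: continuousM; [exact: cf|exact: cg].
(* The product rule multiplies a derivative, of order [n], by an undifferentiated factor, which
   therefore has to be lowered to the same order. *)
move=> hf hg; have f1 := CnS hf; have g1 := CnS hg.
case: hf => [cf df]; case: hg => [cg dg].
split=> [x|i]; first by apply: continuousM; [exact: cf|exact: cg].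
have [d1 d2] := df i; have [e1 e2] := dg i.
split=> [x|]; first exact: derivableM.
rewrite (_ : (fun x => _) = (fun x =>
    f x * 'D_(unit3 R i) g x + g x * 'D_(unit3 R i) f x)).
  by apply: CnD; exact: ih.
by apply/funext => x; exact: deriveM.
Qed.

Definition coord3 (R : realType) (j : 'I_3) (x : R * R * R) : R :=
  if j == 0 then x.1.1 else if j == 1 then x.1.2 else x.2.

Lemma continuous_coord3 (R : realType) (j : 'I_3) : continuous (@coord3 R j).
Proof.
case: j => -[|[|[|]]]//= ? x; rewrite /coord3/=; last exact: cvg_snd.
- by apply: (@cvg_comp _ _ _ fst fst); [exact: cvg_fst|exact: cvg_fst].
- by apply: (@cvg_comp _ _ _ fst snd); [exact: cvg_fst|exact: cvg_snd].
Qed.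

Lemma coord3_line (R : realType) (i j : 'I_3) (h : R) (x : R * R * R) :
  coord3 j (h *: unit3 R i + x) = h * (i == j)%:R + coord3 j x.
Proof.
by rewrite /coord3 /unit3; case: j => -[|[|[|]]]//= ?; case: i => -[|[|[|]]].
Qed.

(** The partial derivative is the next member of the chain along direction [j] and 0 along the
    others; the statement is for all [k] so that the induction on [n] can shift the chain. *)
Lemma Cn_coord3 (R : realType) n (j : 'I_3) (F : nat -> R -> R) :
  (forall n (x : R), is_derive x (1 : R) (F n) (F n.+1 x)) ->
  forall k, Cn n (fun x => F k (coord3 j x)).
Proof.
move=> dF; have cF k : continuous (fun x : R * R * R => F k (coord3 j x)).
  move=> x; apply: continuous_comp; first exact: continuous_coord3.
  apply/differentiable_continuous/derivable1_diffP.
  by case: (dF k (coord3 j x)).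
elim: n => [|n ih] k; first by split.
have dE (i : 'I_3) (x : R * R * R) : is_derive x (unit3 R i)
    (fun x => F k (coord3 j x)) ((i == j)%:R * F k.+1 (coord3 j x)).
  have [/= ij|ij] := eqVneq i j; last first.
    rewrite mul0r.
    suff h : (fun h : R => h^-1 *: (F k (coord3 j (h *: unit3 R i + x)) -
       F k (coord3 j x))) @ 0^' --> (0 : R).
      by apply: DeriveDef; [apply/cvg_ex; exists 0|exact: cvg_lim h].
    rewrite (_ : (fun h : R => _) = cst 0); first exact: cvg_cst.
    by apply/funext => h; rewrite coord3_line (negbTE ij) mulr0 add0r subrr scaler0.
  rewrite mul1r; have [dk Dk] := dF k (coord3 j x).
  have E : (fun h : R => h^-1 *: (F k (coord3 j (h *: unit3 R i + x)) -
      F k (coord3 j x))) = (fun h : R => h^-1 *: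
      (F k (h *: (1 : R) + coord3 j x) - F k (coord3 j x))).
    by apply/funext => h; rewrite coord3_line ij eqxx.
  by apply: DeriveDef; [rewrite /derivable E; exact: dk|rewrite /derive E; exact: Dk].
split=> // i; split=> [x|]; first by case: (dE i x).
rewrite (_ : (fun x => _) = (fun x => (i == j)%:R * F k.+1 (coord3 j x))).
  case: (i == j).
    by under eq_fun do rewrite mul1r; exact: ih.
  under eq_fun do rewrite mul0r.
  elim: (n) => [|n' ih']; first by split=> // x; exact: cvg_cst.
  split=> [x|i']; first exact: cvg_cst.
  split=> [x|]; first exact: derivable_cst.
  by rewrite (_ : (fun x => _) = fun=> 0)//; apply/funext => x; exact: derive_cst.
by apply/funext => x; have [_ ->] := dE i x.
Qed.

(** Scaling inside [flat_exp] sends the bump to the indicator of ]a, b[ as k grows, with values kept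
    in [0, 1]; [k.+1] keeps the scale positive. *)
Definition bump1 (R : realType) (k : nat) (a b t : R) : R :=
  flat_exp 1 (k.+1%:R * (t - a)) * flat_exp 1 (k.+1%:R * (b - t)).

Lemma flat_exp1_itv (R : realType) (x : R) : 0 <= flat_exp 1 x <= 1.
Proof.
rewrite /flat_exp; case: ifPn => x0; last by rewrite lexx ler01.
by rewrite hornerC mul1r expR_ge0 expR_le1 oppr_le0 invr_ge0 ltW.
Qed.

Lemma bump1_itv (R : realType) k (a b t : R) : 0 <= bump1 k a b t <= 1.
Proof.
have /andP[h1 h2] := flat_exp1_itv (k.+1%:R * (t - a)).
have /andP[h3 h4] := flat_exp1_itv (k.+1%:R * (b - t)).
by rewrite /bump1 mulr_ge0// mulr_ile1.
Qed.

Lemma bump1_out (R : realType) k (a b t : R) :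
  t \notin `]a, b[ -> bump1 k a b t = 0.
Proof.
rewrite in_itv/= negb_and -!leNgt /bump1 /flat_exp => /orP[h|h].
  by rewrite ltNge pmulr_rle0// subr_le0 h mul0r.
by rewrite [X in _ * (if X then _ else _)]ltNge pmulr_rle0// subr_le0 h mulr0.
Qed.

Lemma cvg_flat_exp (R : realType) (d : R) : 0 < d ->
  flat_exp 1 (k.+1%:R * d) @[k --> \oo] --> (1 : R).
Proof.
move=> d0.
have -> : (fun k : nat => flat_exp 1 (k.+1%:R * d)) =
    (fun k : nat => expR (- (d^-1 * k.+1%:R^-1))).
  by apply/funext => k; rewrite /flat_exp pmulr_rgt0// d0 hornerC mul1r invfM mulrC.
rewrite -[X in _ --> X](@expR0 R) -[X in expR X]oppr0 -(mulr0 d^-1).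
apply: continuous_cvg; first exact: continuous_expR.
apply: cvgN; apply: cvgM; first exact: cvg_cst.
exact: cvg_harmonic.
Qed.

Lemma cvg_bump1 (R : realType) (a b t : R) : t \in `]a, b[ ->
  bump1 k a b t @[k --> \oo] --> (1 : R).
Proof.
rewrite in_itv/= => /andP[ta tb]; rewrite -[X in _ --> X](mulr1 1).
by apply: cvgM; apply: cvg_flat_exp; rewrite subr_gt0.
Qed.

Lemma smooth1_bump1 (R : realType) n (j : 'I_3) k (a b : R) :
  Cn n (fun x => bump1 k a b (coord3 j x)).
Proof.
have h (c d : R) : Cn n (fun x => flat_exp 1 (c * coord3 j x + d)).
  have [F [F0 dF]] := smooth1_affine c d (smooth1_flat_exp (1 : {poly R})).
  have := @Cn_coord3 R n j F dF 0%N; rewrite F0; exact.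
rewrite /bump1; apply: CnM.
  by under eq_fun do rewrite mulrBr; exact: h.
under eq_fun do rewrite mulrBr addrC -mulNr; exact: h.
Qed.

(** * Boxes as generators, and the fundamental lemma of the calculus of variations *)

Definition box3 (R : realType) (a b : 'I_3 -> R) : set (R * R * R) :=
  [set x | forall j, coord3 j x \in `]a j, b j[].

Definition cbox3 (R : realType) (a b : 'I_3 -> R) : set (R * R * R) :=
  [set x | forall j, coord3 j x \in `[a j, b j]].

Lemma forall_I3 (P : 'I_3 -> Prop) :
  (forall j, P j) <-> [/\ P 0, P 1 & P 2%:R].
Proof.
split=> [h|[h0 h1 h2] [[|[|[|//]]] i]]; first by split.
- by rewrite (_ : Ordinal i = 0)//; exact/val_inj.
- by rewrite (_ : Ordinal i = 1)//; exact/val_inj.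
- by rewrite (_ : Ordinal i = 2%:R)//; exact/val_inj.
Qed.

Lemma box3E (R : realType) (a b : 'I_3 -> R) :
  box3 a b = (`]a 0, b 0[ `*` `]a 1, b 1[) `*` `]a 2%:R, b 2%:R[.
Proof.
by apply/seteqP; split => x; rewrite /box3/= forall_I3; [case|case=> -[]].
Qed.

Lemma cbox3E (R : realType) (a b : 'I_3 -> R) :
  cbox3 a b = (`[a 0, b 0] `*` `[a 1, b 1]) `*` `[a 2%:R, b 2%:R].
Proof.
by apply/seteqP; split => x; rewrite /cbox3/= forall_I3; [case|case=> -[]].
Qed.

Lemma compact_cbox3 (R : realType) (a b : 'I_3 -> R) : compact (cbox3 a b).
Proof.
by rewrite cbox3E; apply: compact_setX; [apply: compact_setX|];
  exact: segment_compact.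
Qed.

Lemma measurable_box3 (R : realType) (a b : 'I_3 -> R) : measurable (box3 a b).
Proof. by rewrite box3E; apply: measurableX; [apply: measurableX|]. Qed.

Lemma leb3_cbox3_fin (R : realType) (a b : 'I_3 -> R) :
  (@leb3 R (cbox3 a b) < +oo)%E.
Proof.
rewrite cbox3E /leb3 product_measure1E//; last exact: measurableX.
rewrite [X in (X * _)%E](_ : _ = (lebesgue_measure `[a 0%R, b 0%R]%classic *
    lebesgue_measure `[a 1%R, b 1%R]%classic)%E); last exact: product_measure1E.
have fin (c d : R) : lebesgue_measure (`[c, d]%classic : set R) \is a fin_num.
  by rewrite lebesgue_measure_itv/=; case: ifP.
by rewrite ltey_eq !fin_numM ?fin.
Qed.

Lemma measurable_cbox3 (R : realType) (a b : 'I_3 -> R) : measurable (cbox3 a b).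
Proof. by rewrite cbox3E; apply: measurableX; [apply: measurableX|]. Qed.

Lemma leb3_box3_fin (R : realType) (a b : 'I_3 -> R) :
  (@leb3 R (box3 a b) < +oo)%E.
Proof.
apply: le_lt_trans (leb3_cbox3_fin a b); apply: le_measure; rewrite ?inE.
- exact: measurable_box3.
- exact: measurable_cbox3.
- by move=> x h j; have := h j; rewrite !in_itv/= => /andP[/ltW -> /ltW ->].
Qed.

Definition bump3 (R : realType) (k : nat) (a b : 'I_3 -> R) (x : R * R * R) : R :=
  bump1 k (a 0) (b 0) (coord3 0 x) * bump1 k (a 1) (b 1) (coord3 1 x) *
  bump1 k (a 2%:R) (b 2%:R) (coord3 2%:R x).

Lemma Cn_bump3 (R : realType) n k (a b : 'I_3 -> R) : Cn n (bump3 k a b).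
Proof. by apply: CnM; [apply: CnM|]; exact: smooth1_bump1. Qed.

Lemma bump3_itv (R : realType) k (a b : 'I_3 -> R) x : 0 <= bump3 k a b x <= 1.
Proof.
rewrite /bump3.
have /andP[? ?] := bump1_itv k (a 0) (b 0) (coord3 0 x).
have /andP[? ?] := bump1_itv k (a 1) (b 1) (coord3 1 x).
have /andP[? ?] := bump1_itv k (a 2%:R) (b 2%:R) (coord3 2%:R x).
apply/andP; split; [by apply: mulr_ge0 => //; apply: mulr_ge0|].
by apply: mulr_ile1 => //; [exact: mulr_ge0|exact: mulr_ile1].
Qed.

Lemma bump3_out (R : realType) k (a b : 'I_3 -> R) x :
  ~ box3 a b x -> bump3 k a b x = 0.
Proof.
rewrite /box3/= forall_I3 => /not_and3P[] /negP h; rewrite /bump3 (bump1_out _ h).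
- by rewrite !mul0r.
- by rewrite mulr0 mul0r.
- by rewrite mulr0.
Qed.

Lemma cvg_bump3 (R : realType) (a b : 'I_3 -> R) x : box3 a b x ->
  bump3 k a b x @[k --> \oo] --> (1 : R).
Proof.
move=> h; rewrite (_ : 1 = 1 * 1 * 1 :> R); last by rewrite !mulr1.
by apply: cvgM; [apply: cvgM|]; exact: cvg_bump1.
Qed.

Definition boxes3 (R : realType) : set (set (R * R * R)) :=
  [set B | exists a b : 'I_3 -> R, B = box3 a b].

Lemma box3I (R : realType) (a b a' b' : 'I_3 -> R) :
  box3 a b `&` box3 a' b' =
  box3 (fun j => Num.max (a j) (a' j)) (fun j => Num.min (b j) (b' j)).
Proof.
apply/seteqP; split=> x.
  move=> [h1 h2] j; have := h1 j; have := h2 j; rewrite !in_itv/=.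
  by rewrite gt_max lt_min => /andP[-> ->] /andP[-> ->].
move=> h; split=> j; have := h j; rewrite !in_itv/= gt_max lt_min.
  by move=> /andP[/andP[-> _] /andP[-> _]].
by move=> /andP[/andP[_ ->] /andP[_ ->]].
Qed.

Lemma setI_closed_boxes3 (R : realType) : setI_closed (@boxes3 R).
Proof.
move=> _ _ [a [b ->]] [a' [b' ->]]; rewrite box3I.
by eexists; eexists; reflexivity.
Qed.

Lemma sigma_boxes3_coord (R : realType) (j : 'I_3) (A : set R) :
  measurable A -> <<s @boxes3 R >> (@coord3 R j @^-1` A).
Proof.
move=> mA; have {mA} : (@RGenOpens.G R).-sigma.-measurable A.
  by rewrite -RGenOpens.measurableE.
move: A.
suff h : <<s @RGenOpens.G R >> `<=` [set B | <<s @boxes3 R >> (@coord3 R j @^-1` B)].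
  by move=> A; exact: h.
apply: smallest_sub.
  have [s0 sC sU] := smallest_sigma_algebra setT (@boxes3 R).
  split=> /=.
  - by rewrite preimage_set0.
  - by move=> B /sC; rewrite !setTD preimage_setC.
  - by move=> F /sU; rewrite preimage_bigcup.
move=> _ [x [y ->]] /=.
(* A slab is not a box, but it is a countable union of boxes whose other sides grow to infinity. *)
have -> : @coord3 R j @^-1` `]x, y[%classic = \bigcup_n
    box3 (fun i => if i == j then x else - n%:R) (fun i => if i == j then y else n%:R).
  apply/seteqP; split=> z /=; last first.
    by move=> [n _ /(_ j)]; rewrite eqxx.
  move=> zj; have [n hn] : exists n : nat, forall i, `|coord3 i z| < n%:R.
    exists (Num.truncn (\sum_i `|coord3 i z|)).+1 => i.
    apply: le_lt_trans (Num.Theory.truncnS_gt _).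
    by rewrite (bigD1 i)//= lerDl sumr_ge0.
  exists n => // i; case: eqP => [->//|_].
  by rewrite in_itv/= -ltr_norml.
apply: sigma_algebra_bigcup => n; apply: sub_sigma_algebra.
by eexists; eexists; reflexivity.
Qed.

(** Together with stability under intersection, this is what the Dynkin argument requires of the
    boxes. Each inclusion is tested on generators. *)
Lemma measurable_boxes3 (R : realType) :
  @measurable _ (measurableTypeR R * measurableTypeR R * measurableTypeR R)%type
    = <<s @boxes3 R >>.
Proof.
apply/seteqP; split; last first.
  apply: smallest_sub; first exact: sigma_algebra_measurable.
  by move=> _ [a [b ->]]; exact: measurable_box3.
have sa := smallest_sigma_algebra setT (@boxes3 R).
apply: smallest_sub => //; rewrite subUset; split; last first.
  move=> _ [A mA <-]; rewrite setTI; exact: (@sigma_boxes3_coord R 2%:R).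
have [s0 sC sU] := sa.
suff h : @measurable _ (measurableTypeR R * measurableTypeR R)%type `<=`
    [set B | <<s @boxes3 R >> (fst @^-1` B)].
  by move=> _ [A mA <-]; rewrite setTI; exact: h.
apply: smallest_sub.
  split=> /=.
  - by rewrite preimage_set0.
  - by move=> B /sC; rewrite !setTD preimage_setC.
  - by move=> F /sU; rewrite preimage_bigcup.
rewrite subUset; split=> _ [A mA <-] /=; rewrite setTI.
  exact: (@sigma_boxes3_coord R 0).
exact: (@sigma_boxes3_coord R 1).
Qed.

Definition scalar_test (R : realType) (Om : set (R * R * R))
    (psi : R * R * R -> R) : Prop :=
  (forall n, Cn n psi) /\
  exists K, [/\ compact K, K `<=` Om & forall x, ~ K x -> psi x = 0].

Lemma box3_sub (R : realType) (a b : 'I_3 -> R) : box3 a b `<=` cbox3 a b.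
Proof. by move=> x h j; have := h j; rewrite !in_itv/= => /andP[/ltW -> /ltW ->]. Qed.

Lemma scalar_test_bump3 (R : realType) (Om : set (R * R * R)) k
    (a b : 'I_3 -> R) :
  cbox3 a b `<=` Om -> scalar_test Om (bump3 k a b).
Proof.
move=> abO; split=> [n|]; first exact: Cn_bump3.
exists (cbox3 a b); split => //; first exact: compact_cbox3.
by move=> x xab; apply: bump3_out => /box3_sub.
Qed.

(** |f| <= 1 + f^2, and constants are integrable on a set of finite measure. *)
Lemma sqint_integrable_fin {d} {T : measurableType d} {R : realType}
    (m : {measure set T -> \bar R}) (D B : set T) (f : T -> R) :
  measurable D -> measurable B -> B `<=` D -> (m B < +oo)%E ->
  sqint m D f -> m.-integrable B (EFin \o f).
Proof.
move=> mD mB BD Bfin [mf if2].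
have mfB := measurable_funS mD BD mf.
have i1 : m.-integrable B (cst 1%:E) by apply/integrableP; split=> //; rewrite integral_cst// normr1 mul1e.
have i2 : m.-integrable B (fun x => ((f x) ^+ 2)%:E).
  exact: (integrableS mD mB BD if2).
apply: (le_integrable mB _ _ (integrableD mB i1 i2)).
  exact/measurable_EFinP.
move=> x Bx /=; rewrite lee_fin [leRHS]ger0_norm ?addr_ge0 ?sqr_ge0//.
by rewrite ler_norml; apply/andP; split; nra.
Qed.

(** Dominated convergence along the bumps of the box, with |w| as dominating function; the closed
    box must lie in [Om] for the bumps to be admissible. *)
Lemma integral_box3_eq0 (R : realType) (Om : set (R * R * R))
    (w : R * R * R -> R) (a b : 'I_3 -> R) :
  measurable Om -> sqint (@leb3 R) Om w ->
  (forall psi, scalar_test Om psi ->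
     \int[@leb3 R]_(x in Om) (w x * psi x) = 0) ->
  cbox3 a b `<=` Om -> (\int[@leb3 R]_(x in box3 a b) (w x)%:E = 0)%E.
Proof.
move=> mO w2 w0 abO; have bO := subset_trans (@box3_sub _ a b) abO.
have mB := @measurable_box3 R a b.
have iw := @sqint_integrable_fin _ _ R (@leb3 R) Om (box3 a b) w mO mB bO (leb3_box3_fin a b) w2.
have /integrableP[/measurable_EFinP mw _] := iw.
have mpsi k (D : set (R * R * R)) : measurable D -> measurable_fun D (bump3 k a b).
  by move=> mD; apply: continuous_measurable_R3 => //; have [] := Cn_bump3 0 k a b.
have [|||||_ _ h] := @dominated_convergence _ _ _ (@leb3 R) (box3 a b) mB
  (fun k x => (w x * bump3 k a b x)%:E) (EFin \o w) (fun x => `|w x|%:E).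
- by move=> k; apply/measurable_EFinP; apply: measurable_funM => //; exact: mpsi.
- exact: measurable_int iw.
- apply: aeW => x Bx; apply: cvg_EFin; first exact: nearW.
  rewrite -[X in _ --> X]mulr1; apply: cvgM; [exact: cvg_cst|exact: cvg_bump3].
- exact: (integrable_abse iw).
- apply: aeW => x k Bx; rewrite lee_fin normrM.
  have /andP[h1 h2] := bump3_itv k a b x.
  by rewrite (ger0_norm h1) ler_piMr.
(* The bump vanishes off the box, so this integral equals the one over [Om], which is zero by
   assumption. *)
suff E k : (\int[@leb3 R]_(x in box3 a b) (w x * bump3 k a b x)%:E = 0)%E.
  have <- := cvg_lim _ h => //.
  by under eq_fun do rewrite E; rewrite lim_cst.
have := w0 _ (scalar_test_bump3 k abO).
rewrite /Rintegral (_ : (\int[@leb3 R]_(x in Om) (w x * bump3 k a b x)%:E)%E =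
    (\int[@leb3 R]_(x in box3 a b) (w x * bump3 k a b x)%:E)%E).
  move=> e; rewrite -[LHS]fineK ?e//; apply: integrable_fin_num => //.
  apply: (@le_integrable _ _ _ (@leb3 R) _ mB _ (fun x => `|w x|%:E) _ _ (integrable_abse iw)).
    by apply/measurable_EFinP; apply: measurable_funM => //; exact: mpsi.
  move=> x Bx; rewrite lee_fin normrM normr_id.
  have /andP[h1 h2] := bump3_itv k a b x.
  by rewrite (ger0_norm h1) ler_piMr.
rewrite [LHS]integral_mkcond [RHS]integral_mkcond; apply: eq_integral => x _.
rewrite /patch; case: ifPn => [/set_mem Ox|/negP nO].
  case: ifPn => // /negP nB; rewrite bump3_out ?mulr0//.
  by move=> /mem_set.
by case: ifPn => // /set_mem/bO/mem_set.
Qed.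

(** The measurable sets A with zero integral of w over A intersected with the box form a Dynkin
    class containing the boxes, hence are all of them. *)
Lemma ae_eq0_box3 (R : realType) (a b : 'I_3 -> R) (w : R * R * R -> R) :
  (@leb3 R).-integrable (box3 a b) (EFin \o w) ->
  (forall a' b' : 'I_3 -> R, (forall j, a j <= a' j) -> (forall j, b' j <= b j) ->
    (\int[@leb3 R]_(x in box3 a' b') (w x)%:E = 0)%E) ->
  {ae @leb3 R, forall x, box3 a b x -> w x = 0}.
Proof.
move=> iw w0; have mB := @measurable_box3 R a b.
suff h : ae_eq (@leb3 R) (box3 a b) (EFin \o w) (cst 0%E).
  by apply: filterS h => x h Bx; exact: EFin_inj (h Bx).
apply: integral_ae_eq => //.
move=> E EB mE; rewrite integral0 -(setIidl EB).
move: E mE {EB}; rewrite measurable_boxes3.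
have iwS A : measurable A -> (@leb3 R).-integrable (A `&` box3 a b) (EFin \o w).
  move=> mA; have mAB : measurable (A `&` box3 a b) by exact: measurableI.
  exact: (@integrableS _ _ _ (@leb3 R) _ _ _ mB mAB (@subIsetr _ _ _) iw).
apply: (@dynkin_induction _
  (measurableTypeR R * measurableTypeR R * measurableTypeR R)%type (@boxes3 R)
  (fun E => \int[@leb3 R]_(x in E `&` box3 a b) (EFin \o w) x = 0)%E
  (@measurable_boxes3 R) (@setI_closed_boxes3 R)).
- by rewrite setTI; apply: w0.
- move=> _ [a' [b' ->]]; rewrite box3I; apply: w0 => j.
    by rewrite le_max lexx orbT.
  by rewrite ge_min lexx orbT.
- move=> A mA A0.
  have E : (A `&` box3 a b) `|` (~` A `&` box3 a b) = box3 a b.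
    by rewrite -setIUl setUv setTI.
  have : (\int[@leb3 R]_(x in (A `&` box3 a b) `|` (~` A `&` box3 a b)) (w x)%:E = 0)%E.
    by rewrite E; apply: w0.
  rewrite integral_setU//=; last 4 first.
  + exact: measurableI.
  + by apply: measurableI => //; exact: measurableC.
  + by rewrite E; exact: measurable_int iw.
  + by apply/disj_setPS => x [[Ax _] [/(_ Ax)]].
  by rewrite A0 add0e.
- move=> F mF tF F0; rewrite setI_bigcupl.
  rewrite integral_bigcup//.
  + by apply: eseries0 => i _ _; exact: F0.
  + exact: trivIset_setIr.
  + by move=> k; exact: measurableI.
  + by rewrite -setI_bigcupl; apply: iwS; exact: bigcupT_measurable.
Qed.

Lemma open_rational_box (R : realType) (Om : set (R * R * R)) x :
  open Om -> Om x -> exists a b : {ffun 'I_3 -> rat},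
    box3 (fun j => ratr (a j)) (fun j => ratr (b j)) x /\
    cbox3 (fun j => ratr (a j)) (fun j => ratr (b j)) `<=` Om.
Proof.
move=> oO Ox; have : nbhs x Om by exact: open_nbhs_nbhs.
move=> /nbhs_ballP[r /= r0 rO].
have hq j : exists q : rat * rat,
    [&& coord3 j x - r / 2 < ratr q.1, ratr q.1 < coord3 j x,
    coord3 j x < ratr q.2 & ratr q.2 < coord3 j x + r / 2].
  have /rat_in_itvoo[p /[!in_itv]/= /andP[p1 p2]] : coord3 j x - r / 2 < coord3 j x by lra.
  have /rat_in_itvoo[q /[!in_itv]/= /andP[q1 q2]] : coord3 j x < coord3 j x + r / 2 by lra.
  by exists (p, q); apply/and4P.
have [q hq'] := choice hq.
exists [ffun j => (q j).1], [ffun j => (q j).2]; split.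
  move=> j; rewrite !ffunE in_itv/=.
  by have /and4P[_ -> -> _] := hq' j.
move=> y hy; apply: rO; rewrite /ball/=.
have h j : `|coord3 j x - coord3 j y| < r.
  have := hy j; rewrite !ffunE in_itv/= => /andP[h1 h2].
  have /and4P[h3 h4 h5 h6] := hq' j.
  by rewrite ltr_norml; apply/andP; split; lra.
by split; [split; [exact: (h 0)|exact: (h 1)]|exact: (h 2%:R)].
Qed.

(** [Om] is covered by the rational boxes whose closure it contains; being countably many, their
    exceptional null sets can be united. *)
Lemma ae_eq0_local (R : realType) (Om : set (R * R * R)) (w : R * R * R -> R) :
  open Om -> sqint (@leb3 R) Om w ->
  (forall psi, scalar_test Om psi ->
     \int[@leb3 R]_(x in Om) (w x * psi x) = 0) ->
  {ae @leb3 R, forall x, Om x -> w x = 0}.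
Proof.
move=> oO w2 w0; have mO := open_measurable_R3 oO.
pose bx (p : {ffun 'I_3 -> rat} * {ffun 'I_3 -> rat}) :=
  box3 (fun j => ratr (p.1 j) : R) (fun j => ratr (p.2 j)).
pose cbx (p : {ffun 'I_3 -> rat} * {ffun 'I_3 -> rat}) :=
  cbox3 (fun j => ratr (p.1 j) : R) (fun j => ratr (p.2 j)).
pose good p : Prop := cbx p `<=` Om.
(* Boxes are enumerated by their codes, and the claim is vacuous for a number that encodes none or a
   box that leaves [Om]. *)
have h (n : nat) : {ae @leb3 R, forall x, forall p, unpickle n = Some p ->
    good p -> bx p x -> w x = 0}.
  case En : (unpickle n) => [p|]; last exact: aeW.
  have [gp|ngp] := pselect (good p); last first.
    by apply: aeW => x _ [<-].
  have mB := @measurable_box3 R (fun j => ratr (p.1 j)) (fun j => ratr (p.2 j)).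
  have bO : bx p `<=` Om by exact: (subset_trans (@box3_sub _ _ _) gp).
  have iw := @sqint_integrable_fin _ _ R (@leb3 R) Om (bx p) w mO mB bO
    (leb3_box3_fin _ _) w2.
  have : {ae @leb3 R, forall x, bx p x -> w x = 0}.
    apply: ae_eq0_box3 => // a' b'.
    move=> a'a b'b; apply: (integral_box3_eq0 mO w2 w0).
    apply: subset_trans gp => x hx j; have := hx j; rewrite !in_itv/=.
    by move=> /andP[/(le_trans (a'a j)) -> /le_trans ->].
  by apply: filterS => x hx p' [<-] _; exact: hx.
have {}h : {ae @leb3 R, forall x, forall n p, unpickle n = Some p ->
    good p -> bx p x -> w x = 0} by exact: ae_foralln.
apply: filterS h => x hx Ox.
have [a [b [h1 h2]]] := open_rational_box oO Ox.
by apply: (hx (pickle (a, b)) (a, b)) => //; rewrite pickleK.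
Qed.

(** * The weak curl *)

Lemma compact_coord3_bound (R : realType) (K : set (R * R * R)) :
  compact K -> exists2 M : R, 0 < M & forall x, K x -> forall j, `|coord3 j x| < M.
Proof.
move=> /compact_bounded[M [_ hM]].
exists (Num.max M 0 + 1 + 1); first by rewrite -addrA ltr_wpDl ?le_max ?lexx ?orbT.
move=> x Kx j; apply: (@le_lt_trans _ _ `|x|); last first.
  apply: (@le_lt_trans _ _ (Num.max M 0 + 1)); last by rewrite ltrDl.
  by apply: hM => //; rewrite ltr_pwDr// le_max lexx.
rewrite /coord3 !prod_normE.
case: j => -[|[|[|//]]] ? /=; first by rewrite !le_max lexx.
  by rewrite !le_max lexx orbT.
by rewrite !le_max lexx orbT.
Qed.

Lemma compact_support_bound (R : realType) (K : set (R * R * R))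
    (f : R * R * R -> R) :
  compact K -> continuous f -> (forall x, ~ K x -> f x = 0) ->
  exists2 C, 0 <= C & forall x, `|f x| <= C.
Proof.
move=> cK cf f0.
have : compact (f @` K).
  by apply: continuous_compact => //; exact: continuous_subspaceT.
move=> /compact_bounded[M [_ hM]].
exists (Num.max M 0 + 1); first by rewrite addr_ge0// le_max lexx orbT.
move=> x; have [Kx|nK] := pselect (K x).
  by apply: (hM (Num.max M 0 + 1)); [rewrite ltr_pwDr// le_max lexx|exists x].
by rewrite f0// normr0 addr_ge0// le_max lexx orbT.
Qed.

Lemma compact_support_integrable (R : realType) (D K : set (R * R * R))
    (f : R * R * R -> R) :
  measurable D -> compact K -> continuous f -> (forall x, ~ K x -> f x = 0) ->
  (@leb3 R).-integrable D (EFin \o f).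
Proof.
move=> mD cK cf f0.
have [M M0 hM] := compact_coord3_bound cK.
have [C C0 hC] := compact_support_bound cK cf f0.
pose B := @cbox3 R (fun=> - M) (fun=> M).
have mB : measurable B by exact: measurable_cbox3.
have KB : K `<=` B.
  move=> x Kx j; rewrite in_itv/=.
  by have := hM x Kx j; rewrite ltr_norml => /andP[/ltW -> /ltW ->].
have iB : (@leb3 R).-integrable D (EFin \o (fun x => C * \1_B x)).
  apply: (@integrableS _ _ _ (@leb3 R) setT) => //.
  apply/integrableP; split.
    by apply/measurable_EFinP; apply: measurable_funM.
  under eq_integral do rewrite /= ger0_norm ?mulr_ge0//.
  under eq_integral do rewrite EFinM.
  rewrite ge0_integralZl//=; last first.
    by apply/measurable_EFinP; exact: measurable_indic.
  rewrite integral_indic// setIT lte_mul_pinfty//.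
  exact: leb3_cbox3_fin.
apply: (@le_integrable _ _ _ (@leb3 R) _ mD _ _ _ _ iB).
  by apply/measurable_EFinP; exact: continuous_measurable_R3.
move=> x Dx /=; rewrite lee_fin [leRHS]ger0_norm ?mulr_ge0//.
have [Kx|nK] := pselect (K x); last by rewrite f0// normr0 mulr_ge0.
by rewrite indicE mem_set ?mulr1//; exact: KB.
Qed.

Lemma compact_support_sqint (R : realType) (D K : set (R * R * R))
    (f : R * R * R -> R) :
  measurable D -> compact K -> continuous f -> (forall x, ~ K x -> f x = 0) ->
  sqint (@leb3 R) D f.
Proof.
move=> mD cK cf f0; split; first exact: continuous_measurable_R3.
apply: (@compact_support_integrable _ _ K (fun x => f x ^+ 2)) => //.
  by move=> x; apply: (@continuousM _ _ f f); exact: cf.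
by move=> x nK; rewrite f0// expr0n.
Qed.

(** * Integrals of compactly supported derivatives *)

Lemma derive_off_support (R : realType) (K : set (R * R * R))
    (f : R * R * R -> R) (v : R * R * R) :
  compact K -> (forall x, ~ K x -> f x = 0) ->
  forall x, ~ K x -> 'D_v f x = 0.
Proof.
move=> cK f0 x nK; rewrite (@near_eq_derive _ _ _ f (cst 0)) ?derive_cst//.
have : open (~` K).
  by apply: closed_openC; apply: compact_closed => //; exact: norm_hausdorff.
move=> oK; have : nbhs x (~` K) by exact: open_nbhs_nbhs.
by apply: filterS => y; exact: f0.
Qed.

Lemma integral_derive_compact (R : realType) (f g : R -> R) (M : R) : 0 < M ->
  (forall t, is_derive t (1 : R) f (g t)) -> continuous g ->
  (forall t, M <= `|t| -> f t = 0) -> (forall t, M <= `|t| -> g t = 0) ->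
  (\int[@lebesgue_measure R]_t (g t)%:E = 0)%E.
Proof.
move=> M0 df cg f0 g0.
have cf : continuous f.
  by move=> t; apply/differentiable_continuous/derivable1_diffP; case: (df t).
have NM : - M < M by rewrite gtrN.
transitivity (\int[@lebesgue_measure R]_(t in `[(- M)%R, M%R]) (g t)%:E)%E.
  rewrite [RHS]integral_mkcond; apply: eq_integral => t _; rewrite /patch.
  case: ifPn => // /negP h; rewrite g0// leNgt; apply/negP => tM.
  by apply: h; apply: mem_set; rewrite /= in_itv/= -ler_norml ltW.
rewrite (@continuous_FTC2 _ g f)//.
- by rewrite !f0 ?subee// ?normrN ler_norm.
- exact: continuous_subspaceT.
- split; first by move=> t _; case: (df t).
  + exact/cvg_at_right_filter/cf.
  + exact/cvg_at_left_filter/cf.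
- by move=> t _; rewrite derive1E; case: (df t).
Qed.

Lemma unit3_line0 (R : realType) (h x1 x2 t : R) :
  h *: unit3 R 0 + (t, x1, x2) = (h *: (1 : R) + t, x1, x2).
Proof.
by rewrite /unit3; congr (_, _, _); rewrite /= /GRing.scale/= mulr0 add0r.
Qed.

Lemma unit3_line1 (R : realType) (h x1 x2 t : R) :
  h *: unit3 R 1 + (x1, t, x2) = (x1, h *: (1 : R) + t, x2).
Proof.
by rewrite /unit3; congr (_, _, _); rewrite /= /GRing.scale/= mulr0 add0r.
Qed.

Lemma unit3_line2 (R : realType) (h x1 x2 t : R) :
  h *: unit3 R 2%:R + (x1, x2, t) = (x1, x2, h *: (1 : R) + t).
Proof.
by rewrite /unit3; congr (_, _, _); rewrite /= /GRing.scale/= mulr0 add0r.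
Qed.

(** [l] is a line parallel to axis [i], parametrised by its own [i]-th coordinate. On it the partial
    derivative is an ordinary one, so a single argument serves the three directions. *)
Lemma integral_line_derive (R : realType) (K : set (R * R * R))
    (f : R * R * R -> R) (i : 'I_3) (l : R -> R * R * R) :
  compact K -> (forall x, ~ K x -> f x = 0) -> Cn 1 f -> continuous l ->
  (forall h t, h *: unit3 R i + l t = l (h *: (1 : R) + t)) ->
  (forall t, coord3 i (l t) = t) ->
  (\int[@lebesgue_measure R]_t ('D_(unit3 R i) f (l t))%:E = 0)%E.
Proof.
move=> cK f0 [cf df] cl hl lt; have [M M0 hM] := compact_coord3_bound cK.
have [d1 [d2 _]] := df i.
have lK t : M <= `|t| -> ~ K (l t).
  by move=> tM Kl; have := hM _ Kl i; rewrite lt ltNge tM.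
apply: (@integral_derive_compact _ (f \o l) _ M) => //.
- move=> t; have E : (fun h : R => h^-1 *: ((f \o l) (h *: (1 : R) + t) - (f \o l) t)) =
      (fun h : R => h^-1 *: (f (h *: unit3 R i + l t) - f (l t))).
    by apply/funext => h; rewrite hl.
  apply: DeriveDef; first by rewrite /derivable E; exact: d1.
  by rewrite /derive E.
- have cD : continuous (fun t : R => 'D_(unit3 R i) f (l t)).
    by move=> t; exact: (@continuous_comp _ _ _ l _ t (cl t) (d2 _)).
  exact: cD.
- by move=> t /lK/f0.
- by move=> t /lK; exact: derive_off_support.
Qed.

(** The hypothesis is asked only of integrable sections, which almost all are, so that the lemma can
    be nested: the section of a triple integral is again a product integral. *)
Lemma fubini_section_eq0 d1 d2 (T1 : measurableType d1)
    (T2 : measurableType d2) (R : realType)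
    (m1 : {sigma_finite_measure set T1 -> \bar R})
    (m2 : {sigma_finite_measure set T2 -> \bar R}) (g : T1 * T2 -> \bar R) :
  (m1 \x m2)%E.-integrable setT g ->
  (forall y, m1.-integrable setT (fun x => g (x, y)) ->
    \int[m1]_x g (x, y) = 0)%E ->
  (\int[m1 \x m2]_x g x = 0)%E.
Proof.
move=> ig g0; rewrite -(integral21_prod_meas1 ig).
transitivity (\int[m2]_(x in setT) (cst 0%E x))%E; last by rewrite integral0.
apply: ae_eq_integral => //; first exact: measurable_fubini_G ig.
by apply: filterS (ae_integrable2 ig) => y iy _; exact: g0.
Qed.

Lemma fubini_inner_eq0 d1 d2 (T1 : measurableType d1)
    (T2 : measurableType d2) (R : realType)
    (m1 : {sigma_finite_measure set T1 -> \bar R})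
    (m2 : {sigma_finite_measure set T2 -> \bar R}) (g : T1 * T2 -> \bar R) :
  (m1 \x m2)%E.-integrable setT g ->
  (forall x, \int[m2]_y g (x, y) = 0)%E ->
  (\int[m1 \x m2]_x g x = 0)%E.
Proof.
move=> ig g0; rewrite -(integral12_prod_meas1 ig).
by apply: integral0_eq => x _; exact: g0.
Qed.

(** The first two factors of [leb3], named so that they can carry the sigma-finite structure that
    Fubini needs against the third factor. *)
Definition leb2 (R : realType) :=
  (@lebesgue_measure R \x @lebesgue_measure R)%E.

HB.instance Definition _ (R : realType) := Measure.copy (@leb2 R)
  (@lebesgue_measure R \x @lebesgue_measure R)%E.

Lemma sigma_finite_leb2 (R : realType) : sigma_finite setT (@leb2 R).
Proof.
have /sigma_finiteP[G [TG ndG mG]] := @sigma_finiteT _ _ _ (@lebesgue_measure R).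
exists (fun n => G n `*` G n).
  apply/seteqP; split=> // -[x y] _.
  have : [set: R] x by []. rewrite TG => -[n _ Gx].
  have : [set: R] y by []. rewrite TG => -[k _ Gy].
  (* The exhausting sequence is nondecreasing, so both coordinates lie in a common member. *)
  exists (maxn n k) => //; split.
    by move: x Gx; exact/subsetPset/ndG/leq_maxl.
  by move: y Gy; exact/subsetPset/ndG/leq_maxr.
move=> k; have [mGk Gk] := mG k; split; first exact: measurableX.
rewrite [ltLHS](_ : _ = (lebesgue_measure (G k) * lebesgue_measure (G k))%E).
  by rewrite ltey_eq fin_numM// ge0_fin_numE.
exact: product_measure1E.
Qed.

HB.instance Definition _ (R : realType) :=
  Measure_isSigmaFinite.Build _ _ _ (@leb2 R) (@sigma_finite_leb2 R).

Lemma fubini3_eq0_1 (R : realType) (g : R * R * R -> \bar R) :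
  (@leb3 R).-integrable setT g ->
  (forall y z, \int[@lebesgue_measure R]_x g (x, y, z) = 0)%E ->
  (\int[@leb3 R]_x g x = 0)%E.
Proof.
move=> ig g0; apply: (@fubini_section_eq0 _ _ _ _ R (@leb2 R) (@lebesgue_measure R) g ig) => z iz.
by apply: (@fubini_section_eq0 _ _ _ _ R (@lebesgue_measure R) (@lebesgue_measure R) _ iz) => y _; exact: g0.
Qed.

Lemma fubini3_eq0_2 (R : realType) (g : R * R * R -> \bar R) :
  (@leb3 R).-integrable setT g ->
  (forall x z, \int[@lebesgue_measure R]_y g (x, y, z) = 0)%E ->
  (\int[@leb3 R]_x g x = 0)%E.
Proof.
move=> ig g0; apply: (@fubini_section_eq0 _ _ _ _ R (@leb2 R) (@lebesgue_measure R) g ig) => z iz.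
by apply: (@fubini_inner_eq0 _ _ _ _ R (@lebesgue_measure R) (@lebesgue_measure R) _ iz) => x; exact: g0.
Qed.

Lemma fubini3_eq0_3 (R : realType) (g : R * R * R -> \bar R) :
  (@leb3 R).-integrable setT g ->
  (forall x y, \int[@lebesgue_measure R]_z g (x, y, z) = 0)%E ->
  (\int[@leb3 R]_x g x = 0)%E.
Proof.
move=> ig g0; by apply: (@fubini_inner_eq0 _ _ _ _ R (@leb2 R) (@lebesgue_measure R) g ig) => -[x y]; exact: g0.
Qed.

Lemma continuous_line0 (R : realType) (y z : R) :
  continuous (fun t : R => (t, y, z)).
Proof.
move=> t; apply: (@cvg_pair _ _ _ (nbhs t) (nbhs (t, y)) (nbhs z)); last exact: cvg_cst.
by apply: (@cvg_pair _ _ _ (nbhs t) (nbhs t) (nbhs y)); [exact: cvg_id|exact: cvg_cst].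
Qed.

Lemma continuous_line1 (R : realType) (y z : R) :
  continuous (fun t : R => (y, t, z)).
Proof.
move=> t; apply: (@cvg_pair _ _ _ (nbhs t) (nbhs (y, t)) (nbhs z)); last exact: cvg_cst.
by apply: (@cvg_pair _ _ _ (nbhs t) (nbhs y) (nbhs t)); [exact: cvg_cst|exact: cvg_id].
Qed.

Lemma continuous_line2 (R : realType) (y z : R) :
  continuous (fun t : R => (y, z, t)).
Proof.
move=> t.
by apply: (@cvg_pair _ _ _ (nbhs t) (nbhs (y, z)) (nbhs t)); [exact: cvg_cst|exact: cvg_id].
Qed.

(** In each case the order of integration is chosen so that the integral along direction [i] is
    innermost and vanishes by the fundamental theorem of calculus. *)
Lemma integral_derive_eq0 (R : realType) (K : set (R * R * R))
    (f : R * R * R -> R) (i : 'I_3) :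
  compact K -> (forall x, ~ K x -> f x = 0) -> Cn 1 f ->
  (\int[@leb3 R]_x ('D_(unit3 R i) f x)%:E = 0)%E.
Proof.
move=> cK f0 f1.
have ig j : (@leb3 R).-integrable setT (fun x => ('D_(unit3 R j) f x)%:E).
  have [cf df] := f1; have [d1 [d2 _]] := df j.
  apply: (@compact_support_integrable _ setT K) => //.
  exact: derive_off_support.
move: i; apply/forall_I3; split.
- apply: (fubini3_eq0_1 (ig 0)) => y z.
  apply: (@integral_line_derive R K f 0 (fun t => (t, y, z))) => //.
    exact: continuous_line0.
  by move=> h t; exact: unit3_line0.
- apply: (fubini3_eq0_2 (ig 1)) => x z.
  apply: (@integral_line_derive R K f 1 (fun t => (x, t, z))) => //.
    exact: continuous_line1.
  by move=> h t; exact: unit3_line1.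
- apply: (fubini3_eq0_3 (ig 2%:R)) => x y.
  apply: (@integral_line_derive R K f 2%:R (fun t => (x, y, t))) => //.
    exact: continuous_line2.
  by move=> h t; exact: unit3_line2.
Qed.

(** * The classical curl of a test field is its weak curl *)

Lemma CnN (R : realType) n (f : R * R * R -> R) :
  Cn n f -> Cn n (fun x => - f x).
Proof.
elim: n f => [|n ih] f [cf df]; first by split=> // x; apply: continuousN; exact: cf.
split=> [x|i]; first by apply: continuousN; exact: cf.
have [d1 d2] := df i; split=> [x|]; first exact: derivableN.
rewrite (_ : (fun x => _) = (fun x => - 'D_(unit3 R i) f x)); first exact: ih.
by apply/funext => x; exact: deriveN.
Qed.

Lemma ccurlE (R : realType) (phi : field R) x :
  [/\ ccurl phi x 0 0 = 'D_(unit3 R 1) (fun y => phi y 2%:R 0) x -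
        'D_(unit3 R 2%:R) (fun y => phi y 1 0) x,
      ccurl phi x 1 0 = 'D_(unit3 R 2%:R) (fun y => phi y 0 0) x -
        'D_(unit3 R 0) (fun y => phi y 2%:R 0) x &
      ccurl phi x 2%:R 0 = 'D_(unit3 R 0) (fun y => phi y 1 0) x -
        'D_(unit3 R 1) (fun y => phi y 0 0) x].
Proof.
have e1 : 0 + 1 = 1 :> 'I_3 by exact/val_inj.
have e2 : 0 + 2%:R = 2%:R :> 'I_3 by exact/val_inj.
have e3 : 1 + 1 = 2%:R :> 'I_3 by exact/val_inj.
have e4 : 1 + 2%:R = 0 :> 'I_3 by exact/val_inj.
have e5 : 2%:R + 1 = 0 :> 'I_3 by exact/val_inj.
have e6 : 2%:R + 2%:R = 1 :> 'I_3 by exact/val_inj.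
by split; rewrite mxE ?e1 ?e2 ?e3 ?e4 ?e5 ?e6.
Qed.

Lemma test_field_comp (R : realType) (Om : set (R * R * R)) (phi : field R) :
  test_field Om phi -> exists K, [/\ compact K, K `<=` Om &
    forall i x, ~ K x -> phi x i 0 = 0].
Proof.
move=> [_ [K [cK KO K0]]]; exists K; split=> // i x nK.
by rewrite K0// mxE.
Qed.

Lemma L2_test (R : realType) (Om : set (R * R * R)) (phi : field R) :
  measurable Om -> test_field Om phi -> L2 Om phi.
Proof.
move=> mO tphi; have [K [cK KO K0]] := test_field_comp tphi.
apply/L2_sqint => i; apply: (compact_support_sqint mO cK); last exact: K0.
by have [] := tphi.1 0%N i.
Qed.

Lemma ccurl_comp (R : realType) (Om : set (R * R * R)) (phi : field R) :
  test_field Om phi -> exists K, [/\ compact K, K `<=` Om &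
    forall i, continuous (fun x => ccurl phi x i 0) /\
      forall x, ~ K x -> ccurl phi x i 0 = 0].
Proof.
move=> tphi; have [K [cK KO K0]] := test_field_comp tphi.
exists K; split=> // i; split; last first.
  move=> x nK; rewrite mxE.
  by rewrite !(@derive_off_support _ K)// ?subrr// => y; exact: K0.
have cD j k : Cn 0 (fun x => 'D_(unit3 R j) (fun y => phi y k 0) x).
  by have [_ /(_ j)[_ ]] := tphi.1 1%N k.
rewrite (_ : (fun x => _) = (fun x =>
    'D_(unit3 R (i + 1)) (fun y => phi y (i + 2%:R) 0) x -
    'D_(unit3 R (i + 2%:R)) (fun y => phi y (i + 1) 0) x)).
  exact: (CnD (cD _ _) (CnN (cD _ _))).1.
by apply/funext => x; rewrite mxE.
Qed.

Lemma L2_ccurl (R : realType) (Om : set (R * R * R)) (phi : field R) :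
  measurable Om -> test_field Om phi -> L2 Om (ccurl phi).
Proof.
move=> mO tphi; have [K [cK KO K0]] := ccurl_comp tphi.
apply/L2_sqint => i; have [h1 h2] := K0 i.
exact: (compact_support_sqint mO cK).
Qed.

(** [pij] and [sij] stand for the derivative along direction i of the j-th component of phi and psi.
    The three groups on the right are the derivatives of the components of psi x phi, expanded by
    the product rule. *)
Lemma curl_div_identity (R : comPzRingType) (p0 p1 p2 s0 s1 s2 : R)
    (p01 p02 p10 p12 p20 p21 s01 s02 s10 s12 s20 s21 : R) :
  p0 * (s12 - s21) + p1 * (s20 - s02) + p2 * (s01 - s10) -
    ((p12 - p21) * s0 + (p20 - p02) * s1 + (p01 - p10) * s2) =
  (p2 * s01 + s1 * p02 - (p1 * s02 + s2 * p01)) +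
  (p0 * s12 + s2 * p10 - (p2 * s10 + s0 * p12)) +
  (p1 * s20 + s0 * p21 - (p0 * s21 + s1 * p20)).
Proof. ring. Qed.

(* The integrand is the divergence of the cross product of the two fields. *)
Lemma is_curl_test (R : realType) (Om : set (R * R * R)) (phi : field R) :
  measurable Om -> test_field Om phi -> is_curl Om phi (ccurl phi).
Proof.
move=> mO tphi; split; first exact: L2_ccurl.
move=> psi tpsi.
have [K [cK KO K0]] := test_field_comp tphi.
have p2 := L2_test mO tphi; have s2 := L2_test mO tpsi.
have cp2 := L2_ccurl mO tphi; have cs2 := L2_ccurl mO tpsi.
apply/eqP; rewrite -subr_eq0; apply/eqP.
(* The components of psi x phi are [W 2 1], [W 0 2] and [W 1 0]. *)
pose W (i j : 'I_3) x := phi x i 0 * psi x j 0 + - (phi x j 0 * psi x i 0).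
have C1W i j : Cn 1 (W i j).
  apply: CnD; last apply: CnN.
    by apply: CnM; [exact: tphi.1|exact: tpsi.1].
  by apply: CnM; [exact: tphi.1|exact: tpsi.1].
have W0 i j x : ~ K x -> W i j x = 0 by move=> nK; rewrite /W !K0// !mul0r subrr.
have iDW i j k : (@leb3 R).-integrable setT (fun x => ('D_(unit3 R k) (W i j) x)%:E).
  have [cf df] := C1W i j; have [d1 [d2 _]] := df k.
  apply: (@compact_support_integrable _ setT K) => //.
  by apply: derive_off_support => // x; exact: W0.
have DW i j k x : 'D_(unit3 R k) (W i j) x =
    (phi x i 0 * 'D_(unit3 R k) (fun y => psi y j 0) x +
     psi x j 0 * 'D_(unit3 R k) (fun y => phi y i 0) x) -
    (phi x j 0 * 'D_(unit3 R k) (fun y => psi y i 0) x +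
     psi x i 0 * 'D_(unit3 R k) (fun y => phi y j 0) x).
  have dphi l : derivable (fun y => phi y l 0) x (unit3 R k).
    by have [_ /(_ k)[+ _]] := tphi.1 1%N l; exact.
  have dpsi l : derivable (fun y => psi y l 0) x (unit3 R k).
    by have [_ /(_ k)[+ _]] := tpsi.1 1%N l; exact.
  have e1 : derivable (fun y => phi y i 0 * psi y j 0) x (unit3 R k).
    exact: (derivableM (dphi i) (dpsi j)).
  have e2 : derivable (fun y => phi y j 0 * psi y i 0) x (unit3 R k).
    exact: (derivableM (dphi j) (dpsi i)).
  have := @deriveB _ _ _ _ _ _ _ e1 e2; rewrite /W => ->.
  by congr (_ - _); [exact: (deriveM (dphi i) (dpsi j))|exact: (deriveM (dphi j) (dpsi i))].
have key x : ((phi x)^T *m ccurl psi x) 0 0 - ((ccurl phi x)^T *m psi x) 0 0 =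
    'D_(unit3 R 0) (W 2%:R 1) x + 'D_(unit3 R 1) (W 0 2%:R) x +
    'D_(unit3 R 2%:R) (W 1 0) x.
  have [a0 a1 a2] := ccurlE phi x; have [b0 b1 b2] := ccurlE psi x.
  have sum3 (F : 'I_3 -> R) : \sum_(i < 3) F i = F 0 + F 1 + F 2%:R.
    rewrite !big_ord_recr big_ord0/= add0r.
    by congr (F _ + F _ + F _); exact/val_inj.
  rewrite !dotE !sum3 a0 a1 a2 b0 b1 b2 !DW.
  exact: curl_div_identity.
rewrite /ip -RintegralB//; [|exact: integrable_dot..].
(* The integral extends to the whole space because outside [Om], hence off the support, all the
   derivatives vanish. *)
transitivity (\int[@leb3 R]_x ('D_(unit3 R 0) (W 2%:R 1) x +
    'D_(unit3 R 1) (W 0 2%:R) x + 'D_(unit3 R 2%:R) (W 1 0) x)).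
  rewrite /Rintegral integral_mkcond; congr fine.
  apply: eq_integral => x _; rewrite /patch; case: ifPn => [_|/negP nO].
    by rewrite key.
  have nK : ~ K x by move=> /KO/mem_set.
  by rewrite !(@derive_off_support _ K)// ?addr0// => y; exact: W0.
have iD2 := @integrableD _ _ _ (@leb3 R) setT measurableT _ _
  (iDW 2%:R 1 0) (iDW 0 2%:R 1).
rewrite (@RintegralD _ _ _ (@leb3 R) setT _ _ measurableT iD2 (iDW 1 0 2%:R)).
rewrite (@RintegralD _ _ _ (@leb3 R) setT _ _ measurableT (iDW 2%:R 1 0) (iDW 0 2%:R 1)).
rewrite /Rintegral.
by rewrite !(@integral_derive_eq0 _ K) ?addr0// => x; exact: W0.
Qed.

Lemma test_field_coord (R : realType) (Om : set (R * R * R))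
    (psi : R * R * R -> R) (i : 'I_3) :
  scalar_test Om psi ->
  test_field Om (fun x => psi x *: delta_mx i 0 : 'cV[R]_3).
Proof.
move=> [Cpsi [K [cK KO K0]]]; split=> [n j|]; last first.
  by exists K; split=> // x nK; rewrite K0// scale0r.
rewrite (_ : (fun x => _) = (fun x => psi x * (j == i)%:R)); last first.
  by apply/funext => x; rewrite !mxE eqxx andbT.
case: (j == i); first by under eq_fun do rewrite mulr1; exact: Cpsi.
under eq_fun do rewrite mulr0.
elim: (n) => [|n' ih']; first by split=> // x; exact: cvg_cst.
split=> [x|i']; first exact: cvg_cst.
split=> [x|]; first exact: derivable_cst.
by rewrite (_ : (fun x => _) = fun=> 0)//; apply/funext => x; exact: derive_cst.
Qed.

(** * Uniqueness, linearity and integration by parts for the weak curl *)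

Lemma L2_test_orthogonal (R : realType) (Om : set (R * R * R)) (w : field R) :
  open Om -> L2 Om w -> (forall phi, test_field Om phi -> ip Om w phi = 0) ->
  aeq Om w 0.
Proof.
move=> oO w2 w0.
have h (i : 'I_3) : {ae @leb3 R, forall x, Om x -> w x i 0 = 0}.
  apply: (@ae_eq0_local _ Om _ oO); first by move/L2_sqint: w2; exact.
  move=> psi tpsi; rewrite -[RHS](w0 _ (test_field_coord i tpsi)).
  apply: eq_Rintegral => x _; rewrite dotE (bigD1 i)//= big1 ?addr0.
    by rewrite !mxE !eqxx mulr1.
  by move=> j ji; rewrite !mxE (negbTE ji) !mulr0.
move: (h 0) (h 1) (h 2%:R); apply: filterS3 => x h0 h1 h2 Ox.
apply/colP => i; rewrite mxE; move: i; apply/forall_I3.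
by split; [exact: h0|exact: h1|exact: h2].
Qed.

(** Membership in [Hcurl] provides the witness that keeps the choice in [curl] from falling back on
    its default 0. *)
Lemma curlP (R : realType) (Om : set (R * R * R)) (u : field R) :
  mem_fs (Hcurl Om) u -> is_curl Om u (curl Om u).
Proof.
by move=> [_ [w hw]]; apply: (xgetI 0 hw).
Qed.

#[local] Opaque ip curl.

(** The difference of two weak curls is orthogonal to all test fields. The algebra of the chosen
    [curl] up to [aeq] follows from this. *)
Lemma is_curl_unique (R : realType) (Om : set (R * R * R)) (u w w' : field R) :
  open Om -> is_curl Om u w -> is_curl Om u w' -> aeq Om w w'.
Proof.
move=> oO [w2 hw] [w2' hw']; have mO := open_measurable_R3 oO.
apply/aeq_subr0; apply: L2_test_orthogonal => //; first exact: L2B.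
move=> phi tphi; rewrite ipBl//; last exact: L2_test tphi.
by rewrite -hw// -hw'// subrr.
Qed.

Lemma is_curlD (R : realType) (Om : set (R * R * R)) (u u' w w' : field R) :
  measurable Om -> L2 Om u -> L2 Om u' -> is_curl Om u w -> is_curl Om u' w' ->
  is_curl Om (u + u') (w + w').
Proof.
move=> mO u2 u2' [w2 hw] [w2' hw']; split; first exact: L2D.
move=> phi tphi; have p2 := L2_test mO tphi; have c2 := L2_ccurl mO tphi.
by rewrite !ipDl// hw// hw'.
Qed.

Lemma is_curlZ (R : realType) (Om : set (R * R * R)) (c : R) (u w : field R) :
  measurable Om -> L2 Om u -> is_curl Om u w -> is_curl Om (c *: u) (c *: w).
Proof.
move=> mO u2 [w2 hw]; split; first exact: L2Z.
move=> phi tphi; have p2 := L2_test mO tphi; have c2 := L2_ccurl mO tphi.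
by rewrite !ipZl// hw.
Qed.

Lemma is_curl_aeq (R : realType) (Om : set (R * R * R)) (u u' w : field R) :
  measurable Om -> L2 Om u -> L2 Om u' -> aeq Om u u' -> is_curl Om u w ->
  is_curl Om u' w.
Proof.
move=> mO u2 u2' uu' [w2 hw]; split=> // phi tphi; rewrite -hw//.
have c2 := L2_ccurl mO tphi.
by apply: ip_aeq => //; [exact: aeq_sym|exact: aeqxx].
Qed.

Lemma Hcurl_L2 (R : realType) (Om : set (R * R * R)) (u : field R) :
  mem_fs (Hcurl Om) u -> L2 Om u.
Proof. by case. Qed.

Lemma curl_L2 (R : realType) (Om : set (R * R * R)) (u : field R) :
  mem_fs (Hcurl Om) u -> L2 Om (curl Om u).
Proof. by move=> /curlP[]. Qed.

Lemma Hcurl0_Hcurl (R : realType) (Om : set (R * R * R)) (u : field R) :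
  mem_fs (Hcurl0 Om) u -> mem_fs (Hcurl Om) u.
Proof. by case. Qed.

Lemma HcurlD (R : realType) (Om : set (R * R * R)) (u v : field R) :
  measurable Om -> mem_fs (Hcurl Om) u -> mem_fs (Hcurl Om) v ->
  mem_fs (Hcurl Om) (u + v).
Proof.
move=> mO [u2 [w hw]] [v2 [z hz]]; split; first exact: L2D.
by exists (w + z); exact: is_curlD.
Qed.

Lemma HcurlZ (R : realType) (Om : set (R * R * R)) (c : R) (u : field R) :
  measurable Om -> mem_fs (Hcurl Om) u -> mem_fs (Hcurl Om) (c *: u).
Proof.
move=> mO [u2 [w hw]]; split; first exact: L2Z.
by exists (c *: w); exact: is_curlZ.
Qed.

Lemma HcurlB (R : realType) (Om : set (R * R * R)) (u v : field R) :
  measurable Om -> mem_fs (Hcurl Om) u -> mem_fs (Hcurl Om) v ->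
  mem_fs (Hcurl Om) (u - v).
Proof. by move=> mO hu hv; rewrite -scaleN1r; apply: HcurlD => //; exact: HcurlZ. Qed.

Lemma Hcurl_aeq (R : realType) (Om : set (R * R * R)) (u v : field R) :
  measurable Om -> mem_fs (Hcurl Om) u -> L2 Om v -> aeq Om u v ->
  mem_fs (Hcurl Om) v.
Proof.
by move=> mO [u2 [w hw]] v2 uv; split=> //; exists w; exact: is_curl_aeq hw.
Qed.

Lemma Hcurl_test (R : realType) (Om : set (R * R * R)) (phi : field R) :
  measurable Om -> test_field Om phi -> mem_fs (Hcurl Om) phi.
Proof.
move=> mO tphi; split; first exact: L2_test tphi.
by exists (ccurl phi); exact: is_curl_test.
Qed.

Lemma curlD (R : realType) (Om : set (R * R * R)) (u v : field R) :
  open Om -> mem_fs (Hcurl Om) u -> mem_fs (Hcurl Om) v ->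
  aeq Om (curl Om (u + v)) (curl Om u + curl Om v).
Proof.
move=> oO hu hv; have mO := open_measurable_R3 oO.
apply: (is_curl_unique (u := u + v) oO); first exact/curlP/HcurlD.
exact: (is_curlD mO (Hcurl_L2 hu) (Hcurl_L2 hv) (curlP hu) (curlP hv)).
Qed.

Lemma curlZ (R : realType) (Om : set (R * R * R)) (c : R) (u : field R) :
  open Om -> mem_fs (Hcurl Om) u ->
  aeq Om (curl Om (c *: u)) (c *: curl Om u).
Proof.
move=> oO hu; have mO := open_measurable_R3 oO.
apply: (is_curl_unique (u := c *: u) oO); first exact/curlP/HcurlZ.
exact: (is_curlZ c mO (Hcurl_L2 hu) (curlP hu)).
Qed.

Lemma curlB (R : realType) (Om : set (R * R * R)) (u v : field R) :
  open Om -> mem_fs (Hcurl Om) u -> mem_fs (Hcurl Om) v ->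
  aeq Om (curl Om (u - v)) (curl Om u - curl Om v).
Proof.
move=> oO hu hv; have mO := open_measurable_R3 oO.
have hNv : mem_fs (Hcurl Om) (- v) by rewrite -scaleN1r; exact: HcurlZ.
apply: (aeq_trans (curlD oO hu hNv)); apply: aeqD; first exact: aeqxx.
by rewrite -[X in curl _ X]scaleN1r -[X in aeq _ _ X]scaleN1r; exact: curlZ.
Qed.

Lemma curl_aeq (R : realType) (Om : set (R * R * R)) (u v : field R) :
  open Om -> mem_fs (Hcurl Om) u -> mem_fs (Hcurl Om) v -> aeq Om u v ->
  aeq Om (curl Om u) (curl Om v).
Proof.
move=> oO hu hv uv; have mO := open_measurable_R3 oO.
apply: (is_curl_unique (u := v) oO); last exact: curlP.
by apply: (is_curl_aeq _ _ _ uv); [|exact: Hcurl_L2..|exact: curlP].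
Qed.

Lemma nrmL2_le_Hcurl (R : realType) (Om : set (R * R * R)) (u : field R) :
  nrm_fs (L2_space Om) u <= nrm_fs (Hcurl Om) u.
Proof. by apply: ler_wsqrtr; rewrite lerDl ip_ge0. Qed.

Lemma nrmL2_curl_le_Hcurl (R : realType) (Om : set (R * R * R)) (u : field R) :
  nrm_fs (L2_space Om) (curl Om u) <= nrm_fs (Hcurl Om) u.
Proof. by apply: ler_wsqrtr; rewrite lerDr ip_ge0. Qed.

(** For a test field this is the definition of the weak curl; both sides are continuous in the graph
    norm, in which test fields are dense in [Hcurl0]. No boundary term appears because the trace of
    [v] is encoded by this closure. *)
Lemma Hcurl0_parts (R : realType) (Om : set (R * R * R)) (u v : field R) :
  open Om -> mem_fs (Hcurl Om) u -> mem_fs (Hcurl0 Om) v ->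
  ip Om u (curl Om v) = ip Om (curl Om u) v.
Proof.
move=> oO hu [hv v0]; have mO := open_measurable_R3 oO.
have u2 := Hcurl_L2 hu; have cu2 := curl_L2 hu.
have v2 := Hcurl_L2 hv; have cv2 := curl_L2 hv.
have [Nu NuE] : exists N : R, nrm_fs (L2_space Om) u = N by eexists.
have [Nc NcE] : exists N : R, nrm_fs (L2_space Om) (curl Om u) = N by eexists.
have Nu0 : 0 <= Nu by rewrite -NuE; exact: nrmL2_ge0.
have Nc0 : 0 <= Nc by rewrite -NcE; exact: nrmL2_ge0.
have N0 : 0 < Nu + Nc + 1 by lra.
apply/eqP; rewrite -subr_eq0 -normr_le0; apply/ler_addgt0Pr => d d0.
rewrite add0r.
(* The approximation error is multiplied by at most Nu + Nc; the added 1 keeps the denominator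
   positive. *)
have [phi tphi hphi] := v0 (d / (Nu + Nc + 1)) (divr_gt0 d0 N0).
have hp := Hcurl_test mO tphi; have p2 := Hcurl_L2 hp; have cp2 := curl_L2 hp.
(* The definition involves the classical curl of [phi], which agrees almost everywhere with the
   chosen weak one. *)
have E : ip Om u (curl Om phi) = ip Om (curl Om u) phi.
  rewrite -(curlP hu).2//; apply: ip_aeq => //; [exact: L2_ccurl tphi|exact: aeqxx|].
  by apply: (is_curl_unique oO (curlP hp)); exact: is_curl_test.
have -> : ip Om u (curl Om v) - ip Om (curl Om u) v =
    ip Om u (curl Om (v - phi)) - ip Om (curl Om u) (v - phi).
  have -> : ip Om u (curl Om (v - phi)) = ip Om u (curl Om v - curl Om phi).
    exact: (ip_aeq mO u2 u2 (curl_L2 (HcurlB mO hv hp)) (L2B mO cv2 cp2)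
      (aeqxx _ _) (curlB oO hv hp)).
  rewrite (ipBr mO cv2 cp2 u2) (ipBr mO v2 p2 cu2) E; ring.
have h1 := ip_CS mO u2 (curl_L2 (HcurlB mO hv hp)).
have h2 := ip_CS mO cu2 (L2B mO v2 p2).
rewrite NuE in h1; rewrite NcE in h2.
have h3 := nrmL2_le_Hcurl Om (v - phi).
have h4 := nrmL2_curl_le_Hcurl Om (v - phi).
apply: (le_trans (ler_normB _ _)); apply: (le_trans (lerD h1 h2)).
apply: (@le_trans _ _ ((Nu + Nc + 1) * nrm_fs (Hcurl Om) (v - phi))).
  rewrite !mulrDl mul1r -[leLHS]addr0.
  apply: lerD; last by apply: le_trans h3; exact: nrmL2_ge0.
  by apply: lerD; apply: ler_wpM2l.
by rewrite -ler_pdivlMl// mulrC ltW.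
Qed.

(** * Strong differentiability in time *)

Lemma cvg0_le (R : realType) (F : set_system R) (f g : R -> R) :
  Filter F -> (\forall s \near F, 0 <= f s <= g s) -> g @ F --> (0 : R) ->
  f @ F --> (0 : R).
Proof. by move=> FF fg g0; apply: (squeeze_cvgr fg) => //; exact: cvg_cst. Qed.

Lemma cvg0_leD (R : realType) (F : set_system R) (f g k : R -> R) :
  Filter F -> g @ F --> (0 : R) -> k @ F --> (0 : R) ->
  (\forall s \near F, 0 <= f s <= g s + k s) -> f @ F --> (0 : R).
Proof.
move=> FF g0 k0 fgk; apply: (cvg0_le _ fgk).
by rewrite -[X in _ --> X]addr0; exact: cvgD.
Qed.

Lemma cvg0_leM (R : realType) (F : set_system R) (C : R) (f g : R -> R) :
  Filter F -> g @ F --> (0 : R) ->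
  (\forall s \near F, 0 <= f s <= C * g s) -> f @ F --> (0 : R).
Proof.
move=> FF g0 fg; apply: (cvg0_le _ fg).
by rewrite -[X in _ --> X](mulr0 C); apply: cvgM => //; exact: cvg_cst.
Qed.

Lemma cvg0_bilinear (R : realType) (F : set_system R) (f g : R -> R) (a b : R) :
  Filter F -> f @ F --> (0 : R) -> g @ F --> (0 : R) ->
  (fun s => f s * g s + a * g s + f s * b) @ F --> (0 : R).
Proof.
move=> FF f0 g0.
rewrite (_ : 0 = 0 * 0 + a * 0 + 0 * b :> R); last by rewrite !(mulr0, mul0r) !addr0.
apply: cvgD; first apply: cvgD.
- exact: cvgM.
- by apply: cvgM => //; exact: cvg_cst.
- by apply: cvgM => //; exact: cvg_cst.
Qed.

Lemma cvg_ip (R : realType) (Om : set (R * R * R)) (F : set_system R)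
    (u v : R -> field R) (u0 v0 : field R) :
  measurable Om -> Filter F -> (\forall s \near F, L2 Om (u s) /\ L2 Om (v s)) ->
  L2 Om u0 -> L2 Om v0 ->
  (fun s => nrm_fs (L2_space Om) (u s - u0)) @ F --> (0 : R) ->
  (fun s => nrm_fs (L2_space Om) (v s - v0)) @ F --> (0 : R) ->
  (fun s => ip Om (u s) (v s)) @ F --> ip Om u0 v0.
Proof.
move=> mO FF uv2 u2 v2 cu cv.
pose N w := nrm_fs (L2_space Om) w.
apply/subr_cvg0.
apply/norm_cvg0P.
apply: (@squeeze_cvgr _ _ _ _ (fun=> 0) (fun s =>
    N (u s - u0) * N (v s - v0) + N u0 * N (v s - v0) + N (u s - u0) * N v0)).
- near=> s; have [us vs] : L2 Om (u s) /\ L2 Om (v s) by near: s.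
  rewrite normr_ge0/=.
  have du := L2B mO us u2; have dv := L2B mO vs v2.
  have -> : ip Om (u s) (v s) - ip Om u0 v0 =
     ip Om (u s - u0) (v s - v0) + ip Om u0 (v s - v0) + ip Om (u s - u0) v0.
    rewrite (ipBr mO vs v2 du) (ipBr mO vs v2 u2) !ipBl//.
    by move: (ip Om (u s) (v s)) => *; ring.
  apply: (le_trans (ler_normD _ _)); apply: lerD; last exact: ip_CS.
  by apply: (le_trans (ler_normD _ _)); apply: lerD; exact: ip_CS.
- exact: cvg_cst.
- exact: (cvg0_bilinear (N u0) (N v0) _ cu cv).
Unshelve. all: by end_near. Qed.

Definition cL2 (R : realType) (Om : set (R * R * R)) (a b : R)
    (u : R -> field R) : Prop :=
  forall t, t \in `[a, b] -> L2 Om (u t) /\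
    (fun s => nrm_fs (L2_space Om) (u s - u t)) @ within `[a, b] (nbhs t) --> (0 : R).

(** Unlike in [Ck], the derivative is an argument rather than an existential witness, so that sums,
    products and pieces can be given explicit derivatives. *)
Definition c1L2 (R : realType) (Om : set (R * R * R)) (a b : R)
    (u w : R -> field R) : Prop :=
  [/\ cL2 Om a b u, cL2 Om a b w &
    forall t, t \in `[a, b] -> is_dt (L2_space Om) a b u t (w t)].

Lemma near_within_itv (R : realType) (a b t : R) (P : R -> Prop) :
  (forall s, s \in `[a, b] -> P s) -> \forall s \near within `[a, b] (nbhs t), P s.
Proof. by move=> h; apply: (filterS h); exact: withinT. Qed.

Lemma near_within_itv' (R : realType) (a b t : R) (P : R -> Prop) :
  (forall s, s \in `[a, b] -> P s) -> \forall s \near within `[a, b] t^', P s.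
Proof. by move=> h; apply: (filterS h); exact: withinT. Qed.

Lemma cL2_ip (R : realType) (Om : set (R * R * R)) (a b : R)
    (u v : R -> field R) :
  measurable Om -> cL2 Om a b u -> cL2 Om a b v ->
  {within `[a, b], continuous (fun s => ip Om (u s) (v s))}.
Proof.
move=> mO cu cv; apply/subspace_continuousP => t tab.
have [u2 cut] := cu t tab; have [v2 cvt] := cv t tab.
apply: (cvg_ip mO _ _ u2 v2 cut cvt); apply: near_within_itv => s sab.
by split; [case: (cu s sab)|case: (cv s sab)].
Qed.

Lemma subACA (V : zmodType) (a b a' b' : V) :
  a - b - (a' - b') = a - a' - (b - b').
Proof. by rewrite !opprB addrACA [RHS]addrACA [- b - a']addrC. Qed.

Lemma cL2B (R : realType) (Om : set (R * R * R)) (a b : R)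
    (u v : R -> field R) :
  measurable Om -> cL2 Om a b u -> cL2 Om a b v -> cL2 Om a b (fun t => u t - v t).
Proof.
move=> mO cu cv t tab; have [u2 cut] := cu t tab; have [v2 cvt] := cv t tab.
split; first exact: L2B.
apply: (cvg0_leD _ cut cvt).
apply: near_within_itv => s sab.
have [us2 _] := cu s sab; have [vs2 _] := cv s sab.
apply/andP; split; first exact: nrmL2_ge0.
rewrite subACA; apply: (le_trans (nrmL2D mO (L2B mO us2 u2) (L2N mO (L2B mO vs2 v2)))).
by rewrite nrmL2N//; exact: L2B.
Qed.

Lemma is_dtB (R : realType) (Om : set (R * R * R)) (a b t : R)
    (u v : R -> field R) (w z : field R) :
  measurable Om -> (forall s, s \in `[a, b] -> L2 Om (u s)) ->
  (forall s, s \in `[a, b] -> L2 Om (v s)) -> t \in `[a, b] ->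
  is_dt (L2_space Om) a b u t w -> is_dt (L2_space Om) a b v t z ->
  is_dt (L2_space Om) a b (fun t => u t - v t) t (w - z).
Proof.
move=> mO u2 v2 tab [w2 cw] [z2 cz]; split; first exact: L2B.
apply: (cvg0_leD _ cw cz).
apply: near_within_itv' => s sab.
have us := L2B mO (u2 s sab) (u2 t tab); have vs := L2B mO (v2 s sab) (v2 t tab).
have qu := L2B mO (L2Z (s - t)^-1 mO us) w2.
have qv := L2B mO (L2Z (s - t)^-1 mO vs) z2.
apply/andP; split; first exact: nrmL2_ge0.
rewrite (subACA (u s)) scalerBr subACA.
by apply: (le_trans (nrmL2D mO qu (L2N mO qv))); rewrite nrmL2N.
Qed.

Lemma c1L2B (R : realType) (Om : set (R * R * R)) (a b : R)
    (u v w z : R -> field R) :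
  measurable Om -> c1L2 Om a b u w -> c1L2 Om a b v z ->
  c1L2 Om a b (fun t => u t - v t) (fun t => w t - z t).
Proof.
move=> mO [cu cw du] [cv cz dv]; split; [exact: cL2B|exact: cL2B|].
move=> t tab; apply: is_dtB => //.
- by move=> s /cu[].
- by move=> s /cv[].
- exact: du.
- exact: dv.
Qed.

(** Each of the three components of A u has square at most 3 C^2 |u|^2; their sum is at most (3 C)^2
    |u|^2. *)
Lemma mact_bound (R : realType) (Om : set (R * R * R)) (A : mxfield R) :
  measurable Om -> spd_bounded Om A -> exists2 C : R, 0 <= C & forall u,
    L2 Om u -> nrm_fs (L2_space Om) (mact A u) <= C * nrm_fs (L2_space Om) u.
Proof.
move=> mO hA; have [_ _ _ [C AC]] := hA.
exists (3 * `|C|) => [|u u2]; first by rewrite mulr_ge0.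
have Au := measurable_mact mO hA u2.
rewrite !nrmL2E -[3 * `|C|]ger0_norm ?mulr_ge0// -sqrtr_sqr -sqrtrM ?sqr_ge0//.
apply: ler_wsqrtr; rewrite -ipZl//.
apply: (@le_Rintegral _ _ _ (@leb3 R)) => //.
- exact: integrable_dot.
- by apply: integrable_dot => //; exact: L2Z.
move=> x Ox; rewrite !dotE.
have sum3 (F : 'I_3 -> R) : \sum_(i < 3) F i = F 0 + F 1 + F 2%:R.
  rewrite !big_ord_recr big_ord0/= add0r.
  by congr (F _ + F _ + F _); exact/val_inj.
have h i : mact A u x i 0 * mact A u x i 0 <=
    3 * C ^+ 2 * (u x 0 0 ^+ 2 + u x 1 0 ^+ 2 + u x 2%:R 0 ^+ 2).
  rewrite /mact mxE sum3.
  have a2 j : A x i j ^+ 2 <= C ^+ 2.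
    have hC : 0 <= C by apply: le_trans (AC x Ox i j).
    by rewrite -[leLHS]real_normK ?num_real// lerXn2r ?nnegrE// AC.
  have := a2 0; have := a2 1; have := a2 2%:R.
  move: (A x i 0) (A x i 1) (A x i 2%:R) (u x 0 0) (u x 1 0) (u x 2%:R 0).
  move=> p q r a' b' c' hr hq hp.
  apply: (@le_trans _ _ (3 * ((p * a') ^+ 2 + (q * b') ^+ 2 + (r * c') ^+ 2))).
    have := sqr_ge0 (p * a' - q * b'); have := sqr_ge0 (p * a' - r * c').
    have := sqr_ge0 (q * b' - r * c'); move: (p * a') (q * b') (r * c') => *; nra.
  rewrite -mulrA ler_pM2l// !exprMn !mulrDr.
  by rewrite !lerD// ler_wpM2r ?sqr_ge0.
rewrite !sum3; apply: (le_trans (lerD (lerD (h 0) (h 1)) (h 2%:R))).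
rewrite !fctE !mxE exprMn real_normK ?num_real//.
by rewrite le_eqVlt; apply/orP; left; apply/eqP; ring.
Qed.

Lemma cL2_mact (R : realType) (Om : set (R * R * R)) (A : mxfield R) (a b : R)
    (u : R -> field R) :
  measurable Om -> spd_bounded Om A -> cL2 Om a b u ->
  cL2 Om a b (fun t => mact A (u t)).
Proof.
move=> mO hA cu t tab; have [u2 cut] := cu t tab.
have [C C0 hC] := mact_bound mO hA.
split; first exact: measurable_mact.
apply: (cvg0_leM (C := C) _ cut).
apply: near_within_itv => s sab; have [us2 _] := cu s sab.
apply/andP; split; first exact: nrmL2_ge0.
rewrite -mactB; apply: hC; exact: L2B.
Qed.

Lemma c1L2_mact (R : realType) (Om : set (R * R * R)) (A : mxfield R) (a b : R)
    (u w : R -> field R) :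
  measurable Om -> spd_bounded Om A -> c1L2 Om a b u w ->
  c1L2 Om a b (fun t => mact A (u t)) (fun t => mact A (w t)).
Proof.
move=> mO hA [cu cw du]; split; [exact: cL2_mact|exact: cL2_mact|].
move=> t tab; have [C C0 hC] := mact_bound mO hA.
have [w2 dut] := du t tab; have [u2 _] := cu t tab.
split; first exact: measurable_mact.
apply: (cvg0_leM (C := C) _ dut).
apply: near_within_itv' => s sab; have [us2 _] := cu s sab.
apply/andP; split; first exact: nrmL2_ge0.
rewrite -mactB -mactZ -mactB; apply: hC.
by apply: L2B => //; apply: L2Z => //; exact: L2B.
Qed.

Lemma cvg0_within_le (R : realType) (F : set_system R) (a b : R)
    (f g : R -> R) :
  Filter F -> g @ within `[a, b] F --> (0 : R) ->
  (forall s, s \in `[a, b] -> 0 <= f s <= g s) -> f @ within `[a, b] F --> (0 : R).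
Proof.
move=> FF g0 fg; have WF : Filter (within `[a, b] F) by exact: within_filter.
apply: (cvg0_le WF _ g0); exact: (@filterE _ F FF (fun s => s \in `[a, b] -> 0 <= f s <= g s) fg).
Qed.

Lemma cL2_Hcurl (R : realType) (Om : set (R * R * R)) (a b : R)
    (u : R -> field R) :
  open Om -> Ck (Hcurl Om) 0 a b u ->
  cL2 Om a b u /\ cL2 Om a b (fun t => curl Om (u t)).
Proof.
move=> oO [cu _]; have mO := open_measurable_R3 oO.
split=> t tab; have [hu cut] := cu t tab.
  split; first exact: Hcurl_L2.
  apply: (cvg0_within_le _ cut) => s sab.
  by apply/andP; split; [exact: nrmL2_ge0|exact: nrmL2_le_Hcurl].
split; first exact: curl_L2.
apply: (cvg0_within_le _ cut) => s sab; have [hs _] := cu s sab.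
apply/andP; split; first exact: nrmL2_ge0.
rewrite -(nrmL2_aeq mO (curl_L2 (HcurlB mO hs hu))
  (L2B mO (curl_L2 hs) (curl_L2 hu)) (curlB oO hs hu)).
exact: nrmL2_curl_le_Hcurl.
Qed.

(** The graph norm dominates both |u| and |curl u|, and [curl] commutes with difference quotients
    almost everywhere. *)
Lemma is_dt_Hcurl (R : realType) (Om : set (R * R * R)) (a b t : R)
    (u : R -> field R) (w : field R) :
  open Om -> (forall s, s \in `[a, b] -> mem_fs (Hcurl Om) (u s)) ->
  t \in `[a, b] -> is_dt (Hcurl Om) a b u t w ->
  is_dt (L2_space Om) a b u t w /\
  is_dt (L2_space Om) a b (fun t => curl Om (u t)) t (curl Om w).
Proof.
move=> oO hu tab [hw cw]; have mO := open_measurable_R3 oO; have ht := hu t tab.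
split; split; first exact: Hcurl_L2.
- apply: (cvg0_within_le _ cw) => s sab.
  by apply/andP; split; [exact: nrmL2_ge0|exact: nrmL2_le_Hcurl].
- exact: curl_L2.
apply: (cvg0_within_le _ cw) => s sab; have hs := hu s sab.
apply/andP; split; first exact: nrmL2_ge0.
have hst := HcurlB mO hs ht; have hq := HcurlZ (s - t)^-1 mO hst.
rewrite -(nrmL2_aeq mO (curl_L2 (HcurlB mO hq hw))
  (L2B mO (L2Z _ mO (L2B mO (curl_L2 hs) (curl_L2 ht))) (curl_L2 hw))).
  exact: nrmL2_curl_le_Hcurl.
apply: (aeq_trans (curlB oO hq hw)); apply: aeqB; last exact: aeqxx.
by apply: (aeq_trans (curlZ _ oO hst)); apply: aeqZ; exact: curlB.
Qed.

Lemma c1L2_Hcurl (R : realType) (Om : set (R * R * R)) (a b : R)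
    (u : R -> field R) :
  open Om -> Ck (Hcurl Om) 1 a b u -> exists w : R -> field R,
  [/\ forall t, t \in `[a, b] -> mem_fs (Hcurl Om) (u t) /\ mem_fs (Hcurl Om) (w t),
    c1L2 Om a b u w & c1L2 Om a b (fun t => curl Om (u t)) (fun t => curl Om (w t))].
Proof.
move=> oO [cu [w [dw cw]]]; exists w.
have [cu0 cu1] := cL2_Hcurl oO (conj cu I); have [cw0 cw1] := cL2_Hcurl oO cw.
have hu s : s \in `[a, b] -> mem_fs (Hcurl Om) (u s) by move=> /cu[].
split.
- by move=> t tab; split; [exact: hu|case: (dw t tab)].
- split; [exact: cu0|exact: cw0|] => t tab.
  by have [] := is_dt_Hcurl oO hu tab (dw t tab).
- split; [exact: cu1|exact: cw1|] => t tab.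
  by have [] := is_dt_Hcurl oO hu tab (dw t tab).
Qed.

(** * Uniqueness of strong derivatives, change of representative and of interval *)

Lemma within_itv_dnbhs_proper (R : realType) (a b t : R) :
  a < b -> t \in `[a, b] -> ProperFilter (within `[a, b] t^').
Proof.
move=> ab; rewrite in_itv/= => /andP[at_ tb].
apply: Build_ProperFilter_ex => P; rewrite /within/= /dnbhs/within/=.
move=> /nbhs_ballP[r /= r0 h].
(* A point to the right of t exists unless t is the right end, in which case one goes left; half of
   the minimum stays both in the ball and in the interval. *)
have [tb'|bt] := ltP t b.
  have d0 : 0 < Num.min r (b - t) by rewrite lt_min r0 subr_gt0.
  have d1 : Num.min r (b - t) <= r by rewrite ge_min lexx.
  have d2 : Num.min r (b - t) <= b - t by rewrite ge_min lexx orbT.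
  exists (t + Num.min r (b - t) / 2); apply: h => /=.
  - by rewrite /ball/= ltr_norml; apply/andP; split; lra.
  - by apply/eqP; lra.
  - by rewrite in_itv/=; apply/andP; split; lra.
have d0 : 0 < Num.min r (b - a) by rewrite lt_min r0 subr_gt0.
have d1 : Num.min r (b - a) <= r by rewrite ge_min lexx.
have d2 : Num.min r (b - a) <= b - a by rewrite ge_min lexx orbT.
exists (t - Num.min r (b - a) / 2); apply: h => /=.
- by rewrite /ball/= ltr_norml; apply/andP; split; lra.
- by apply/eqP; lra.
- by rewrite in_itv/=; apply/andP; split; lra.
Qed.

Lemma is_dt_unique (R : realType) (Om : set (R * R * R)) (a b t : R)
    (u : R -> field R) (w z : field R) :
  measurable Om -> a < b -> t \in `[a, b] ->
  (forall s, s \in `[a, b] -> L2 Om (u s)) ->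
  is_dt (L2_space Om) a b u t w -> is_dt (L2_space Om) a b u t z -> aeq Om w z.
Proof.
move=> mO ab tab u2 [w2 cw] [z2 cz]; have PF := within_itv_dnbhs_proper ab tab.
apply/aeq_subr0; apply: nrmL2_eq0 => //; first exact: L2B.
have h : (fun=> nrm_fs (L2_space Om) (w - z)) @ within `[a, b] t^' --> (0 : R).
  apply: (cvg0_leD _ cz cw); apply: near_within_itv' => s sab.
  have q2 := L2Z (s - t)^-1 mO (L2B mO (u2 s sab) (u2 t tab)).
  apply/andP; split; first exact: nrmL2_ge0.
  rewrite (_ : w - z = ((s - t)^-1 *: (u s - u t) - z) -
    ((s - t)^-1 *: (u s - u t) - w)); last by rewrite subACA subrr sub0r opprB.
  apply: (le_trans (nrmL2D mO (L2B mO q2 z2) (L2N mO (L2B mO q2 w2)))).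
  by rewrite nrmL2N//; exact: L2B.
exact: (cvg_unique _ (cvg_cst _) h).
Qed.

Lemma is_dt_aeq (R : realType) (Om : set (R * R * R)) (a b t : R)
    (u v : R -> field R) (w z : field R) :
  measurable Om -> (forall s, s \in `[a, b] -> [/\ L2 Om (u s), L2 Om (v s) &
    aeq Om (u s) (v s)]) -> t \in `[a, b] -> L2 Om z -> aeq Om w z ->
  is_dt (L2_space Om) a b u t w -> is_dt (L2_space Om) a b v t z.
Proof.
move=> mO uv tab z2 wz [w2 cw]; split; first exact: z2.
apply: (cvg0_within_le _ cw) => s sab.
have [us vs e] := uv s sab; have [ut vt e'] := uv t tab.
apply/andP; split; first exact: nrmL2_ge0.
rewrite (@nrmL2_aeq _ Om _ ((s - t)^-1 *: (u s - u t) - w))//.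
- by apply: L2B => //; apply: L2Z => //; exact: L2B.
- by apply: L2B => //; apply: L2Z => //; exact: L2B.
- apply: aeqB; last exact: aeq_sym.
  by apply: aeqZ; apply: aeqB; exact: aeq_sym.
Qed.

Lemma cL2_aeq (R : realType) (Om : set (R * R * R)) (a b : R)
    (u v : R -> field R) :
  measurable Om ->
  (forall s, s \in `[a, b] -> L2 Om (v s) /\ aeq Om (u s) (v s)) ->
  cL2 Om a b u -> cL2 Om a b v.
Proof.
move=> mO uv cu t tab; have [u2 cut] := cu t tab; have [v2 e] := uv t tab.
split; first exact: v2.
apply: (cvg0_within_le _ cut) => s sab.
have [us2 _] := cu s sab; have [vs2 e'] := uv s sab.
apply/andP; split; first exact: nrmL2_ge0.
rewrite (@nrmL2_aeq _ Om _ (u s - u t))//; [exact: L2B|exact: L2B|].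
by apply: aeqB; exact: aeq_sym.
Qed.

Lemma c1L2_aeq (R : realType) (Om : set (R * R * R)) (a b : R)
    (u v w z : R -> field R) :
  measurable Om ->
  (forall s, s \in `[a, b] -> L2 Om (v s) /\ aeq Om (u s) (v s)) ->
  (forall s, s \in `[a, b] -> L2 Om (z s) /\ aeq Om (w s) (z s)) ->
  c1L2 Om a b u w -> c1L2 Om a b v z.
Proof.
move=> mO uv wz [cu cw du]; split; [exact: (cL2_aeq mO uv)|exact: (cL2_aeq mO wz)|].
move=> t tab; have [z2 e] := wz t tab.
apply: (is_dt_aeq mO _ tab z2 e (du t tab)) => s sab.
by have [? ?] := uv s sab; split=> //; case: (cu s sab).
Qed.

(** Near an interior point the restriction to [a, b] is void, so the two-sided quotient converges.
    This links derivatives on a piece to [dt], which refers to the whole of [0, T]. *)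
Lemma is_dt_interior (R : realType) (V : lmodType R) (X : fspace V)
    (a b a' b' t : R) (u : R -> V) (w : V) :
  t \in `]a, b[ -> is_dt X a b u t w -> is_dt X a' b' u t w.
Proof.
move=> tab [hw cw]; split=> // P nP; have := cw P nP; rewrite /nbhs/= /within/=.
have h : \forall s \near t^', s \in `[a, b].
  apply: nbhs_dnbhs; near=> s; apply: subset_itv_oo_cc.
  by near: s; exact: near_in_itvoo.
by move: h; apply: filterS2 => s sab h' _; exact: h'.
Unshelve. all: by end_near. Qed.

(** Any existing derivative validates the choice made by [dt], and uniqueness identifies the two. *)
Lemma dt_is_dt (R : realType) (Om : set (R * R * R)) (T t : R)
    (u : R -> field R) (w : field R) :
  measurable Om -> 0 < T -> t \in `[0, T] ->
  (forall s, s \in `[0, T] -> L2 Om (u s)) ->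
  is_dt (L2_space Om) 0 T u t w ->
  is_dt (L2_space Om) 0 T u t (dt Om T u t) /\ aeq Om w (dt Om T u t).
Proof.
move=> mO T0 tT u2 dw.
have h : is_dt (L2_space Om) 0 T u t (dt Om T u t) := xgetI 0 dw.
by split=> //; exact: (is_dt_unique mO T0 tT u2 dw h).
Qed.

Lemma cvg_within_subset (R : realType) (F : set_system R) (A B : set R)
    (f : R -> R) (l : R) :
  Filter F -> B `<=` A -> f @ within A F --> l -> f @ within B F --> l.
Proof.
move=> FF BA fl; apply: cvg_trans fl; apply: cvg_app => P.
by apply: (@filterS _ F FF) => s h /BA; exact: h.
Qed.

Lemma subset_itvcc (R : realType) (a b a' b' : R) :
  a <= a' -> b' <= b -> `[a', b']%classic `<=` `[a, b]%classic.
Proof.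
move=> aa bb s /=; rewrite !in_itv/= => /andP[/(le_trans aa) -> h].
by rewrite (le_trans h).
Qed.

Lemma cL2_sub (R : realType) (Om : set (R * R * R)) (a b a' b' : R)
    (u : R -> field R) :
  a <= a' -> b' <= b -> cL2 Om a b u -> cL2 Om a' b' u.
Proof.
move=> aa bb cu t tab; have sub := subset_itvcc aa bb.
have [u2 cut] := cu t (sub t tab); split; first exact: u2.
exact: (cvg_within_subset _ sub cut).
Qed.

Lemma c1L2_sub (R : realType) (Om : set (R * R * R)) (a b a' b' : R)
    (u w : R -> field R) :
  a <= a' -> b' <= b -> c1L2 Om a b u w -> c1L2 Om a' b' u w.
Proof.
move=> aa bb [cu cw du]; have sub := subset_itvcc aa bb.
split; [exact: (cL2_sub aa bb cu)|exact: (cL2_sub aa bb cw)|].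
move=> t tab; have [w2 dut] := du t (sub t tab); split; first exact: w2.
exact: (cvg_within_subset _ sub dut).
Qed.

Lemma cvgD_near (R : realType) (F : set_system R) (f g k : R -> R) (l m : R) :
  Filter F -> f @ F --> l -> g @ F --> m ->
  (\forall s \near F, k s = f s + g s) -> k @ F --> l + m.
Proof.
move=> FF fl gm e; have h : (f + g) @ F --> l + m by exact: cvgD.
apply: cvg_trans h; apply: near_eq_cvg.
by move: e; apply: filterS => s ->.
Qed.

Lemma is_derive_dnbhs (R : realType) (f : R -> R) (t l : R) :
  (fun s => (s - t)^-1 * (f s - f t)) @ t^' --> l -> is_derive t (1 : R) f l.
Proof.
move=> h.
suff h' : (fun h : R => h^-1 *: (f (h *: (1 : R) + t) - f t)) @ 0^' --> l.
  by apply: DeriveDef; [apply/cvg_ex; exists l|exact: cvg_lim h'].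
apply/cvgrPdist_lt => e e0; move/cvgrPdist_lt: h => /(_ e e0).
rewrite /nbhs/= /dnbhs/within/= => /nbhs_ballP[r /= r0 hr].
apply/nbhs_ballP; exists r => //= x; rewrite /ball/= sub0r normrN => xr x0.
have := hr (x + t); rewrite /ball/= (_ : t - (x + t) = - x) ?normrN; last by ring.
move=> /(_ xr); rewrite addrK [x *: 1]mulr1; apply.
by rewrite -subr_eq0 addrK.
Qed.

Lemma nrmL2_0 (R : realType) (Om : set (R * R * R)) :
  measurable Om -> nrm_fs (L2_space Om) 0 = 0.
Proof.
by move=> mO; rewrite -(scale0r (0 : field R)) nrmL2Z ?normr0 ?mul0r//; exact: L20.
Qed.

(** The product rule: the increment splits as <u(s) - u(t), v(s)> + <u(t), v(s) - v(t)>, and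
    convergence in norm passes to scalar products. *)
Lemma cvg_ip_quotient (R : realType) (Om : set (R * R * R)) (a b t : R)
    (u v w z : R -> field R) :
  measurable Om -> c1L2 Om a b u w -> c1L2 Om a b v z -> t \in `[a, b] ->
  (fun s => (s - t)^-1 * (ip Om (u s) (v s) - ip Om (u t) (v t)))
    @ within `[a, b] t^' --> ip Om (w t) (v t) + ip Om (u t) (z t).
Proof.
move=> mO [cu cw du] [cv cz dv] tab.
have [u2 cut] := cu t tab; have [v2 cvt] := cv t tab.
have [w2 dut] := du t tab; have [z2 dvt] := dv t tab.
have sub (f : R -> R) : f @ within `[a, b] (nbhs t) --> (0 : R) ->
    f @ within `[a, b] t^' --> (0 : R).
  move=> h; apply: cvg_trans h; apply: cvg_app => P.
  exact: (@nbhs_dnbhs _ t).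
have h1 : (fun s => ip Om ((s - t)^-1 *: (u s - u t)) (v s))
    @ within `[a, b] t^' --> ip Om (w t) (v t).
  apply: (cvg_ip mO _ _ w2 v2 dut (sub _ cvt)).
  apply: near_within_itv' => s sab; have [us2 _] := cu s sab; have [vs2 _] := cv s sab.
  by split; [apply: L2Z => //; exact: L2B|exact: vs2].
have h2 : (fun s => ip Om (u t) ((s - t)^-1 *: (v s - v t)))
    @ within `[a, b] t^' --> ip Om (u t) (z t).
  apply: (cvg_ip mO _ _ u2 z2 _ dvt).
    apply: near_within_itv' => s sab; have [vs2 _] := cv s sab.
    by split; [exact: u2|apply: L2Z => //; exact: L2B].
  rewrite subrr nrmL2_0//; exact: cvg_cst.
apply: (cvgD_near _ h1 h2).
apply: near_within_itv' => s sab; have [us2 _] := cu s sab; have [vs2 _] := cv s sab.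
rewrite (ipZl _ mO (L2B mO us2 u2) vs2) (ipZr _ mO (L2B mO vs2 v2) u2).
rewrite (ipBl mO us2 u2 vs2) (ipBr mO vs2 v2 u2) -mulrDr.
by congr (_ * _); rewrite addrA subrK.
Qed.

Lemma c1L2_ip_FTC (R : realType) (Om : set (R * R * R)) (a b : R)
    (u v w z : R -> field R) :
  measurable Om -> a < b -> c1L2 Om a b u w -> c1L2 Om a b v z ->
  let g := fun s => ip Om (w s) (v s) + ip Om (u s) (z s) in
  {within `[a, b], continuous g} /\
  (\int[@lebesgue_measure R]_(s in `[a, b]) (g s)%:E =
    (ip Om (u b) (v b))%:E - (ip Om (u a) (v a))%:E)%E.
Proof.
move=> mO ab hu hv g; have [cu cw du] := hu; have [cv cz dv] := hv.
have cg : {within `[a, b], continuous g}.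
  by move=> x; apply: cvgD; exact: cL2_ip.
split=> //.
have cf := cL2_ip mO cu cv; have [_ cfa cfb] := (continuous_within_itvP _ ab).1 cf.
have df x : x \in `]a, b[ -> is_derive x (1 : R) (fun s => ip Om (u s) (v s)) (g x).
  move=> xab; have xab' := subset_itv_oo_cc xab.
  apply: is_derive_dnbhs; have := cvg_ip_quotient mO hu hv xab'.
  apply: cvg_trans; apply: cvg_app => P.
  have h : \forall s \near x^', s \in `[a, b].
    apply: nbhs_dnbhs; near=> s; apply: subset_itv_oo_cc.
    by near: s; exact: near_in_itvoo.
  by move: h; apply: filterS2 => s sab h'; exact: h'.
have LR : derivable_oo_LRcontinuous (fun s => ip Om (u s) (v s)) a b.
  by split; [move=> x xab; case: (df x xab)|exact: cfa|exact: cfb].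
have dE : {in `]a, b[, (fun s => ip Om (u s) (v s))^`()%classic =1 g}.
  by move=> x xab; rewrite derive1E; case: (df x xab).
exact: (continuous_FTC2 ab cg LR dE).
Unshelve. all: by end_near. Qed.

(** * A Gronwall inequality *)

(** The upper function of the Gronwall bound is not shown to be measurable. Integrals of nonnegative
    functions are suprema over simple functions below them, hence monotone in any case; positive and
    negative parts are compared separately. *)
Lemma nonmeasurable_le_integral {d} {T : measurableType d} {R : realType}
    (m : {measure set T -> \bar R}) (D : set T) (g f : T -> \bar R) :
  measurable D -> m.-integrable D g -> (forall x, D x -> g x <= f x)%E ->
  (\int[m]_(x in D) g x <= \int[m]_(x in D) f x)%E.
Proof.
move=> mD ig gf.
have ge0_mono (h k : T -> \bar R) : (forall x, D x -> 0 <= h x)%E ->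
    (forall x, D x -> h x <= k x)%E ->
    (\int[m]_(x in D) h x <= \int[m]_(x in D) k x)%E.
  move=> h0 hk; rewrite !ge0_integralE//; last first.
    by move=> x Dx; exact: le_trans (h0 x Dx) (hk x Dx).
  apply: le_ereal_sup => _ [s /= sh <-]; exists s => //= x.
  apply: (le_trans (sh x)); rewrite /patch; case: ifPn => // /set_mem Dx.
  exact: hk.
rewrite integralE [leRHS]integralE; apply: leeB.
  apply: ge0_mono => x Dx; first exact: funepos_ge0.
  by rewrite !funeposE ge_max !le_max gf// lexx orbT.
apply: ge0_mono => x Dx; first exact: funeneg_ge0.
by rewrite !funenegE ge_max !le_max leeN2 gf// lexx orbT.
Qed.

(* Halving the increment of G halves the bound, so D cannot vary. *)
Lemma quadratic_increment_const (R : realType) (G D : R -> R) (C a0 b0 : R) :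
  0 <= C -> {within `[a0, b0], continuous G} ->
  (forall a b, a0 <= a -> a <= b -> b <= b0 -> G a <= G b) ->
  (forall a b, a0 <= a -> a <= b -> b <= b0 ->
     `|D b - D a| <= C * (G b - G a) ^+ 2) ->
  a0 <= b0 -> D b0 = D a0.
Proof.
move=> C0 cG mG hD ab0.
have h k : forall a b, a0 <= a -> a <= b -> b <= b0 ->
    `|D b - D a| <= C * (G b - G a) ^+ 2 * 2^-1 ^+ k.
  elim: k => [|k ih] a b a0a ab bb0; first by rewrite expr0 mulr1; exact: hD.
  have cGab : {within `[a, b], continuous G}.
    by apply: continuous_subspaceW cG; exact: subset_itvcc.
  have Gab := mG a b a0a ab bb0.
  have [|c /[!in_itv]/= /andP[ac cb] Gc] :=
    @IVT _ G a b ((G a + G b) / 2) ab cGab.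
    by rewrite ge_min le_max; apply/andP; split; apply/orP; [left|right]; lra.
  have h1 := ih a c a0a ac (le_trans cb bb0).
  have h2 := ih c b (le_trans a0a ac) cb bb0.
  rewrite (_ : D b - D a = (D b - D c) + (D c - D a)); last by rewrite addrA subrK.
  apply: (le_trans (ler_normD _ _)); apply: (le_trans (lerD h2 h1)).
  (* Each half contributes a quarter of the squared increment, so together they gain the factor
     1/2. *)
  rewrite Gc [2^-1 ^+ k.+1]exprS; move: (2^-1 ^+ k) => q.
  by rewrite le_eqVlt; apply/orP; left; apply/eqP; field.
have : `|D b0 - D a0| <= 0.
  have lim0 : (fun k => C * (G b0 - G a0) ^+ 2 * 2^-1 ^+ k) @ \oo --> (0 : R).
    rewrite -[X in _ --> X](mulr0 (C * (G b0 - G a0) ^+ 2)).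
    apply: cvgM; first exact: cvg_cst.
    by apply: cvg_expr; rewrite ger0_norm//; lra.
  rewrite -(cvg_lim _ lim0)//; apply: limr_ge; first exact: cvgP lim0.
  by apply: nearW => k; exact: h.
by rewrite normr_le0 subr_eq0 => /eqP.
Qed.

(** * Primitives of integrable functions and exponential weights *)

Lemma integrable_bounded_mul (R : realType) (D : set R) (g h : R -> R) (C : R) :
  measurable D -> (@lebesgue_measure R).-integrable D (EFin \o g) ->
  measurable_fun D h -> (forall x, D x -> `|h x| <= C) ->
  (@lebesgue_measure R).-integrable D (fun x => (g x * h x)%:E).
Proof.
move=> mD ig mh hC.
have /integrableP[/measurable_EFinP mg _] := ig.
apply: (@le_integrable _ _ _ (@lebesgue_measure R) _ mD _ (fun x => C%:E * (g x)%:E)%E).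
- by apply/measurable_EFinP; exact: measurable_funM.
- move=> x Dx /=; rewrite lee_fin !normrM mulrC ler_wpM2r//.
  by rewrite (le_trans (hC x Dx))// ler_norm.
- exact: integrableZl.
Qed.

Lemma expRN_lipschitz (R : realType) (x y : R) : 0 <= x -> x <= y ->
  `|expR (- y) - expR (- x)| <= y - x.
Proof.
move=> x0 xy; rewrite distrC ger0_norm; last first.
  by rewrite subr_ge0 ler_expR lerN2.
have -> : expR (- y) = expR (- x) * expR (- (y - x)).
  by rewrite -expRD; congr expR; lra.
have h1 := expR_ge1Dx (- (y - x)).
have h2 : expR (- x) <= 1 by rewrite expR_le1 oppr_le0.
have h3 := expR_ge0 (- x).
rewrite -[X in X - _]mulr1 -mulrBr.
apply: (@le_trans _ _ (expR (- x) * (y - x))); first by apply: ler_wpM2l => //; lra.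
by rewrite ler_piMl// subr_ge0.
Qed.

(** From above, exp(-d) <= 1 / (1 + d) <= 1 - d + d^2; from below, exp(-d) >= 1 - d. *)
Lemma expRN_quadratic (R : realType) (d : R) : 0 <= d ->
  `|expR (- d) - 1 + d| <= d ^+ 2.
Proof.
move=> d0; have h1 := expR_ge1Dx (- d).
rewrite ger0_norm; last by lra.
have h2 := expR_ge1Dx d; have d1 : 0 < 1 + d by lra.
have h3 : expR (- d) <= (1 + d)^-1 by rewrite expRN lef_pV2// posrE// expR_gt0.
have h4 : (1 + d)^-1 <= 1 - d + d ^+ 2.
  rewrite -[leLHS]mul1r ler_pdivrMr//.
  have := mulr_ge0 d0 (sqr_ge0 d); nra.
lra.
Qed.

Lemma Rintegral_abs_le_const (R : realType) (D : set R) (g h : R -> R) (C : R) :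
  measurable D -> (@lebesgue_measure R).-integrable D (EFin \o g) ->
  (forall x, D x -> 0 <= g x) ->
  measurable_fun D h -> (forall x, D x -> `|h x| <= C) ->
  `|\int[@lebesgue_measure R]_(x in D) (g x * h x)| <=
    C * \int[@lebesgue_measure R]_(x in D) g x.
Proof.
move=> mD ig g0 mh hC.
have igh := integrable_bounded_mul mD ig mh hC.
apply: (@le_trans _ _ (\int[@lebesgue_measure R]_(x in D) `|g x * h x|)).
  exact: le_normr_Rintegral.
rewrite -RintegralZl//; apply: le_Rintegral => //.
- exact: (integrable_abse igh).
- exact: (@integrableZl _ _ _ (@lebesgue_measure R) _ mD C _ ig).
- move=> x Dx; rewrite normrM mulrC (ger0_norm (g0 x Dx)).
  by apply: ler_wpM2r; [exact: g0|exact: hC].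
Qed.

Lemma measurable_within_itv (R : realType) (a b : R) (f : R -> R) :
  {within `[a, b], continuous f} -> measurable_fun `[a, b] f.
Proof. by move=> cf; exact: (@subspace_continuous_measurable_fun R `[a, b] f). Qed.

(** The same integral as [Gam], under a name that is made opaque below to keep terms folded. *)
Definition primitive (R : realType) (g : R -> R) (s : R) : R :=
  \int[@lebesgue_measure R]_(r in `[0, s]) g r.

Lemma primitiveE (R : realType) (g : R -> R) (s : R) :
  primitive g s = \int[@lebesgue_measure R]_(r in `[0, s]) g r.
Proof. by []. Qed.

Lemma primitiveB (R : realType) (g : R -> R) (t a b : R) :
  (@lebesgue_measure R).-integrable `[0, t] (EFin \o g) ->
  0 <= a -> a <= b -> b <= t ->
  primitive g b - primitive g a = \int[@lebesgue_measure R]_(r in `]a, b]) g r.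
Proof.
move=> ig a0 ab bt; apply: Rintegral_itvB; [|by rewrite bnd_simp..].
apply: (@integrableS _ _ _ (@lebesgue_measure R) `[0, t]%classic) => //.
by apply: subset_itvl; rewrite bnd_simp.
Qed.

Lemma primitive_continuous (R : realType) (g : R -> R) (t : R) : 0 <= t ->
  (@lebesgue_measure R).-integrable `[0, t] (EFin \o g) ->
  {within `[0, t], continuous (primitive g)}.
Proof. by move=> t0 ig; exact: parameterized_integral_continuous. Qed.

Lemma primitive0 (R : realType) (g : R -> R) : primitive g 0 = 0.
Proof. by rewrite /primitive set_itv1 Rintegral_set1. Qed.

Lemma Gam_primitive (R : realType) (gamma : R -> R) (s : R) :
  Gam gamma s = primitive gamma s.
Proof. by []. Qed.

#[local] Opaque primitive.

Lemma mulB_split (R : comPzRingType) (e e' x y : R) :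
  e * x - e' * y = e * (x - y) + (e - e') * y.
Proof. ring. Qed.

Lemma quadratic_sum (R : comPzRingType) (M L d : R) :
  (M + (M + L) + L) * d ^+ 2 = M * d * d + (M + L) * d * d + L * d ^+ 2.
Proof. ring. Qed.

(** The increment of exp(-G) N - k over [a, b]: [e] is the exponential of minus the increment of G,
    so the last summand is its second-order Taylor remainder. *)
Lemma increment_split (R : comPzRingType) (ea eb na nb ga gb ka kb e : R) :
  eb = ea * e ->
  eb * nb - kb - (ea * na - ka) =
  eb * (nb - na) - (kb - ka) - ea * na * (gb - ga) +
  ea * na * (e - 1 + (gb - ga)).
Proof. by move=> ->; ring. Qed.

(** Each summand on the left contains a difference that is of first order in the increment of the
    primitive of gamma; integration against gamma raises this to second order. *)
Lemma integrand_split (R : comPzRingType) (g n ea eb es ns na : R) :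
  g * (n * (eb - es)) + g * (es * ns - ea * na) =
  eb * (g * n) - g * (es * (n - ns)) - ea * na * g.
Proof. ring. Qed.

Lemma Rintegral_combination {d} {T : measurableType d} {R : realType}
    (m : {measure set T -> \bar R}) (D : set T) (f1 f2 g1 g2 g3 : T -> R) (c1 c3 : R) :
  let int f := m.-integrable D (EFin \o f) in
  measurable D -> int f1 -> int f2 -> int g1 -> int g2 -> int g3 ->
  (forall x, f1 x + f2 x = c1 * g1 x - g2 x - c3 * g3 x) ->
  let I f := \int[m]_(x in D) f x in
  I f1 + I f2 = c1 * I g1 - I g2 - c3 * I g3.
Proof.
move=> int mD if1 if2 ig1 ig2 ig3 e I.
have icg (c : R) g : int g -> int (fun x => c * g x).
  by move=> ig; exact: (@integrableZl _ _ _ m _ mD c _ ig).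
have i12 : int (fun x => c1 * g1 x - g2 x).
  exact: (@integrableB _ _ _ m _ mD _ _ (icg c1 _ ig1) ig2).
rewrite /I -(RintegralD mD if1 if2) -(RintegralZl c1 mD ig1) -(RintegralZl c3 mD ig3).
rewrite -(RintegralB mD (icg c1 _ ig1) ig2) -(RintegralB mD i12 (icg c3 _ ig3)).
by apply: eq_Rintegral => x _; exact: e.
Qed.

(** Formally both sides have derivative gamma exp(-Gm) (n - N). The difference [D] is instead shown
    to have increments quadratic in those of Gm, which is continuous and nondecreasing. *)
Lemma exp_primitive_identity (R : realType) (t M : R) (gamma n : R -> R) :
  0 <= t ->
  (@lebesgue_measure R).-integrable `[0, t] (EFin \o gamma) ->
  (forall s, s \in `[0, t] -> 0 <= gamma s) ->
  measurable_fun `[0, t] n -> (forall s, s \in `[0, t] -> `|n s| <= M) ->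
  let Gm := primitive gamma in let N := primitive (fun s => gamma s * n s) in
  expR (- Gm t) * N t =
  primitive (fun s => gamma s * (expR (- Gm s) * (n s - N s))) t.
Proof.
move=> t0 ig g0 mn nM Gm N.
have M0 : 0 <= M by apply: le_trans (nM 0 _) => //; rewrite in_itv/= lexx.
have mI : measurable `[0, t] by [].
have ign := integrable_bounded_mul mI ig mn nM.
have cG : {within `[0, t], continuous Gm} by exact: primitive_continuous.
have cN : {within `[0, t], continuous N} by exact: primitive_continuous.
have sub a b : 0 <= a -> b <= t -> `]a, b]%classic `<=` `[0, t]%classic.
  move=> a0 bt s /=; rewrite !in_itv/= => /andP[/ltW/(le_trans a0) -> sb].
  exact: le_trans bt.
have subi a b g : 0 <= a -> b <= t ->
    (@lebesgue_measure R).-integrable `[0, t] g ->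
    (@lebesgue_measure R).-integrable `]a, b] g.
  by move=> a0 bt; apply: integrableS => //; exact: sub.
have mG : forall a b, 0 <= a -> a <= b -> b <= t -> Gm a <= Gm b.
  move=> a b a0 ab bt; rewrite -subr_ge0 (primitiveB ig)//.
  by apply: Rintegral_ge0 => s /(sub _ _ a0 bt); exact: g0.
have G0 s : 0 <= s -> s <= t -> 0 <= Gm s.
  by move=> s0 st; rewrite -(primitive0 gamma); exact: mG.
have dN a b : 0 <= a -> a <= b -> b <= t -> `|N b - N a| <= M * (Gm b - Gm a).
  move=> a0 ab bt; rewrite (primitiveB ign)// (primitiveB ig)//.
  apply: Rintegral_abs_le_const => //.
  - exact: subi.
  - by move=> s /(sub _ _ a0 bt); exact: g0.
  - by apply: measurable_funS mn => //; exact: sub.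
  - by move=> s /(sub _ _ a0 bt); exact: nM.
pose L := M * Gm t.
have L0 : 0 <= L by rewrite mulr_ge0// G0.
have NL s : 0 <= s -> s <= t -> `|N s| <= L.
  move=> s0 st; have := dN 0 s (lexx _) s0 st.
  rewrite /N /Gm !primitive0 !subr0 => h; apply: (le_trans h).
  by apply: ler_wpM2l => //; exact: mG.
pose k s := expR (- Gm s) * (n s - N s).
have mE : measurable_fun `[0, t] (fun s => expR (- Gm s)).
  apply: (@measurableT_comp _ _ _ _ _ _ (@expR R)) => //.
  by apply: measurable_funN; exact: measurable_within_itv.
have mN := measurable_within_itv cN.
have mk : measurable_fun `[0, t] k.
  by apply: measurable_funM => //; exact: measurable_funB.
have E1 s : s \in `[0, t] -> `|expR (- Gm s)| <= 1.
  rewrite in_itv/= => /andP[s0 st].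
  by rewrite ger0_norm ?expR_ge0// expR_le1 oppr_le0 G0.
have kM s : s \in `[0, t] -> `|k s| <= M + L.
  move=> st; rewrite /k normrM -[leRHS]mul1r.
  apply: ler_pM => //; first exact: E1.
  apply: (le_trans (ler_normB _ _)); apply: lerD; first exact: nM.
  by move: st; rewrite in_itv/= => /andP[s0 st]; exact: NL.
have igk := integrable_bounded_mul mI ig mk kM.
pose D s := expR (- Gm s) * N s - primitive (fun s => gamma s * k s) s.
have N00 : N 0 = 0 by exact: primitive0.
have D0 : D 0 = 0.
  by rewrite /D N00 mulr0 sub0r (primitive0 (fun s => gamma s * k s)) oppr0.
suff : D t = D 0 by rewrite D0 => /eqP; rewrite subr_eq0 => /eqP.
(* The three parts bound the integral of gamma h1, that of gamma h2, and the Taylor remainder of the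
   exponential. *)
apply: (@quadratic_increment_const R Gm D (M + (M + L) + L) 0 t) => //.
  by rewrite !addr_ge0.
move=> a b a0 ab bt; have at_ := le_trans ab bt; have b0 := le_trans a0 ab.
have dG : 0 <= Gm b - Gm a by rewrite subr_ge0 mG.
pose I (h : R -> R) := \int[@lebesgue_measure R]_(r in `]a, b]) (gamma r * h r).
have mIab : measurable `]a, b] by [].
have igab := subi a b _ a0 bt ig.
have g0ab s : `]a, b]%classic s -> 0 <= gamma s by move=> /(sub _ _ a0 bt); exact: g0.
have inab s : `]a, b]%classic s -> [/\ 0 <= s, s <= t, a <= s & s <= b].
  by rewrite /= in_itv/= => /andP[/ltW h1 h2]; split=> //; [exact: le_trans h1|exact: le_trans bt].
pose h1 s := n s * (expR (- Gm b) - expR (- Gm s)).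
pose h2 s := expR (- Gm s) * N s - expR (- Gm a) * N a.
have ms (f : R -> R) : measurable_fun `[0, t] f -> measurable_fun `]a, b] f.
  by move=> mf; apply: measurable_funS mf => //; exact: sub.
have m1 : measurable_fun `]a, b] h1.
  apply: measurable_funM; first exact: ms.
  by apply: measurable_funB; [exact: measurable_cst|exact: ms].
have m2 : measurable_fun `]a, b] h2.
  by apply: measurable_funB; [apply: measurable_funM; exact: ms|exact: measurable_cst].
have b1 s : `]a, b]%classic s -> `|h1 s| <= M * (Gm b - Gm a).
  move=> /[dup] /inab[s0 st as_ sb] /(sub _ _ a0 bt) sI.
  rewrite normrM; apply: ler_pM => //; first exact: nM.
  apply: (le_trans (expRN_lipschitz (G0 s s0 st) (mG s b s0 sb bt))).
  by rewrite lerD2l lerN2 mG.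
have b2 s : `]a, b]%classic s -> `|h2 s| <= (M + L) * (Gm b - Gm a).
  move=> /[dup] /inab[s0 st as_ sb] /(sub _ _ a0 bt) sI.
  have -> : h2 s = expR (- Gm s) * (N s - N a) +
     (expR (- Gm s) - expR (- Gm a)) * N a by exact: mulB_split.
  have dGs : Gm s - Gm a <= Gm b - Gm a by rewrite lerD2r mG.
  apply: (le_trans (ler_normD _ _)); rewrite [leRHS]mulrDl; apply: lerD.
    rewrite normrM -[leRHS]mul1r; apply: ler_pM => //; first exact: E1.
    apply: (le_trans (dN a s a0 as_ st)); exact: ler_wpM2l.
  rewrite normrM mulrC; apply: ler_pM => //; first exact: NL.
  exact: le_trans (expRN_lipschitz (G0 a a0 at_) (mG a s a0 as_ st)) dGs.
have ih1 := integrable_bounded_mul mIab igab m1 b1.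
have ih2 := integrable_bounded_mul mIab igab m2 b2.
have ignab := subi a b _ a0 bt ign.
have igkab := subi a b _ a0 bt igk.
have key : D b - D a = I h1 + I h2 +
    expR (- Gm a) * N a * (expR (- (Gm b - Gm a)) - 1 + (Gm b - Gm a)).
  have eN := primitiveB ign a0 ab bt.
  have eG := primitiveB ig a0 ab bt.
  have ek := primitiveB igk a0 ab bt.
  have e12 : I h1 + I h2 = expR (- Gm b) * (N b - N a) -
      (primitive (fun s => gamma s * k s) b - primitive (fun s => gamma s * k s) a)
      - expR (- Gm a) * N a * (Gm b - Gm a).
    rewrite [N b - N a]eN [Gm b - Gm a]eG ek.
    exact: (@Rintegral_combination _ _ R (@lebesgue_measure R) `]a, b]%classic
      (fun s => gamma s * h1 s) (fun s => gamma s * h2 s)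
      (fun s => gamma s * n s) (fun s => gamma s * k s) gamma
      (expR (- Gm b)) (expR (- Gm a) * N a) mIab ih1 ih2 ignab igkab igab
      (fun s => integrand_split _ _ _ _ _ _ _)).
  have eE : expR (- Gm b) = expR (- Gm a) * expR (- (Gm b - Gm a)).
    by rewrite -expRD; congr expR; ring.
  by rewrite e12; exact: increment_split eE.
have B1 : `|I h1| <= M * (Gm b - Gm a) * (Gm b - Gm a).
  by rewrite {2}(primitiveB ig)//; exact: Rintegral_abs_le_const.
have B2 : `|I h2| <= (M + L) * (Gm b - Gm a) * (Gm b - Gm a).
  by rewrite {2}(primitiveB ig)//; exact: Rintegral_abs_le_const.
have B3 : `|expR (- Gm a) * N a * (expR (- (Gm b - Gm a)) - 1 + (Gm b - Gm a))|
    <= L * (Gm b - Gm a) ^+ 2.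
  rewrite normrM; apply: ler_pM => //; last exact: expRN_quadratic.
  rewrite normrM -[leRHS]mul1r; apply: ler_pM => //; last exact: NL.
  by apply: E1; rewrite in_itv/= a0 at_.
rewrite key quadratic_sum; apply: (le_trans (ler_normD _ _)); apply: lerD => //.
by apply: (le_trans (ler_normD _ _)); apply: lerD.
Qed.

(** With N the primitive of gamma n, the assumption reads n - N <= f. Integrated against gamma
    exp(-Gm) it bounds exp(-Gm t) N(t) by the preceding identity; multiply by exp(Gm t) and insert
    in n <= f + N. *)
Lemma gronwall_bound (R : realType) (t M : R) (gamma n : R -> R)
    (f : R -> \bar R) :
  0 <= t ->
  (@lebesgue_measure R).-integrable `[0, t] (EFin \o gamma) ->
  (forall s, s \in `[0, t] -> 0 <= gamma s) ->
  measurable_fun `[0, t] n -> (forall s, s \in `[0, t] -> `|n s| <= M) ->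
  (forall s, s \in `[0, t] ->
    ((n s)%:E <= f s + (primitive (fun s => gamma s * n s) s)%:E)%E) ->
  ((n t)%:E <= bound gamma f t)%E.
Proof.
move=> t0 ig g0 mn nM nf.
set Gm := primitive gamma; set N := primitive (fun s => gamma s * n s).
have mI : measurable `[0, t] by [].
have ign := integrable_bounded_mul mI ig mn nM.
have cG : {within `[0, t], continuous Gm} by exact: primitive_continuous.
have cN : {within `[0, t], continuous N} by exact: primitive_continuous.
pose k s := expR (- Gm s) * (n s - N s).
have mE : measurable_fun `[0, t] (fun s => expR (- Gm s)).
  apply: (@measurableT_comp _ _ _ _ _ _ (@expR R)) => //.
  by apply: measurable_funN; exact: measurable_within_itv.
have mN := measurable_within_itv cN.
have mk : measurable_fun `[0, t] k.
  by apply: measurable_funM => //; exact: measurable_funB.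
(* Boundedness makes gamma k integrable; the continuous factors are bounded by compactness of the
   interval. *)
have [C kC] : exists C, forall s, s \in `[0, t] -> `|k s| <= C.
  have : compact ((fun s => expR (- Gm s) : R) @` `[0, t]).
    apply: continuous_compact; last exact: segment_compact.
    move=> x; apply: continuous_comp; first exact: (continuousN (cG x)).
    exact: continuous_expR.
  move=> /compact_bounded[M1 [_ h1]].
  have : compact (N @` `[0, t]).
    by apply: continuous_compact => //; exact: segment_compact.
  move=> /compact_bounded[M2 [_ h2]].
  exists ((M1 + 1) * (M + (M2 + 1))) => s st.
  rewrite normrM; apply: ler_pM => //.
    by apply: h1; [rewrite ltrDl|exists s].
  apply: (le_trans (ler_normB _ _)); apply: lerD; first exact: nM.
  by apply: h2; [rewrite ltrDl|exists s].
have igk := integrable_bounded_mul mI ig mk kC.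
have le1 : ((primitive (fun s => gamma s * k s) t)%:E <=
   \int[@lebesgue_measure R]_(s in `[0%R, t]) ((expR (- Gam gamma s) * gamma s)%:E * f s))%E.
  rewrite primitiveE /Rintegral fineK; last exact: integrable_fin_num.
  apply: nonmeasurable_le_integral => // s st.
  have -> : (gamma s * k s)%:E = ((expR (- Gam gamma s) * gamma s)%:E * (n s - N s)%:E)%E.
    by rewrite -EFinM; congr EFin; rewrite /k Gam_primitive mulrA [gamma s * _]mulrC.
  apply: lee_wpmul2l; first by rewrite lee_fin mulr_ge0 ?expR_ge0// g0.
  by rewrite EFinB leeBlDr//; exact: nf.
have tt : t \in `[0, t] by rewrite in_itv/= t0 lexx.
have id1 := exp_primitive_identity t0 ig g0 mn nM.
rewrite /bound; apply: (le_trans (nf t tt)); rewrite addeC; apply: leeD => //.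
apply: (@le_trans _ _ ((expR (Gam gamma t))%:E * (primitive (fun s => gamma s * k s) t)%:E)%E).
  rewrite -EFinM lee_fin /k -id1 mulrA -expRD.
  by rewrite Gam_primitive subrr expR0 mul1r.
by apply: lee_wpmul2l => //; rewrite lee_fin expR_ge0.
Qed.

(** * The energy identity *)

Lemma partition_additive (R : realType) (Q : R -> R -> Prop) (m : nat)
    (tau : nat -> R) :
  (forall a, Q a a) ->
  (forall a b c, a <= b -> b <= c -> Q a b -> Q b c -> Q a c) ->
  (forall i, (i < m)%N -> forall a b, tau i <= a -> a <= b -> b <= tau i.+1 ->
    Q a b) ->
  forall a b, tau 0%N <= a -> a <= b -> b <= tau m -> Q a b.
Proof.
move=> Q0 QD; elim: m => [|m IH] hQ a b a0 ab bm.
  suff -> : a = b by exact: Q0.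
  by apply/eqP; rewrite eq_le ab (le_trans bm).
have IHm : forall a b, tau 0%N <= a -> a <= b -> b <= tau m -> Q a b.
  by apply: IH => i im; apply: hQ; exact: ltnW.
have [bm'|/ltW bm'] := leP b (tau m); first exact: IHm.
have [am|/ltW am] := leP (tau m) a; first exact: (hQ m).
by apply: (QD _ (tau m)) => //; [exact: IHm|exact: (hQ m)].
Qed.

Definition c1_piece (R : realType) (Om : set (R * R * R)) (u : R -> field R)
    (a b : R) : Prop :=
  exists w : R -> field R,
  [/\ forall t, t \in `[a, b] -> mem_fs (Hcurl Om) (u t) /\ mem_fs (Hcurl Om) (w t),
    c1L2 Om a b u w & c1L2 Om a b (fun t => curl Om (u t)) (fun t => curl Om (w t))].

Lemma c1_piece_sub (R : realType) (Om : set (R * R * R)) (u : R -> field R)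
    (a b a' b' : R) :
  a <= a' -> b' <= b -> c1_piece Om u a b -> c1_piece Om u a' b'.
Proof.
move=> aa bb [w [hw cu cc]]; exists w; split.
- by move=> t tab; apply: hw; exact: (subset_itvcc aa bb).
- exact: (c1L2_sub aa bb cu).
- exact: (c1L2_sub aa bb cc).
Qed.

(** Reduces an additive property of intervals to those on which [u] is C^1. Used once per
    approximation, it spares a common refinement of their partitions. *)
Lemma C1p_additive (R : realType) (Om : set (R * R * R)) (T : R)
    (u : R -> field R) (Q : R -> R -> Prop) :
  open Om -> C1p (Hcurl Om) T u -> (forall a, Q a a) ->
  (forall a b c, a <= b -> b <= c -> Q a b -> Q b c -> Q a c) ->
  (forall a b, 0 <= a -> a <= b -> b <= T -> c1_piece Om u a b -> Q a b) ->
  forall a b, 0 <= a -> a <= b -> b <= T -> Q a b.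
Proof.
move=> oO [_ [m [tau [t0 tm ht]]]] Q0 QD hQ a b a0 ab bT.
suff h : 0 <= a -> b <= T -> Q a b by exact: h.
apply: (@partition_additive _ (fun a b => 0 <= a -> b <= T -> Q a b) m tau) => //.
- move=> x y z xy yz Qxy Qyz x0 zT; apply: (QD _ y) => //.
    by apply: Qxy => //; exact: le_trans zT.
  by apply: Qyz => //; exact: le_trans xy.
- move=> i im x y ix xy yi x0 yT; apply: hQ => //.
  have [_ /(c1L2_Hcurl oO)] := ht i im; exact: c1_piece_sub.
- by rewrite t0.
- by rewrite tm.
Qed.

(** Weaker than continuity, so that it survives gluing of pieces and changes at end points, yet
    sufficient for integrability. *)
Definition bounded_measurable (R : realType) (k : R -> R) (a b : R) : Prop :=
  measurable_fun `[a, b] k /\ exists C : R, forall s, s \in `[a, b] -> `|k s| <= C.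

Lemma bounded_measurable_integrable (R : realType) (k : R -> R) (a b : R) :
  bounded_measurable k a b ->
  (@lebesgue_measure R).-integrable `[a, b] (EFin \o k).
Proof.
move=> [mk [C hC]]; apply: measurable_bounded_integrable => //.
  apply: (@compact_finite_measure R); exact: segment_compact.
by exists C; split; [exact: num_real|move=> M CM s /= /hC /le_trans->//; exact: ltW].
Qed.

Lemma bounded_measurable_pt (R : realType) (k : R -> R) (a : R) :
  bounded_measurable k a a.
Proof.
split; first by rewrite set_itv1; exact: measurable_fun_set1.
exists `|k a| => s; rewrite in_itv/= => /andP[? ?].
by have -> : s = a by apply/eqP; rewrite eq_le; apply/andP; split.
Qed.

Lemma itvcc_split (R : realType) (a b c : R) : a <= b -> b <= c ->
  `[a, c]%classic = `[a, b]%classic `|` `[b, c]%classic.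
Proof.
move=> ab bc; apply/seteqP; split=> s /=; rewrite !in_itv/=.
  by move=> /andP[as_ sc]; have [sb|/ltW sb] := leP s b; [left|right]; apply/andP.
by move=> [|] /andP[x y]; apply/andP; split=> //; [exact: le_trans bc|exact: le_trans x].
Qed.

Lemma bounded_measurableU (R : realType) (k : R -> R) (a b c : R) :
  a <= b -> b <= c -> bounded_measurable k a b -> bounded_measurable k b c ->
  bounded_measurable k a c.
Proof.
move=> ab bc [m1 [C1 h1]] [m2 [C2 h2]]; split.
  by rewrite (itvcc_split ab bc); apply/measurable_funU.
exists (Num.max C1 C2) => s sac; rewrite le_max.
have : (`[a, c]%classic : set R) s by [].
by rewrite (itvcc_split ab bc) => -[/h1|/h2] ->; rewrite ?orbT.
Qed.

Lemma bounded_measurable_continuous (R : realType) (g : R -> R) (a b : R) :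
  {within `[a, b], continuous g} -> bounded_measurable g a b.
Proof.
move=> cg; split; first exact: measurable_within_itv.
have /compact_bounded[M [_ hM]] := continuous_compact cg (@segment_compact R a b).
by exists (M + 1) => s sab; apply: (hM (M + 1)); [lra|exists s].
Qed.

(** At break points [dt] may be an arbitrary default; the two end values only enlarge the bound. *)
Lemma bounded_measurable_eq_oo (R : realType) (k g : R -> R) (a b : R) :
  a < b -> (forall s, s \in `]a, b[ -> k s = g s) ->
  bounded_measurable g a b -> bounded_measurable k a b.
Proof.
move=> ab kg [mg [C hg]]; split.
  apply: (@measurable_fun_itv_cc _ a b false true).
  apply: (eq_measurable_fun g) => [s|]; first by rewrite inE/= => /kg.
  by apply: measurable_funS mg => //; exact: subset_itv_oo_cc.
exists (C + `|k a| + `|k b|) => s; rewrite in_itv/= => /andP[].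
have a0 := normr_ge0 (k a); have b0 := normr_ge0 (k b).
have C0 : 0 <= C by apply: le_trans (hg a _); rewrite // in_itv/= lexx ltW.
rewrite !le_eqVlt => /orP[/eqP<- _|as_]; first lra.
move=> /orP[/eqP->|sb]; first lra.
have sI : s \in `]a, b[ by rewrite in_itv/= as_.
rewrite (kg s sI); have := hg s (subset_itv_oo_cc sI); lra.
Qed.

(** The integrated form glues over adjacent intervals, where a pointwise derivative may fail to
    exist. *)
Definition is_primitive (R : realType) (k P : R -> R) (a b : R) : Prop :=
  bounded_measurable k a b /\
  \int[@lebesgue_measure R]_(s in `[a, b]) k s = P b - P a.

Lemma is_primitive_pt (R : realType) (k P : R -> R) (a : R) :
  is_primitive k P a a.
Proof.
split; first exact: bounded_measurable_pt.
by rewrite set_itv1 Rintegral_set1 subrr.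
Qed.

Lemma is_primitiveU (R : realType) (k P : R -> R) (a b c : R) :
  a <= b -> b <= c -> is_primitive k P a b -> is_primitive k P b c ->
  is_primitive k P a c.
Proof.
move=> ab bc [k1 e1] [k2 e2]; have k3 := bounded_measurableU ab bc k1 k2.
split=> //; have := @Rintegral_itvB R k (BLeft a) (BRight c) b
  (bounded_measurable_integrable k3).
rewrite !bnd_simp e1 => /(_ ab bc) /eqP; rewrite subr_eq => /eqP ->.
rewrite Rintegral_itv_obnd_cbnd; first by rewrite e2 addrA subrK.
apply: (@integrableS _ _ _ (@lebesgue_measure R) `[b, c]%classic) => //.
  by apply: subset_itvr; rewrite bnd_simp.
exact: bounded_measurable_integrable.
Qed.

Lemma is_primitive_FTC (R : realType) (Om : set (R * R * R)) (a b : R)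
    (u v w z : R -> field R) :
  measurable Om -> a < b -> c1L2 Om a b u w -> c1L2 Om a b v z ->
  is_primitive (fun s => ip Om (w s) (v s) + ip Om (u s) (z s))
    (fun s => ip Om (u s) (v s)) a b.
Proof.
move=> mO ab cu cv; have [cg ig] := c1L2_ip_FTC mO ab cu cv.
by split; [exact: bounded_measurable_continuous|rewrite /Rintegral ig -EFinB].
Qed.

Lemma is_primitiveDZ (R : realType) (k l P Q : R -> R) (c a b : R) :
  is_primitive k P a b -> is_primitive l Q a b ->
  is_primitive (fun s => k s + c * l s) (fun s => P s + c * Q s) a b.
Proof.
move=> [bk ek] [bl el].
have ik := bounded_measurable_integrable bk.
have il := bounded_measurable_integrable bl.
have icl : (@lebesgue_measure R).-integrable `[a, b] (EFin \o (fun s => c * l s)).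
  rewrite (_ : EFin \o _ = (fun s => c%:E * (EFin \o l) s)%E); first exact: integrableZl.
  by apply/funext => s /=; rewrite EFinM.
split; last first.
  rewrite (RintegralD _ ik icl)//.
  by rewrite RintegralZl// ek el; ring.
split.
  apply: measurable_funD; first exact: bk.1.
  by apply: measurable_funM; [exact: measurable_cst|exact: bl.1].
have [C hC] := bk.2; have [D hD] := bl.2.
exists (C + `|c| * D) => s sab.
apply: (le_trans (ler_normD _ _)); apply: lerD; first exact: hC.
by rewrite normrM ler_wpM2l//; exact: hD.
Qed.

Lemma is_primitive_eq_oo (R : realType) (k g P Q : R -> R) (a b : R) :
  a < b -> (forall s, s \in `]a, b[ -> k s = g s) ->
  P a = Q a -> P b = Q b -> is_primitive g P a b -> is_primitive k Q a b.
Proof.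
move=> ab kg Pa Pb [bg ig]; have bk := bounded_measurable_eq_oo ab kg bg.
split=> //.
have mk : measurable_fun `]a, b[ (EFin \o k).
  by apply/measurable_EFinP; apply: measurable_funS bk.1 => //; exact: subset_itv_oo_cc.
have mg : measurable_fun `]a, b[ (EFin \o g).
  by apply/measurable_EFinP; apply: measurable_funS bg.1 => //; exact: subset_itv_oo_cc.
rewrite -Pa -Pb -ig.
rewrite /Rintegral (@integral_itv_bndoo R a b (EFin \o k) true false mk).
rewrite (@eq_integral _ _ _ (@lebesgue_measure R) _ (EFin \o g) (EFin \o k)); last first.
  by move=> s; rewrite inE/= => sab; rewrite /= kg.
by rewrite -(@integral_itv_bndoo R a b (EFin \o g) true false mg).
Qed.

(** * The energy balance of the error *)

Ltac l2 := by repeat (first [assumption | apply: L2B | apply: L2D | apply: measurable_mact]).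
Ltac ip_expand := rewrite ?mactB ?mactD;
  repeat (first [rewrite ipBl; [|l2..] | rewrite ipDl; [|l2..] |
                 rewrite ipBr; [|l2..] | rewrite ipDr; [|l2..]]).

(** Here A = eps and B = mu^-1; a prefix [c] means curl, [t] an approximation, [w] a derivative on
    the piece, and [E2] is the second derivative of E. The first identity is the wave equation
    tested with [et], the second moves the curl of Y. The pairings of B ctE with curl et = cE1 -
    ctEt cancel, and what is left of curl et meets only Y. *)
Lemma energy_derivative (R : realType) (Om : set (R * R * R)) (A B : mxfield R)
    (E2 wEt et cE cE1 ctE ctEt cwE Y cY wY K : field R) :
  measurable Om -> spd_bounded Om A -> spd_bounded Om B ->
  L2 Om E2 -> L2 Om wEt -> L2 Om et -> L2 Om cE -> L2 Om cE1 -> L2 Om ctE ->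
  L2 Om ctEt -> L2 Om cwE -> L2 Om Y -> L2 Om cY -> L2 Om wY -> L2 Om K ->
  ip Om (mact A E2) et = ip Om K et - ip Om (mact B cE) (cE1 - ctEt) ->
  ip Om cY et = ip Om Y (cE1 - ctEt) ->
  let ce := cE - ctE in let Kt := mact B ctE - Y in
  2 * (ip Om Kt (ctEt - cwE) - ip Om (mact A wEt + cY - K) et +
       ip Om (mact B ctEt - wY) ce) =
  ip Om (mact A (E2 - wEt)) et + ip Om (mact A et) (E2 - wEt) +
  1 * (ip Om (mact B (cE1 - cwE)) ce + ip Om (mact B ce) (cE1 - cwE)) +
  2 * (ip Om (mact B cwE - wY) ce + ip Om Kt (cE1 - cwE)).
Proof.
move=> mO hA hB ? ? ? ? ? ? ? ? ? ? ? ? h1 h2 ce Kt; rewrite {}/ce {}/Kt.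
have sB u v : ip Om (mact B u) v = ip Om (mact B v) u by rewrite ip_mact// ipC.
have sA u v : ip Om (mact A u) v = ip Om (mact A v) u by rewrite ip_mact// ipC.
move: h1 h2; ip_expand.
rewrite (sA et E2) (sA et wEt) (sB ctEt cE) (sB cE1 cE) (sB cwE cE) (sB cE1 ctE).
rewrite (sB cwE ctE) (sB ctEt ctE) => -> ->.
by repeat match goal with |- context[ip ?O ?u ?v] => generalize (ip O u v); intro end; ring.
Qed.

Lemma cL2D (R : realType) (Om : set (R * R * R)) (a b : R)
    (u v : R -> field R) :
  measurable Om -> cL2 Om a b u -> cL2 Om a b v -> cL2 Om a b (fun t => u t + v t).
Proof.
move=> mO cu cv; have c0 : cL2 Om a b (fun=> 0).
  move=> t _; split; first exact: L20.
  have -> : (fun=> nrm_fs (L2_space Om) (0 - 0)) = (fun=> 0) :> (R -> R).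
    by apply/funext => s; rewrite subr0 nrmL2_0.
  exact: cvg_cst.
have -> : (fun t => u t + v t) = (fun t => u t - (0 - v t)).
  by apply/funext => t; rewrite sub0r opprK.
exact: (cL2B mO cu (cL2B mO c0 cv)).
Qed.

Lemma dt_interior (R : realType) (Om : set (R * R * R)) (T a b s : R)
    (u : R -> field R) (w : field R) :
  measurable Om -> (forall s, s \in `[0, T] -> L2 Om (u s)) ->
  0 <= a -> b <= T -> s \in `]a, b[ -> is_dt (L2_space Om) a b u s w ->
  L2 Om (dt Om T u s) /\ aeq Om w (dt Om T u s).
Proof.
move=> mO u2 a0 bT sab h.
have sT : s \in `[0, T] by apply: (subset_itvcc a0 bT); exact: subset_itv_oo_cc.
have T0 : 0 < T.
  by move: sab; rewrite in_itv/= => /andP[as_ sb]; apply: (le_lt_trans a0); apply: lt_le_trans bT; exact: lt_trans sb.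
by have [[]] := dt_is_dt mO T0 sT u2 (is_dt_interior 0 T sab h).
Qed.

Definition flux (R : realType) (Om : set (R * R * R)) (mu : mxfield R) (T : R)
    (tE tEt Y : R -> field R) (s : R) : R :=
  ip Om (Kt Om mu tE Y s) (curl Om (tEt s - dt Om T tE s)).

Definition Mt (R : realType) (Om : set (R * R * R)) (mu : mxfield R) (T : R)
    (tEt Y : R -> field R) (s : R) : field R :=
  mact (minv mu) (curl Om (tEt s)) - dt Om T Y s.

(** The candidate derivative of [energy]: the error enters only through [et] and curl e, never
    through curl et. *)
Definition power (R : realType) (Om : set (R * R * R)) (eps mu : mxfield R)
    (T : R) (K tE tEt Y e et : R -> field R) (s : R) : R :=
  2 * (flux Om mu T tE tEt Y s - ip Om (Kc Om eps T K tEt Y s) (et s) +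
       ip Om (Mt Om mu T tEt Y s) (curl Om (e s))).

(* Adding the term in Kt makes the derivative free of time derivatives of e. *)
Definition energy (R : realType) (Om : set (R * R * R)) (eps mu : mxfield R)
    (tE Y e et : R -> field R) (s : R) : R :=
  wsqn Om eps (et s) + wsqn Om (minv mu) (curl Om (e s)) +
  2 * ip Om (Kt Om mu tE Y s) (curl Om (e s)).

(** The regularity of the three integrands of g is bundled with the identity, so that all are glued
    over the pieces at once. *)
Definition energy_balance (R : realType) (Om : set (R * R * R))
    (eps mu : mxfield R) (T : R) (K tE tEt Y e et : R -> field R) (a b : R) : Prop :=
  [/\ is_primitive (power Om eps mu T K tE tEt Y e et)
        (energy Om eps mu tE Y e et) a b,
      bounded_measurable (flux Om mu T tE tEt Y) a b,
      bounded_measurable (fun s => wsqn Om (minv eps) (Kc Om eps T K tEt Y s)) a b &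
      bounded_measurable (fun s => wsqn Om mu (Mt Om mu T tEt Y s)) a b].

Lemma energy_balance_pt (R : realType) (Om : set (R * R * R))
    (eps mu : mxfield R) (T : R) (K tE tEt Y e et : R -> field R) (a : R) :
  energy_balance Om eps mu T K tE tEt Y e et a a.
Proof.
by split; [exact: is_primitive_pt|exact: bounded_measurable_pt..].
Qed.

Lemma energy_balanceU (R : realType) (Om : set (R * R * R))
    (eps mu : mxfield R) (T : R) (K tE tEt Y e et : R -> field R) (a b c : R) :
  a <= b -> b <= c -> energy_balance Om eps mu T K tE tEt Y e et a b ->
  energy_balance Om eps mu T K tE tEt Y e et b c ->
  energy_balance Om eps mu T K tE tEt Y e et a c.
Proof.
move=> ab bc [h1 h2 h3 h4] [k1 k2 k3 k4]; split.
- exact: is_primitiveU h1 k1.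
- exact: bounded_measurableU h2 k2.
- exact: bounded_measurableU h3 k3.
- exact: bounded_measurableU h4 k4.
Qed.

Definition weak_wave (R : realType) (Om : set (R * R * R)) (eps mu : mxfield R)
    (T : R) (K E E1 E2 : R -> field R) : Prop :=
  [/\ forall t, t \in `[0, T] -> mem_fs (Hcurl Om) (E t) /\ mem_fs (Hcurl Om) (E1 t),
      c1L2 Om 0 T (fun t => curl Om (E t)) (fun t => curl Om (E1 t)),
      c1L2 Om 0 T E1 E2, cL2 Om 0 T K &
      forall s v, s \in `]0, T[ -> mem_fs (Hcurl0 Om) v ->
        ip Om (mact eps (E2 s)) v =
        ip Om (K s) v - ip Om (mact (minv mu) (curl Om (E s))) (curl Om v)].

Lemma energy_balance_piece (R : realType) (Om : set (R * R * R))
    (eps mu : mxfield R) (T : R) (K E E1 E2 tE tEt Y : R -> field R) (a b : R) :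
  let e := fun t => E t - tE t in let et := fun t => E1 t - tEt t in
  open Om -> coefficient Om eps -> coefficient Om mu ->
  weak_wave Om eps mu T K E E1 E2 ->
  (forall t, t \in `[0, T] -> [/\ mem_fs (Hcurl Om) (tE t),
     mem_fs (Hcurl Om) (tEt t) & mem_fs (Hcurl Om) (Y t)]) ->
  (forall t, t \in `]0, T[ -> mem_fs (Hcurl0 Om) (et t)) ->
  0 <= a -> a <= b -> b <= T ->
  c1_piece Om tE a b -> c1_piece Om tEt a b -> c1_piece Om Y a b ->
  energy_balance Om eps mu T K tE tEt Y e et a b.
Proof.
move=> e et oO [heps hie] [hmu him] [hE cE cE1 cK weak] hH het a0 ab bT.
move=> [wE [hwE dE dcE]] [wEt [hwEt dEt dcEt]] [wY [hwY dY dcY]].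
move: ab; rewrite le_eqVlt => /orP[/eqP<-|ab]; first exact: energy_balance_pt.
have mO := open_measurable_R3 oO.
have sub s : s \in `[a, b] -> s \in `[0, T] by move/(subset_itvcc a0 bT).
have subo s : s \in `]a, b[ -> s \in `]0, T[.
  rewrite !in_itv/= => /andP[as_ sb].
  by rewrite (le_lt_trans a0 as_) (lt_le_trans sb bT).
have {}cE := c1L2_sub a0 bT cE; have {}cE1 := c1L2_sub a0 bT cE1.
have {}cK := cL2_sub a0 bT cK.
have det : c1L2 Om a b et (fun t => E2 t - wEt t) := c1L2B mO cE1 dEt.
have dce := c1L2B mO cE dcE.
have dKt : c1L2 Om a b (Kt Om mu tE Y) (fun t => mact (minv mu) (curl Om (wE t)) - wY t).
  exact: (c1L2B mO (c1L2_mact mO him dcE) dY).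
have [cdEt cdY] : cL2 Om a b wEt /\ cL2 Om a b wY by case: dEt dY => _ + _ [_ + _].
(* With [dt] replaced by the derivatives of the piece the residuals are continuous up to the end
   points; the originals agree with them inside. *)
have cKc : cL2 Om a b (fun t => mact eps (wEt t) + curl Om (Y t) - K t).
  apply: (cL2B mO _ cK); apply: (cL2D mO); first exact: cL2_mact.
  by case: dcY.
have cM : cL2 Om a b (fun t => mact (minv mu) (curl Om (tEt t)) - wY t).
  by apply: (cL2B mO _ cdY); apply: (cL2_mact mO him); case: dcEt.
have cfl : cL2 Om a b (fun t => curl Om (tEt t) - curl Om (wE t)).
  by apply: (cL2B mO); [case: dcEt|case: dcE].
have cip2 A u : spd_bounded Om A -> cL2 Om a b u ->
    bounded_measurable (fun s => wsqn Om A (u s)) a b.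
  by move=> hA cu; apply: bounded_measurable_continuous; apply: (cL2_ip mO _ cu); exact: cL2_mact.
have hdE s : s \in `]a, b[ -> L2 Om (dt Om T tE s) /\ aeq Om (wE s) (dt Om T tE s).
  move=> sab; apply: (dt_interior mO _ a0 bT sab); last by case: dE => _ _; apply; exact: subset_itv_oo_cc.
  by move=> r /hH[/Hcurl_L2].
have hdEt s : s \in `]a, b[ -> L2 Om (dt Om T tEt s) /\ aeq Om (wEt s) (dt Om T tEt s).
  move=> sab; apply: (dt_interior mO _ a0 bT sab); last by case: dEt => _ _; apply; exact: subset_itv_oo_cc.
  by move=> r /hH[_ /Hcurl_L2].
have hdY s : s \in `]a, b[ -> L2 Om (dt Om T Y s) /\ aeq Om (wY s) (dt Om T Y s).
  move=> sab; apply: (dt_interior mO _ a0 bT sab); last by case: dY => _ _; apply; exact: subset_itv_oo_cc.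
  by move=> r /hH[_ _ /Hcurl_L2].
have hKc s : s \in `]a, b[ -> L2 Om (Kc Om eps T K tEt Y s) /\
    aeq Om (Kc Om eps T K tEt Y s) (mact eps (wEt s) + curl Om (Y s) - K s).
  move=> sab; have [d2 dw] := hdEt s sab; have sab' := subset_itv_oo_cc sab.
  have [_ _ hY] := hH s (sub s sab'); have [K2 _] := cK s sab'; have cY2 := curl_L2 hY.
  split; first by rewrite /Kc; l2.
  apply: aeqB; last exact: aeqxx.
  by apply: aeqD; [apply: aeq_mact; exact: aeq_sym|exact: aeqxx].
have hM s : s \in `]a, b[ -> L2 Om (Mt Om mu T tEt Y s) /\
    aeq Om (Mt Om mu T tEt Y s) (mact (minv mu) (curl Om (tEt s)) - wY s).
  move=> sab; have [d2 dw] := hdY s sab.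
  have [_ /curl_L2 c2 _] := hH s (sub s (subset_itv_oo_cc sab)).
  split; first by rewrite /Mt; l2.
  by apply: aeqB; [exact: aeqxx|exact: aeq_sym].
have hfl s : s \in `]a, b[ -> L2 Om (curl Om (tEt s - dt Om T tE s)) /\
    aeq Om (curl Om (tEt s - dt Om T tE s)) (curl Om (tEt s) - curl Om (wE s)).
  move=> sab; have [d2 dw] := hdE s sab; have sab' := subset_itv_oo_cc sab.
  have [_ htEt _] := hH s (sub s sab'); have [_ hw] := hwE s sab'.
  (* [dt] is chosen among derivatives in [L2] only; it has a curl because it agrees almost
     everywhere with [wE s]. *)
  have hd := Hcurl_aeq mO hw d2 dw.
  split; first by apply: curl_L2; exact: HcurlB.
  apply: (aeq_trans (curlB oO htEt hd)); apply: aeqB; first exact: aeqxx.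
  by apply: (curl_aeq oO hd hw); exact: aeq_sym.
have hce s : s \in `[a, b] -> L2 Om (curl Om (e s)) /\
    aeq Om (curl Om (e s)) (curl Om (E s) - curl Om (tE s)).
  move=> sab; have [hEs _] := hE s (sub s sab); have [htE _ _] := hH s (sub s sab).
  by split; [apply: curl_L2; exact: HcurlB|exact: curlB].
have flE s : s \in `]a, b[ -> flux Om mu T tE tEt Y s =
    ip Om (Kt Om mu tE Y s) (curl Om (tEt s) - curl Om (wE s)).
  move=> sab; have [f2 fe] := hfl s sab; have sab' := subset_itv_oo_cc sab.
  have [g2 _] := cfl s sab'; have [k2 _] : L2 Om (Kt Om mu tE Y s) /\ True.
    by case: dKt => /(_ s sab')[].
  by apply: ip_aeq => //; exact: aeqxx.
split.
- have P1 := is_primitive_FTC mO ab (c1L2_mact mO heps det) det.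
  have P2 := is_primitive_FTC mO ab (c1L2_mact mO him dce) dce.
  have P3 := is_primitive_FTC mO ab dKt dce.
  have PE s : s \in `[a, b] -> ip Om (mact eps (et s)) (et s) +
      1 * ip Om (mact (minv mu) (curl Om (E s) - curl Om (tE s))) (curl Om (E s) - curl Om (tE s)) +
      2 * ip Om (Kt Om mu tE Y s) (curl Om (E s) - curl Om (tE s)) =
      energy Om eps mu tE Y e et s.
    move=> sab; rewrite /energy mul1r; have [c2 ce] := hce s sab.
    have [d2 _] : L2 Om (curl Om (E s) - curl Om (tE s)) /\ True by case: dce => /(_ s sab)[].
    have [k2 _] : L2 Om (Kt Om mu tE Y s) /\ True by case: dKt => /(_ s sab)[].
    congr (_ + _ + _ * _).
      apply: (ip_aeq mO) => //; [exact: measurable_mact..| |exact: aeq_sym].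
      by apply: aeq_mact; exact: aeq_sym.
    by apply: (ip_aeq mO) => //; [exact: aeqxx|exact: aeq_sym].
  (* The fundamental theorem is applied to the three summands of the energy separately; integrands
     need to match only in the interior and primitives only at the ends. *)
  apply: (is_primitive_eq_oo ab _ _ _ (is_primitiveDZ 2 (is_primitiveDZ 1 P1 P2) P3)).
  + move=> s sab; have sab' := subset_itv_oo_cc sab.
    have [[hEs hE1s] [htE htEt hY]] := (hE s (sub s sab'), hH s (sub s sab')).
    have [K2 _] := cK s sab'; have h0 := het s (subo s sab).
    have het' := Hcurl0_Hcurl h0.
    have E22 : L2 Om (E2 s) by case: cE1 => _ /(_ s sab')[].
    have wEt2 : L2 Om (wEt s) by case: (cdEt s sab').
    have wY2 : L2 Om (wY s) by case: (cdY s sab').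
    have [_ hw] := hwE s sab'.
    have [c2 ce] := hce s sab'; have [M2 Me] := hM s sab; have [Kc2 Kce] := hKc s sab.
    have et2 := Hcurl_L2 het'; have Y2 := Hcurl_L2 hY.
    have cE2 := curl_L2 hEs; have cE12 := curl_L2 hE1s; have ctE2 := curl_L2 htE.
    have ctEt2 := curl_L2 htEt; have cY2 := curl_L2 hY; have cw2 := curl_L2 hw.
    have cete : aeq Om (curl Om (et s)) (curl Om (E1 s) - curl Om (tEt s)) := curlB oO hE1s htEt.
    have cet2 := curl_L2 het'.
    rewrite /power flE//.
    rewrite (ip_aeq mO Kc2 _ et2 et2 Kce (aeqxx _ _)); last by l2.
    rewrite (ip_aeq mO M2 _ c2 _ Me ce); [|by l2..].
    apply: (energy_derivative mO heps him) => //.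
      rewrite (weak s (et s) (subo s sab) h0); congr (_ - _).
      by apply: (ip_aeq mO) => //; [exact: measurable_mact..|l2|exact: aeqxx].
    rewrite -(Hcurl0_parts oO hY h0).
    by apply: (ip_aeq mO) => //; [l2|exact: aeqxx].
  + by apply: PE; rewrite in_itv/= lexx ltW.
  + by apply: PE; rewrite in_itv/= lexx ltW.
- apply: (bounded_measurable_eq_oo ab flE).
  by apply: bounded_measurable_continuous; apply: (cL2_ip mO _ cfl); case: dKt.
- apply: (bounded_measurable_eq_oo ab _ (cip2 _ _ hie cKc)) => s sab.
  have [h1 h2] := hKc s sab; have [h3 _] := cKc s (subset_itv_oo_cc sab).
  by apply: (ip_aeq mO) => //; [exact: measurable_mact..|exact: aeq_mact].
- apply: (bounded_measurable_eq_oo ab _ (cip2 _ _ hmu cM)) => s sab.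
  have [h1 h2] := hM s sab; have [h3 _] := cM s (subset_itv_oo_cc sab).
  by apply: (ip_aeq mO) => //; [exact: measurable_mact..|exact: aeq_mact].
Qed.

Lemma energy_balance_C1p (R : realType) (Om : set (R * R * R))
    (eps mu : mxfield R) (T : R) (K E E1 E2 tE tEt Y : R -> field R) :
  let e := fun t => E t - tE t in let et := fun t => E1 t - tEt t in
  open Om -> coefficient Om eps -> coefficient Om mu ->
  weak_wave Om eps mu T K E E1 E2 ->
  C1p (Hcurl Om) T tE -> C1p (Hcurl Om) T tEt -> C1p (Hcurl Om) T Y ->
  (forall t, t \in `]0, T[ -> mem_fs (Hcurl0 Om) (et t)) ->
  forall a b, 0 <= a -> a <= b -> b <= T ->
  energy_balance Om eps mu T K tE tEt Y e et a b.
Proof.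
move=> e et oO heps hmu hw pE pEt pY het.
set Q := energy_balance _ _ _ _ _ _ _ _ _ _.
have hH t : t \in `[0, T] -> [/\ mem_fs (Hcurl Om) (tE t),
    mem_fs (Hcurl Om) (tEt t) & mem_fs (Hcurl Om) (Y t)].
  move=> tT; split.
  - by have [[/(_ t tT)[]]] := pE.
  - by have [[/(_ t tT)[]]] := pEt.
  - by have [[/(_ t tT)[]]] := pY.
have Q0 a : Q a a by exact: energy_balance_pt.
have QD a b c : a <= b -> b <= c -> Q a b -> Q b c -> Q a c.
  exact: energy_balanceU.
(* Additivity is inherited by the implication from being a C^1 piece, since pieces restrict. Hence
   the three partitions can be treated one after another. *)
have restr u (P : R -> R -> Prop) : (forall a b c, a <= b -> b <= c -> P a b -> P b c -> P a c) ->
    forall a b c, a <= b -> b <= c -> (c1_piece Om u a b -> P a b) ->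
    (c1_piece Om u b c -> P b c) -> c1_piece Om u a c -> P a c.
  move=> PD a b c ab bc h1 h2 hu; apply: (PD _ b) => //.
    by apply: h1; exact: c1_piece_sub hu.
  by apply: h2; exact: c1_piece_sub hu.
apply: (C1p_additive oO pE Q0 QD) => a b a0 ab bT; move: a b a0 ab bT.
apply: (C1p_additive oO pEt (fun a _ => Q0 a) (restr _ _ QD)) => a b a0 ab bT.
move: a b a0 ab bT.
apply: (C1p_additive oO pY (fun a _ _ => Q0 a) (restr _ _ (restr _ _ QD))).
move=> a b a0 ab bT cY cEt cE.
exact: (energy_balance_piece oO heps hmu hw hH het a0 ab bT cE cEt cY).
Qed.

(** * The second-order equation *)

Lemma Ck_linear (R : realType) (V W : lmodType R) (X : fspace V) (Y : fspace W)
    (f : V -> W) (k : nat) (a b : R) (u : R -> V) :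
  (forall v w, f (v - w) = f v - f w) -> (forall c v, f (c *: v) = c *: f v) ->
  (forall v, mem_fs X v -> mem_fs Y (f v)) ->
  (forall v, 0 <= nrm_fs Y (f v) <= nrm_fs X v) ->
  Ck X k a b u -> Ck Y k a b (fun t => f (u t)).
Proof.
move=> fB fZ fm fn; elim: k u => [|k IH] u [cu hu]; (split; [move=> t tab; have [ut cut] := cu t tab; split; [exact: fm|]|]) => //.
- by apply: (cvg0_le _ _ cut); apply: filterE => s; rewrite -fB.
- by apply: (cvg0_le _ _ cut); apply: filterE => s; rewrite -fB.
- have [w [dw cw]] := hu; exists (fun t => f (w t)); split; last exact: IH.
  move=> t tab; have [wt dwt] := dw t tab; split; first exact: fm.
  by apply: (cvg0_le _ _ dwt); apply: filterE => s; rewrite -fB -fZ -fB.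
Qed.

Lemma Ck_fst (R : realType) (V W : lmodType R) (X : fspace V) (Y : fspace W)
    (k : nat) (a b : R) (u : R -> V * W) :
  (forall v, 0 <= nrm_fs X v) -> Ck (prod_space X Y) k a b u ->
  Ck X k a b (fun t => (u t).1).
Proof.
move=> X0; apply: (Ck_linear (f := fst)) => // [v []//|v]; rewrite X0/=.
by rewrite -[leLHS](ger0_norm (X0 _)) -sqrtr_sqr ler_wsqrtr// lerDl sqr_ge0.
Qed.

Lemma Ck_snd (R : realType) (V W : lmodType R) (X : fspace V) (Y : fspace W)
    (k : nat) (a b : R) (u : R -> V * W) :
  (forall v, 0 <= nrm_fs Y v) -> Ck (prod_space X Y) k a b u ->
  Ck Y k a b (fun t => (u t).2).
Proof.
move=> Y0; apply: (Ck_linear (f := snd)) => // [v []//|v]; rewrite Y0/=.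
by rewrite -[leLHS](ger0_norm (Y0 _)) -sqrtr_sqr ler_wsqrtr// lerDr sqr_ge0.
Qed.

Lemma Ck_Hcurl0 (R : realType) (Om : set (R * R * R)) (k : nat) (a b : R)
    (u : R -> field R) : Ck (Hcurl0 Om) k a b u -> Ck (Hcurl Om) k a b u.
Proof.
apply: (Ck_linear (f := id)) => // [v []//|v].
by apply/andP; split; [exact: sqrtr_ge0|exact: lexx].
Qed.

Lemma Ck1_L2 (R : realType) (Om : set (R * R * R)) (k : nat) (a b : R) (u : R -> field R) :
  Ck (L2_space Om) k.+1 a b u -> exists2 w : R -> field R,
    c1L2 Om a b u w & Ck (L2_space Om) k a b w.
Proof.
move=> [cu [w [dw cw]]]; exists w; last exact: cw.
by split; [exact: cu|case: k cw => [|k] cw; exact: (proj1 cw)|exact: dw].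
Qed.

Lemma c1L2_dt (R : realType) (Om : set (R * R * R)) (T : R) (u w : R -> field R) :
  measurable Om -> 0 < T -> c1L2 Om 0 T u w ->
  c1L2 Om 0 T u (dt Om T u) /\
  forall t, t \in `[0, T] -> L2 Om (dt Om T u t) /\ aeq Om (w t) (dt Om T u t).
Proof.
move=> mO T0 cu; have [cu0 cw du] := cu.
have u2 s : s \in `[0, T] -> L2 Om (u s) by case/cu0.
have h t : t \in `[0, T] -> L2 Om (dt Om T u t) /\ aeq Om (w t) (dt Om T u t).
  by move=> tT; have [[]] := dt_is_dt mO T0 tT u2 (du t tT).
split; last exact: h.
by apply: (c1L2_aeq mO _ h cu) => s sT; split; [exact: u2|exact: aeqxx].
Qed.

Lemma c1L2_dt_Hcurl (R : realType) (Om : set (R * R * R)) (T : R)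
    (u : R -> field R) :
  open Om -> 0 < T -> Ck (Hcurl Om) 1 0 T u ->
  (forall t, t \in `[0, T] -> mem_fs (Hcurl Om) (u t) /\ mem_fs (Hcurl Om) (dt Om T u t)) /\
  c1L2 Om 0 T (fun t => curl Om (u t)) (fun t => curl Om (dt Om T u t)).
Proof.
move=> oO T0 /(c1L2_Hcurl oO)[w [hw cu ccu]]; have mO := open_measurable_R3 oO.
have [_ h] := c1L2_dt mO T0 cu.
have hd t : t \in `[0, T] -> mem_fs (Hcurl Om) (u t) /\ mem_fs (Hcurl Om) (dt Om T u t).
  move=> tT; have [hu hwt] := hw t tT; have [d2 dw] := h t tT.
  by split; [exact: hu|exact: Hcurl_aeq hwt d2 dw].
split; first exact: hd.
apply: (c1L2_aeq mO _ _ ccu) => t tT; have [hu hdt] := hd t tT.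
  by split; [exact: curl_L2|exact: aeqxx].
have [_ hwt] := hw t tT; have [d2 dw] := h t tT.
by split; [exact: curl_L2|exact: (curl_aeq oO hwt hdt dw)].
Qed.

(** The evolution equations are given on the open interval, the claims concern the closed one: |u -
    v|^2 is continuous and vanishes inside, hence also at the ends. *)
Lemma aeq_itvcc (R : realType) (Om : set (R * R * R)) (a b : R)
    (u v : R -> field R) :
  measurable Om -> a < b -> cL2 Om a b u -> cL2 Om a b v ->
  (forall t, t \in `]a, b[ -> aeq Om (u t) (v t)) ->
  forall t, t \in `[a, b] -> aeq Om (u t) (v t).
Proof.
move=> mO ab cu cv uv t tab; have cd := cL2B mO cu cv.
have d2 s : s \in `[a, b] -> L2 Om (u s - v s) by case/cd.
apply/aeq_subr0; apply: (ip_eq0_aeq mO (d2 t tab)).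
have PF := within_itv_dnbhs_proper ab tab.
have /subspace_continuousP/(_ t tab) := cL2_ip mO cd cd.
set g := fun s => ip Om (u s - v s) (u s - v s) => gt.
have gt' : g @ within `[a, b] t^' --> g t.
  apply: cvg_trans gt; apply: cvg_app => P.
  exact: (@nbhs_dnbhs _ t (fun s => s \in `[a, b] -> P s)).
suff g0 : \forall s \near within `[a, b] t^', g s = 0.
  have g0' : g @ within `[a, b] t^' --> (0 : R).
    by apply: (cvg_trans _ (@cvg_cst _ (0 : R) _ (within `[a, b] t^') _)); apply: near_eq_cvg; move: g0; apply: filterS => s ->.
  exact: (cvg_unique _ gt' g0').
(* Close to t and distinct from it, a point of the segment is neither end: an end equal to t is
   excluded, another one is too far. *)
have : \forall s \near t^', s \in `[a, b] -> s \in `]a, b[.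
  move: (tab); rewrite in_itv/= => /andP[at_ tb].
  have h1 : \forall s \near t^', a <= s -> a < s.
    move: at_; rewrite le_eqVlt => /orP[/eqP ->|at_].
      by apply: (filterS _ (@nbhs_dnbhs_neq _ t)) => s st ts; rewrite lt_neqAle eq_sym st.
    by apply: nbhs_dnbhs; near=> s => _; near: s; exact: lt_nbhsr.
  have h2 : \forall s \near t^', s <= b -> s < b.
    move: tb; rewrite le_eqVlt => /orP[/eqP <-|tb].
      by apply: (filterS _ (@nbhs_dnbhs_neq _ t)) => s st ts; rewrite lt_neqAle st.
    by apply: nbhs_dnbhs; near=> s => _; near: s; exact: lt_nbhsl.
  move: h1 h2; apply: filterS2 => s h1 h2; rewrite !in_itv/= => /andP[as_ sb].
  by rewrite h1// h2.
apply: filterS => s h sab; have sab' := h sab.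
have z2 := L20 mO.
rewrite /g (ip_aeq mO (d2 s sab) z2 (d2 s sab) (d2 s sab) _ (aeqxx _ _)).
  by rewrite -(scale0r (0 : field R)) ipZl ?mul0r//; exact: d2.
by apply/aeq_subr0; exact: uv.
Unshelve. all: by end_near. Qed.

Lemma c1L2_cL2 (R : realType) (Om : set (R * R * R)) (a b : R)
    (u w : R -> field R) : c1L2 Om a b u w -> cL2 Om a b u.
Proof. by case. Qed.

Lemma c1L2_cL2d (R : realType) (Om : set (R * R * R)) (a b : R)
    (u w : R -> field R) : c1L2 Om a b u w -> cL2 Om a b w.
Proof. by case. Qed.

(** Differentiate the first equation in time, test it, move the curl of the derivative of H onto
    [v], and eliminate that derivative by the second equation. No double curl of E is ever
    formed. *)
Lemma maxwell_weak_wave (R : realType) (Om : set (R * R * R)) (T : R)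
    (eps mu : mxfield R) (F G : R -> field R) (E0 H0 : field R)
    (E H : R -> field R) :
  open Om -> 0 < T -> coefficient Om eps -> coefficient Om mu ->
  maxwell_data Om eps mu T F G E0 H0 ->
  maxwell_solution Om eps mu T F G E0 H0 E H ->
  (exists E2, weak_wave Om eps mu T
     (fun t => mact eps (dt Om T F t) + curl Om (G t)) E (dt Om T E) E2) /\
  forall t, t \in `[0, T] ->
    [/\ aeq Om (dt Om T E t - mact (minv eps) (curl Om (H t))) (F t),
        aeq Om (dt Om T H t + mact (minv mu) (curl Om (E t))) (G t),
        mem_fs (Hcurl Om) (H t), L2 Om (dt Om T H t) & L2 Om (F t) /\ L2 Om (G t)].
Proof.
move=> oO T0 [heps hie] [hmu him] [_ dataD dataH _] [_ solD solH eqn _].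
have mO := open_measurable_R3 oO.
have Hcurl_ge0 v : 0 <= nrm_fs (Hcurl Om) v by exact: sqrtr_ge0.
have L2_ge0 v : 0 <= nrm_fs (L2_space Om) v by exact: sqrtr_ge0.
have Hcurl0_ge0 v : 0 <= nrm_fs (Hcurl0 Om) v by exact: sqrtr_ge0.
have solE : Ck (Hcurl0 Om) 1 0 T E := Ck_fst Hcurl0_ge0 solD.
have {solD} solHc : Ck (Hcurl Om) 1 0 T H := Ck_snd Hcurl_ge0 solD.
have solE2 : Ck (L2_space Om) 2 0 T E := Ck_fst L2_ge0 solH.
have {solH} solH2 : Ck (L2_space Om) 2 0 T H := Ck_snd L2_ge0 solH.
have {dataD} dataG : Ck (Hcurl Om) 0 0 T G := Ck_snd Hcurl_ge0 dataD.
have {dataH} dataF : Ck (L2_space Om) 1 0 T F := Ck_fst L2_ge0 dataH.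
have [hE ccE] := c1L2_dt_Hcurl oO T0 (Ck_Hcurl0 solE).
have [hH ccH] := c1L2_dt_Hcurl oO T0 solHc.
have [hG _] := dataG.
have [cG ccG] := cL2_Hcurl oO dataG.
have [F1 dF _] := Ck1_L2 dataF.
have {dF} [dF hF] := c1L2_dt mO T0 dF.
have [E1 dE /Ck1_L2[E2 dE1 _]] := Ck1_L2 solE2.
have [H1 dH _] := Ck1_L2 solH2.
have {dE} [dE hdE] := c1L2_dt mO T0 dE.
have {dH} [dH hdH] := c1L2_dt mO T0 dH.
have {}dE1 : c1L2 Om 0 T (dt Om T E) E2.
  apply: (c1L2_aeq mO hdE _ dE1) => t tT; split; last exact: aeqxx.
  by have [] := c1L2_cL2d dE1 tT.
have cF := c1L2_cL2 dF.
have cdF := c1L2_cL2d dF.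
have cdH := c1L2_cL2d dH.
have dEH := c1L2B mO dE1 (c1L2_mact mO hie ccH).
have eqE : forall t, t \in `[0, T] ->
    aeq Om (dt Om T E t - mact (minv eps) (curl Om (H t))) (F t).
  by apply: (aeq_itvcc mO T0 (c1L2_cL2 dEH) cF) => t /eqn[].
have eqH : forall t, t \in `[0, T] ->
    aeq Om (dt Om T H t + mact (minv mu) (curl Om (E t))) (G t).
  apply: (aeq_itvcc mO T0 _ cG); last by move=> t /eqn[_ h]; exact: h.
  by apply: (cL2D mO cdH); apply: (cL2_mact mO him); exact: c1L2_cL2 ccE.
split; last first.
  move=> t tT; split; [exact: eqE|exact: eqH| | |split].
  - by case: (hH t tT).
  - by case: (hdH t tT).
  - by case: (cF t tT).
  - by case: (cG t tT).
exists E2; split; [exact: hE|exact: ccE|exact: dE1| |].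
  by apply: (cL2D mO _ ccG); exact: cL2_mact.
move=> s v sT' hv; have sT : s \in `[0, T] by exact: subset_itv_oo_cc.
have [[hEs hdEs] [hHs hdHs]] := (hE s sT, hH s sT).
have [E22 _] : L2 Om (E2 s) /\ True by have [] := c1L2_cL2d dE1 sT.
have [dF2 _] := hF s sT; have [hGs _] := hG s sT.
have F2 r : r \in `[0, T] -> L2 Om (F r) by case/cF.
have hv' := Hcurl0_Hcurl hv; have v2 := Hcurl_L2 hv'; have cv2 := curl_L2 hv'.
have cdH2 := curl_L2 hdHs; have dH2 := Hcurl_L2 hdHs; have cE2 := curl_L2 hEs.
have G2 := Hcurl_L2 hGs; have cG2 := curl_L2 hGs.
(* The first equation holds almost everywhere in space at every time, so both sides have the same
   strong derivative. *)
have dFE : aeq Om (E2 s - mact (minv eps) (curl Om (dt Om T H s))) (dt Om T F s).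
  have [_ _ /(_ s sT) dd] := dEH.
  have d2 : L2 Om (E2 s - mact (minv eps) (curl Om (dt Om T H s))) by l2.
  have eqF r : r \in `[0, T] ->
      [/\ L2 Om (dt Om T E r - mact (minv eps) (curl Om (H r))), L2 Om (F r) &
        aeq Om (dt Om T E r - mact (minv eps) (curl Om (H r))) (F r)].
    move=> rT; split; [|exact: F2|exact: eqE].
    by have [] := c1L2_cL2 dEH rT.
  have ddF := is_dt_aeq mO eqF sT d2 (aeqxx _ _) dd.
  have [_ h] := dt_is_dt mO T0 sT F2 ddF; exact: h.
have eE : aeq Om (mact eps (E2 s)) (mact eps (dt Om T F s) + curl Om (dt Om T H s)).
  apply: (@aeq_trans _ _ (mact eps (E2 s - mact (minv eps) (curl Om (dt Om T H s)) + mact (minv eps) (curl Om (dt Om T H s))))).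
    by rewrite subrK; exact: aeqxx.
  rewrite mactD; apply: aeqD; first exact: aeq_mact.
  exact: mactVK.
have eH : aeq Om (dt Om T H s) (G s - mact (minv mu) (curl Om (E s))).
  apply: (@aeq_trans _ _ (dt Om T H s + mact (minv mu) (curl Om (E s)) - mact (minv mu) (curl Om (E s)))).
    by rewrite addrK; exact: aeqxx.
  by apply: aeqB; [exact: eqH|exact: aeqxx].
have e1 : ip Om (mact eps (E2 s)) v = ip Om (mact eps (dt Om T F s) + curl Om (dt Om T H s)) v.
  by apply: (ip_aeq mO) => //; [l2|l2|exact: aeqxx].
have e2 : ip Om (dt Om T H s) (curl Om v) = ip Om (G s - mact (minv mu) (curl Om (E s))) (curl Om v).
  by apply: (ip_aeq mO) => //; [l2|exact: aeqxx].
(* After the substitution the curl is moved back onto G only; mu^-1 curl E stays paired with curl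
   v. *)
rewrite e1 ipDl; [|l2..]; rewrite -(Hcurl0_parts oO hdHs hv) e2 ipBl; [|l2..].
rewrite (Hcurl0_parts oO hGs hv) (ipDl (u := mact eps (dt Om T F s))); [|l2..].
by rewrite addrA.
Qed.

(** * The error bounds *)

Lemma measurable_fun_invr_pos d (T : measurableType d) (R : realType) (D : set T)
    (g : T -> R) :
  measurable_fun D g -> (forall x, D x -> 0 < g x) ->
  measurable_fun D (fun x => (g x)^-1).
Proof.
move=> mg g0; apply: (eq_measurable_fun (fun x => g x `^ (-1))) => [x /set_mem Dx|].
  by rewrite powR_inv1// ltW// g0.
by apply: (@measurableT_comp _ _ _ _ _ _ (fun x : R => x `^ (-1)));
  [exact: measurable_powR|exact: mg].
Qed.

(** Where no derivative exists the choice returns 0, so square integrability holds at every time. *)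
Lemma L2_dt (R : realType) (Om : set (R * R * R)) (T t : R) (u : R -> field R) :
  measurable Om -> L2 Om (dt Om T u t).
Proof. by move=> mO; rewrite /dt; case: xgetP => [w _ [] //|_]; exact: L20. Qed.

Lemma bounded_measurableB (R : realType) (k l : R -> R) (a b : R) :
  bounded_measurable k a b -> bounded_measurable l a b ->
  bounded_measurable (fun s => k s - l s) a b.
Proof.
move=> [mk [C hC]] [ml [D hD]]; split; first exact: measurable_funB.
exists (C + D) => s sab; apply: (le_trans (ler_normB _ _)).
by apply: lerD; [exact: hC|exact: hD].
Qed.

Lemma bounded_measurableZ (R : realType) (k : R -> R) (c a b : R) :
  bounded_measurable k a b -> bounded_measurable (fun s => c * k s) a b.
Proof.
move=> [mk [C hC]]; split.
  by apply: measurable_funM; [exact: measurable_cst|exact: mk].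
by exists (`|c| * C) => s sab; rewrite normrM ler_wpM2l//; exact: hC.
Qed.

Lemma bounded_measurable_sub (R : realType) (k : R -> R) (a b a' b' : R) :
  a <= a' -> b' <= b -> bounded_measurable k a b -> bounded_measurable k a' b'.
Proof.
move=> aa bb [mk [C hC]]; have sub := subset_itvcc aa bb.
split; first exact: (measurable_funS _ sub mk).
by exists C => s sab; apply: hC; exact: (sub s sab).
Qed.

Lemma double_sub_split (R : comPzRingType) (a b c g : R) :
  2 * (a - b + c) - 2 * a - g = 2 * (c - b) - g.
Proof. ring. Qed.

(** Read a = |et|^2, b = |curl e|^2, c = <Kt, curl e>, k = (1 - r)^-1 |Kt|^2: Young's inequality
    consumes the share 1 - r of b. *)
Lemma energy_lower_split (R : realDomainType) (a b c k r : R) :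
  2 * - c <= k + (1 - r) * b -> a + r * b <= a + b + 2 * c + k.
Proof. lra. Qed.

Lemma energy_step_split (R : realDomainType) (n Phi c ft z P : R) :
  n <= Phi + c -> n <= c + ft + z + P + (Phi - z - ft - P).
Proof. lra. Qed.

Lemma addeA_regroup (R : realDomainType) (x z p : R) (i j : \bar R) :
  (x%:E + i + j + z%:E + p%:E = (x + z + p)%:E + (i + j))%E.
Proof. by rewrite !EFinD -(addeA x%:E) (addeAC x%:E) (addeAC (x%:E + z%:E)%E). Qed.

Lemma energy_young (R : realType) (Om : set (R * R * R)) (eps mu : mxfield R)
    (gam rho : R) (Kcs ets Ms ces : field R) :
  measurable Om -> coefficient Om eps -> coefficient Om mu ->
  L2 Om Kcs -> L2 Om ets -> L2 Om Ms -> L2 Om ces -> 0 < gam -> 0 < rho ->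
  2 * (ip Om Ms ces - ip Om Kcs ets) -
    gam * (wsqn Om eps ets + rho * wsqn Om (minv mu) ces) <=
  gam^-1 * wsqn Om (minv eps) Kcs + (gam * rho)^-1 * wsqn Om mu Ms.
Proof.
move=> mO heps hmu Kc2 et2 M2 ce2 g0 r0.
have gr0 : 0 < (gam * rho)^-1 by rewrite invr_gt0 mulr_gt0.
have := ip_weighted_young mO hmu M2 ce2 gr0; rewrite invrK.
have := ip_weighted_young mO heps et2 (L2N mO Kc2) g0.
rewrite (wsqnN mO heps.2 Kc2) (ipC Om ets) (ipNl mO Kc2 et2).
set a := ip Om Ms ces; set b := ip Om Kcs ets; lra.
Qed.

Lemma EFin_Rintegral d (T : measurableType d) (R : realType)
    (m : {measure set T -> \bar R}) (D : set T) (g : T -> R) :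
  measurable D -> m.-integrable D (EFin \o g) ->
  (\int[m]_(x in D) g x)%:E = (\int[m]_(x in D) (g x)%:E)%E.
Proof. by move=> mD ig; rewrite /Rintegral fineK//; exact: (integrable_fin_num mD ig). Qed.

Lemma error_norm_le_primitive (R : realType) (Om : set (R * R * R))
    (eps mu : mxfield R) (T : R) (K E E1 tE tEt Y : R -> field R)
    (rho gamma : R -> R) (s : R) :
  let e := fun t => E t - tE t in let et := fun t => E1 t - tEt t in
  let n := fun t =>
    wsqn Om eps (et t) + rho t * wsqn Om (minv mu) (curl Om (e t)) in
  measurable Om -> coefficient Om eps -> coefficient Om mu ->
  (forall r, r \in `[0, s] -> [/\ L2 Om (K r), L2 Om (et r), L2 Om (curl Om (e r)),
     L2 Om (curl Om (tE r)) & L2 Om (Y r) /\ L2 Om (curl Om (Y r))]) ->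
  (forall r, r \in `[0, s] -> L2 Om (curl Om (tEt r))) ->
  energy_balance Om eps mu T K tE tEt Y e et 0 s ->
  measurable_fun `[0, s] rho -> (forall r, r \in `[0, s] -> 0 < rho r < 1) ->
  (@lebesgue_measure R).-integrable `[0, s] (EFin \o gamma) ->
  (forall r, r \in `[0, s] -> 0 < gamma r) ->
  bounded_measurable n 0 s -> 0 <= s ->
  ((n s)%:E <= gfun Om eps mu T K tE tEt rho Y gamma s +
     (zconst Om eps mu tE Y e et)%:E +
     (primitive (fun r => (gamma r * n r)%R) s)%:E)%E.
Proof.
move=> e et n mO heps hmu h2 h2' [[bp ip_p] bfl bkc bm] mrho hrho ig hg bn s0.
have [hrs0 hrs1] : 0 < rho s /\ rho s < 1.
  by apply/andP; apply: hrho; rewrite in_itv/= lexx s0.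
have sI : s \in `[0, s] by rewrite in_itv/= lexx s0.
have mI : measurable (`[0, s]%classic : set (measurableTypeR R)) by [].
have Kt2 r : r \in `[0, s] -> L2 Om (Kt Om mu tE Y r).
  move=> rI; have [_ _ _ a [b _]] := h2 r rI; rewrite /Kt.
  by apply: L2B => //; apply: measurable_mact => //; exact: hmu.2.
have M2 r : r \in `[0, s] -> L2 Om (Mt Om mu T tEt Y r).
  move=> rI; rewrite /Mt; apply: L2B => //; last exact: L2_dt.
  by apply: measurable_mact => //; [exact: hmu.2|exact: h2'].
have Kc2 r : r \in `[0, s] -> L2 Om (Kc Om eps T K tEt Y r).
  move=> rI; have [a _ _ _ [_ b]] := h2 r rI; rewrite /Kc.
  apply: L2B => //; apply: L2D => //.
  by apply: measurable_mact => //; [exact: heps.1|exact: L2_dt].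
set kc := fun r => wsqn Om (minv eps) (Kc Om eps T K tEt Y r) in bkc *.
set m2 := fun r => wsqn Om mu (Mt Om mu T tEt Y r) in bm *.
set fl := flux Om mu T tE tEt Y in bfl *.
set pw := power Om eps mu T K tE tEt Y e et in bp ip_p *.
have [mn [M nM]] := bn.
have ign : (@lebesgue_measure R).-integrable `[0, s] (EFin \o (fun r => gamma r * n r)).
  exact: (integrable_bounded_mul mI ig mn nM).
have bd := bounded_measurableB bp (bounded_measurableZ 2 bfl).
have id := bounded_measurable_integrable bd.
(* What is left of the power without the flux and the Gronwall term. It is integrable and lies
   pointwise below the two Young terms, whose integrals may be infinite. *)
pose h r := pw r - 2 * fl r - gamma r * n r.
have ih : (@lebesgue_measure R).-integrable `[0, s] (EFin \o h).
  have := integrableB mI id ign; exact: eq_integrable.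
have Ih : \int[@lebesgue_measure R]_(r in `[0, s]) h r =
    \int[@lebesgue_measure R]_(r in `[0, s]) pw r -
    2 * \int[@lebesgue_measure R]_(r in `[0, s]) fl r - primitive (fun r => gamma r * n r) s.
  rewrite primitiveE (RintegralB mI id ign) (RintegralB mI (bounded_measurable_integrable bp)
    (bounded_measurable_integrable (bounded_measurableZ 2 bfl))).
  by rewrite (RintegralZl _ mI (bounded_measurable_integrable bfl)).
set I1 := (\int[@lebesgue_measure R]_(r in `[0%R, s]) ((gamma r)^-1 * kc r)%:E)%E.
set I2 := (\int[@lebesgue_measure R]_(r in `[0%R, s]) ((gamma r * rho r)^-1 * m2 r)%:E)%E.
have /integrableP[/measurable_EFinP mg _] := ig.
have kc0 r : 0 <= kc r by exact: (wsqn_ge0 _ heps.2).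
have m20 r : 0 <= m2 r by exact: (wsqn_ge0 _ hmu.1).
have hle r : r \in `[0, s] -> h r <= (gamma r)^-1 * kc r + (gamma r * rho r)^-1 * m2 r.
  move=> rI; have [_ et2 ce2 _ _] := h2 r rI; have /andP[r0 _] := hrho r rI.
  rewrite /h /pw /power double_sub_split.
  exact: (energy_young mO heps hmu (Kc2 r rI) et2 (M2 r rI) ce2 (hg r rI) r0).
have hI : ((\int[@lebesgue_measure R]_(r in `[0, s]) h r)%:E <= I1 + I2)%E.
  rewrite (EFin_Rintegral mI ih) /I1 /I2 -ge0_integralD//.
  - apply: (nonmeasurable_le_integral mI ih) => r rI; rewrite /= -EFinD lee_fin.
    exact: hle.
  - by move=> r rI; rewrite lee_fin mulr_ge0// invr_ge0 ltW// hg.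
  - apply/measurable_EFinP; apply: measurable_funM; last exact: bkc.1.
    exact: measurable_fun_invr_pos.
  - move=> r rI; rewrite lee_fin mulr_ge0// invr_ge0 mulr_ge0// ltW//; first exact: hg.
    by have /andP[] := hrho r rI.
  - apply/measurable_EFinP; apply: measurable_funM; last exact: bm.1.
    apply: measurable_fun_invr_pos; first exact: measurable_funM.
    by move=> r rI; rewrite mulr_gt0 ?hg//; have /andP[] := hrho r rI.
have Kts : n s <= energy Om eps mu tE Y e et s +
    (1 - rho s)^-1 * wsqn Om mu (Kt Om mu tE Y s).
  have [_ _ ce2 _ _] := h2 s sI.
  have c0 : 0 < (1 - rho s)^-1 by rewrite invr_gt0 subr_gt0.
  have := ip_weighted_young mO hmu (L2N mO (Kt2 s sI)) ce2 c0.
  rewrite invrK (wsqnN mO hmu.1 (Kt2 s sI)) (ipNl mO (Kt2 s sI) ce2) /n /energy.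
  exact: energy_lower_split.
have E0z : energy Om eps mu tE Y e et 0 = zconst Om eps mu tE Y e et by [].
set c := (1 - rho s)^-1 * wsqn Om mu (Kt Om mu tE Y s) in Kts *.
set ft := 2 * \int[@lebesgue_measure R]_(r in `[0, s]) fl r in Ih *.
set P := primitive _ s in Ih *.
have step : n s <= c + ft + zconst Om eps mu tE Y e et + P +
    \int[@lebesgue_measure R]_(r in `[0, s]) h r.
  by rewrite Ih ip_p E0z; exact: energy_step_split.
have -> : gfun Om eps mu T K tE tEt rho Y gamma s = ((c + ft)%:E + I1 + I2)%E by [].
rewrite addeA_regroup.
apply: (le_trans _ (leeD2l _ hI)); by rewrite -EFinD lee_fin.
Qed.

Lemma error_norm_le_bound (R : realType) (Om : set (R * R * R))
    (eps mu : mxfield R) (T : R) (K E E1 E2 tE tEt Y : R -> field R)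
    (rho gamma : R -> R) (t : R) :
  let e := fun t => E t - tE t in let et := fun t => E1 t - tEt t in
  open Om -> coefficient Om eps -> coefficient Om mu ->
  weak_wave Om eps mu T K E E1 E2 -> rho_weight T rho ->
  C1p (Hcurl Om) T tE -> C1p (Hcurl Om) T tEt -> C1p (Hcurl Om) T Y ->
  (forall t, t \in `]0, T[ -> mem_fs (Hcurl0 Om) (et t)) ->
  gamma_weight T gamma -> t \in `[0, T] ->
  ((wsqn Om eps (et t) + rho t * wsqn Om (minv mu) (curl Om (e t)))%:E <=
   bound gamma (fun s => gfun Om eps mu T K tE tEt rho Y gamma s +
     (zconst Om eps mu tE Y e et)%:E) t)%E.
Proof.
move=> e et oO heps hmu hw [mrho hrho] pE pEt pY het [ig hg] tT.
have mO := open_measurable_R3 oO.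
move: (tT); rewrite in_itv/= => /andP[t0 tleT].
have [hE ccE cE1 cK _] := hw.
have [[cE0 ctE] [cEt0 ctEt] [cY0 cY]] := And3 (cL2_Hcurl oO pE.1) (cL2_Hcurl oO pEt.1) (cL2_Hcurl oO pY.1).
have htE r : r \in `[0, T] -> mem_fs (Hcurl Om) (tE r) by move=> rT; have [h _] := pE.1.1 r rT; exact: h.
have cet : cL2 Om 0 T et := cL2B mO (c1L2_cL2 cE1) cEt0.
have cce : cL2 Om 0 T (fun r => curl Om (e r)).
  apply: (cL2_aeq mO _ (cL2B mO (c1L2_cL2 ccE) ctE)) => r rT.
  have [hEr _] := hE r rT.
  by split; [apply: curl_L2; exact: (HcurlB mO hEr (htE r rT))|
    apply: aeq_sym; exact: (curlB oO hEr (htE r rT))].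
have bw A u : spd_bounded Om A -> cL2 Om 0 T u ->
    bounded_measurable (fun s => wsqn Om A (u s)) 0 T.
  move=> hA cu; apply: bounded_measurable_continuous.
  by apply: (cL2_ip mO _ cu); exact: cL2_mact.
have [m1 [C1 b1]] := bw _ _ heps.1 cet.
have [m2 [C2 b2]] := bw _ _ hmu.2 cce.
pose n r := wsqn Om eps (et r) + rho r * wsqn Om (minv mu) (curl Om (e r)).
(* The two norms are continuous in time, but rho is only measurable with values below 1. *)
have bn : bounded_measurable n 0 T.
  split; first by apply: measurable_funD; [exact: m1|apply: measurable_funM; [exact: mrho|exact: m2]].
  exists (C1 + C2) => r rT; apply: (le_trans (ler_normD _ _)); apply: lerD; first exact: b1.
  have [r0 r1] := hrho r rT; rewrite normrM (ger0_norm (ltW r0)).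
  apply: le_trans (b2 r rT); rewrite -[leRHS]mul1r; apply: ler_wpM2r => //; exact: ltW.
have sub s : s \in `[0, t] -> (`[0, s]%classic `<=` `[0, T]%classic).
  rewrite in_itv/= => /andP[_ st]; apply: subset_itvcc => //; exact: le_trans tleT.
have igs s : s \in `[0, t] -> (@lebesgue_measure R).-integrable `[0, s] (EFin \o gamma).
  move=> st; apply: (@integrableS _ _ _ (@lebesgue_measure R) `[0, T]%classic) => //.
  exact: sub.
have tt : t \in `[0, t] by rewrite in_itv/= lexx t0.
have [mn [M nM]] := bounded_measurable_sub (lexx 0) tleT bn.
apply: (gronwall_bound t0 (igs t tt) _ mn nM).
  by move=> s st; apply: ltW; apply: hg; exact: (sub t tt s st).
move=> s st; have ss := sub s st; move: (st); rewrite in_itv/= => /andP[s0 sle].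
have sT := le_trans sle tleT.
have hL2 r : r \in `[0, s] -> [/\ L2 Om (K r), L2 Om (et r), L2 Om (curl Om (e r)),
    L2 Om (curl Om (tE r)) & L2 Om (Y r) /\ L2 Om (curl Om (Y r))].
  move=> /ss rT; have [h1 _] := cK r rT; have [h2 _] := cet r rT.
  have [h3 _] := cce r rT; have [h4 _] := ctE r rT; have [h5 _] := cY0 r rT.
  by have [h6 _] := cY r rT.
have htEt r : r \in `[0, s] -> L2 Om (curl Om (tEt r)).
  by move=> /ss rT; have [h _] := ctEt r rT; exact: h.
have hr r : r \in `[0, s] -> 0 < rho r < 1.
  by move=> /ss rT; apply/andP; exact: hrho.
have hgs r : r \in `[0, s] -> 0 < gamma r by move=> /ss; exact: hg.
have EB := energy_balance_C1p oO heps hmu hw pE pEt pY het (lexx 0) s0 sT.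
have mr := measurable_funS (measurable_itv _) ss mrho.
have bs := bounded_measurable_sub (lexx 0) sT bn.
have X1 := error_norm_le_primitive mO heps hmu hL2 htEt EB mr hr.
have X2 := X1 gamma (igs s st) hgs bs s0.
exact: X2.
Qed.

(** Read a = |h_t|^2, b = |curl h|^2, nc = |curl e|^2, ne = |e_t|^2, with q and r the squared
    residuals. The factor rho turns nc into the share present in n, and rho q <= q. *)
Lemma dual_norm_split (R : realFieldType) (a b nc ne q r rho : R) :
  0 <= nc -> 0 <= q -> 0 <= rho -> rho <= 1 ->
  a <= 2 * q + 2 * nc -> b <= 2 * ne + 2 * r ->
  rho * a + b <= 2 * (ne + rho * nc) + 2 * r + 2 * q.
Proof.
move=> nc0 q0 r0 r1 h1 h2; have h3 := ler_wpM2l r0 h1; have h4 := ler_wpM2r q0 r1.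
have := mulr_ge0 r0 q0; lra.
Qed.

Lemma scaled_le_infimum (R : realType) (c n x : R) (i : \bar R) :
  0 <= c -> (n%:E <= i)%E -> ((c * n + x)%:E <= c%:E * i + x%:E)%E.
Proof.
move=> c0 ni; rewrite EFinD EFinM; apply: leeD2r.
by apply: lee_wpmul2l => //; rewrite lee_fin.
Qed.

Lemma triple_split (R : realFieldType) (n m x y : R) :
  m <= 2 * n + x + y -> n + m <= 3 * n + (x + y).
Proof. lra. Qed.

Theorem mainTheorem6 (R : realType) (Om : set (R * R * R)) (T : R)
    (eps mu : mxfield R) (F G : R -> field R) (E0 H0 : field R)
    (E H : R -> field R) (rho : R -> R) (tE tEt tH tHt : R -> field R) :
  lipschitz_domain Om -> 0 < T ->
  coefficient Om eps -> coefficient Om mu ->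
  maxwell_data Om eps mu T F G E0 H0 ->
  maxwell_solution Om eps mu T F G E0 H0 E H ->
  rho_weight T rho ->
  C1p (Hcurl Om) T tE -> C1p (Hcurl Om) T tEt ->
  (forall t, t \in `[0, T] -> mem_fs (Hcurl Om) (tH t) /\ L2 Om (tHt t)) ->
  let e := fun t => E t - tE t in
  let et := fun t => dt Om T E t - tEt t in
  let h := fun t => H t - tH t in
  let ht := fun t => dt Om T H t - tHt t in
  (forall t, t \in `]0, T[ -> mem_fs (Hcurl0 Om) (et t)) ->
  let r := fun t => F t - tEt t + mact (minv eps) (curl Om (tH t)) in
  let q := fun t => G t - tHt t - mact (minv mu) (curl Om (tE t)) in
  let n := fun t =>
    wsqn Om eps (et t) + rho t * wsqn Om (minv mu) (curl Om (e t)) in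
  let nhat := fun t =>
    rho t * wsqn Om mu (ht t) + wsqn Om (minv eps) (curl Om (h t)) in
  let K := fun t => mact eps (dt Om T F t) + curl Om (G t) in
  let f := fun Y gamma t =>
    (gfun Om eps mu T K tE tEt rho Y gamma t +
     (zconst Om eps mu tE Y e et)%:E)%E in
  let infb := fun t =>
    ereal_inf [set b : \bar R | exists (Y : R -> field R) (gamma : R -> R),
      [/\ C1p (Hcurl Om) T Y, gamma_weight T gamma &
          b = bound gamma (f Y gamma) t]] in
  forall t, t \in `[0, T] ->
    [/\ aeq Om (et t - mact (minv eps) (curl Om (h t))) (r t),
        aeq Om (ht t + mact (minv mu) (curl Om (e t))) (q t),
        nhat t <= 2 * n t + 2 * wsqn Om eps (r t) + 2 * wsqn Om mu (q t),
        ((2 * n t + 2 * wsqn Om eps (r t) + 2 * wsqn Om mu (q t))%:E <=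
         2%:E * infb t + (2 * wsqn Om eps (r t) + 2 * wsqn Om mu (q t))%:E)%E &
        ((n t + nhat t)%:E <=
         3%:E * infb t + (2 * wsqn Om eps (r t) + 2 * wsqn Om mu (q t))%:E)%E].
Proof.
move=> [oO _ _] T0 heps hmu data sol hrho pE pEt htH e et h ht het r q n nhat K f infb.
move=> t tT; have mO := open_measurable_R3 oO.
have [[E2 hw] reg] := maxwell_weak_wave oO T0 heps hmu data sol.
have [eqE eqH hH dH2 [F2 G2]] := reg t tT; have [htHt tHt2] := htH t tT.
have [hE _ cE1 _ _] := hw; have [hEt _] := hE t tT.
have [htE _] := pE.1.1 t tT; have [htEt _] := pEt.1.1 t tT.
have [dE2 _] := c1L2_cL2 cE1 tT; have tEt2 := Hcurl_L2 htEt.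
have ctE2 := curl_L2 htE; have ctH2 := curl_L2 htHt; have cH2 := curl_L2 hH.
have et2 : L2 Om (et t) := L2B mO dE2 tEt2.
have ce2 : L2 Om (curl Om (e t)) := curl_L2 (HcurlB mO hEt htE).
have ch2 : L2 Om (curl Om (h t)) := curl_L2 (HcurlB mO hH htHt).
have ht2 : L2 Om (ht t) := L2B mO dH2 tHt2.
have eE : aeq Om (et t - mact (minv eps) (curl Om (h t))) (r t).
  apply: (@aeq_trans _ _ (et t - mact (minv eps) (curl Om (H t) - curl Om (tH t)))).
    by apply: aeqB; [exact: aeqxx|apply: aeq_mact; exact: (curlB oO hH htHt)].
  have -> : r t = F t - (tEt t - mact (minv eps) (curl Om (tH t))).
    by rewrite /r opprB [RHS]addrA [RHS]addrAC.
  by rewrite mactB subACA; apply: aeqB; [exact: eqE|exact: aeqxx].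
have eH : aeq Om (ht t + mact (minv mu) (curl Om (e t))) (q t).
  apply: (@aeq_trans _ _ (ht t + mact (minv mu) (curl Om (E t) - curl Om (tE t)))).
    by apply: aeqD; [exact: aeqxx|apply: aeq_mact; exact: (curlB oO hEt htE)].
  rewrite mactB /ht addrACA addrA /q.
  by apply: aeqB; [apply: aeqB; [exact: eqH|exact: aeqxx]|exact: aeqxx].
have r2 : L2 Om (r t).
  apply: (L2D mO); first exact: (L2B mO F2 tEt2).
  exact: (measurable_mact mO heps.2 ctH2).
have q2 : L2 Om (q t).
  apply: (L2B mO); first exact: (L2B mO G2 tHt2).
  exact: (measurable_mact mO hmu.2 ctE2).
have ice2 := measurable_mact mO hmu.2 ce2; have ich2 := measurable_mact mO heps.2 ch2.
have [r0 r1] := hrho.2 t tT.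
(* The second error equation expresses [ht t] as a difference, whose squared norm costs the factor
   2. *)
have bht : wsqn Om mu (ht t) <= 2 * wsqn Om mu (q t) + 2 * wsqn Om (minv mu) (curl Om (e t)).
  rewrite -(wsqn_mactV mO hmu ce2).
  rewrite (wsqn_aeq (v := q t - mact (minv mu) (curl Om (e t))) mO hmu.1 ht2 (L2B mO q2 ice2)).
    exact: (wsqnB_le mO hmu.1 q2 ice2).
  apply: (aeq_trans _ (aeqB eH (aeqxx _ _))).
  by rewrite addrK; exact: aeqxx.
have bch : wsqn Om (minv eps) (curl Om (h t)) <= 2 * wsqn Om eps (et t) + 2 * wsqn Om eps (r t).
  rewrite -(wsqn_mactV mO heps ch2).
  rewrite (wsqn_aeq (v := et t - r t) mO heps.1 ich2 (L2B mO et2 r2)).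
    exact: (wsqnB_le mO heps.1 et2 r2).
  apply: (aeq_trans _ (aeqB (aeqxx _ (et t)) eE)).
  by rewrite opprB addrC subrK; exact: aeqxx.
have hat : nhat t <= 2 * n t + 2 * wsqn Om eps (r t) + 2 * wsqn Om mu (q t).
  apply: (dual_norm_split _ _ (ltW r0) (ltW r1) bht bch).
    exact: (wsqn_ge0 _ hmu.2).
  exact: (wsqn_ge0 _ hmu.1).
have ninf : ((n t)%:E <= infb t)%E.
  apply: le_ereal_inf_tmp => b [Y [gamma [pY hg ->]]].
  exact: (error_norm_le_bound oO heps hmu hw hrho pE pEt pY het hg tT).
split; [exact: eE|exact: eH|exact: hat| |].
  by rewrite -addrA; apply: scaled_le_infimum.
apply: (le_trans _ (scaled_le_infimum _ _ ninf)); last by [].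
by rewrite lee_fin; apply: triple_split hat.
Qed.
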